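(* Let $V\subseteq\mathbb{A}^n$ be an irreducible $\Delta$-variety over $\mathcal{F}$ (of $\Delta$-dimension $d$) with $$\omega_V(t)=(d+1)\binom{t+m}{m}-\binom{t+m-s}{m}$$ for some $s\in\mathbb{N}$. Then the $\Delta$-Chow form of $V$ exists, and the order of the $\Delta$-Chow form of $V$ is $s$.
   Context: Setting: $m\ge 2$; $\mathcal{F}$ is a field of characteristic $0$ with commuting derivations $\Delta=\{\delta_1,\ldots,\delta_m\}$ (a $\Delta$-field), and $\mathcal{E}$ is a universal $\Delta$-extension field of $\mathcal{F}$. $\Theta$ is the free commutative monoid generated by $\Delta$, $\mathrm{ord}(\prod\delta_i^{e_i})=\sum e_i$. $\mathcal{F}\{\mathbb{Y}\}$ is the $\Delta$-polynomial ring in $\mathbb{Y}=\{y_1,\ldots,y_n\}$; $[S]_R$ is the $\Delta$-ideal generated by $S$ in the $\Delta$-ring $R$; the order of a $\Delta$-polynomial is the maximal order of derivatives appearing in it. $\mathbb{A}^n=\mathcal{E}^n$; a $\Delta$-variety over $\mathcal{F}$ is the zero set in $\mathcal{E}^n$ of a subset of $\mathcal{F}\{\mathbb{Y}\}$; it is irreducible iff $\mathbb{I}(V)\subseteq\mathcal{F}\{\mathbb{Y}\}$, the $\Delta$-ideal of $\Delta$-polynomials vanishing on $V$, is prime. The Kolchin polynomial $\omega_V(t)$ is the numerical polynomial equal, for all large $t$, to the dimension of $\mathbb{I}(V)\cap\mathcal{F}[\theta(y_j):\mathrm{ord}(\theta)\le t,1\le j\le n]$; the $\Delta$-dimension is the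 $\Delta$-transcendence degree over $\mathcal{F}$ of a generic point (it is the coefficient of $\binom{t+m}{m}$ when $\omega_V$ is written in the basis $\binom{t+i}{i}$, so here it is $d$). Binomial coefficients are polynomials in $t$. $\Delta$-Chow form: let $V$ have $\Delta$-dimension $d$ and let $\mathbb{L}_i=u_{i0}+u_{i1}y_1+\cdots+u_{in}y_n$ ($i=0,\ldots,d$), where all $u_{ij}$ are independent $\Delta$-indeterminates, $\mathbf{u}_i=(u_{i0},\ldots,u_{in})$. The $\Delta$-Chow form of $V$ is said to exist if there is an irreducible $\Delta$-polynomial $F(\mathbf{u}_0,\ldots,\mathbf{u}_d)\in\mathcal{F}\{\mathbf{u}_0,\ldots,\mathbf{u}_d\}$ such that $$[\mathbb{I}(V),\mathbb{L}_0,\ldots,\mathbb{L}_d]_{\mathcal{F}\{\mathbb{Y},\mathbf{u}_0,\ldots,\mathbf{u}_d\}}\cap\mathcal{F}\{\mathbf{u}_0,\ldots,\mathbf{u}_d\}=\mathrm{sat}(F),$$ and then $F$ is called the $\Delta$-Chow form of $V$. Here $\mathrm{sat}(F)=\{p:\exists a,b\in\mathbb{N},\ I_F^aS_F^b\,p\in[F]\}$, with $I_F$, $S_F$ the initial and separant of $F$ under a ranking (a total order on derivatives with $\delta_k u>u$ and $u>v\Rightarrow\delta_ku>\delta_kv$): the leader is the highest derivative appearing in $F$, $I_F$ is the coefficient of the highest power of the leader in $F$, $S_F$ the partial derivative of $F$ with respect to its leader. For irreducible $F$, $\mathrm{sat}(F)$ is a prime $\Delta$-ideal, independent of the ranking,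 called the general component of $F$. *)

(* Defs.v *)
From HB Require Import structures.
From mathcomp Require Import all_boot all_order all_algebra.
From mathcomp Require Import finmap.
From mathcomp.multinomials Require Import monalg.

Set Implicit Arguments.
Unset Strict Implicit.
Unset Printing Implicit Defensive.

Import GRing.Theory.
Local Open Scope ring_scope.

HB.mixin Record ComNzRing_isDifferential (m : nat) R of GRing.ComNzRing R := {
  dder : 'I_m -> R -> R;
  dderD : forall k x y, dder k (x + y) = dder k x + dder k y;
  dderM : forall k x y, dder k (x * y) = dder k x * y + x * dder k y;
  dderC : forall k l x, dder k (dder l x) = dder l (dder k x)
}.

#[short(type="diffRingType")]
HB.structure Definition DiffRing m :=
  { R of GRing.ComNzRing R & ComNzRing_isDifferential m R }.

#[short(type="diffFieldType")]
HB.structure Definition DiffField m :=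
  { F of GRing.Field F & ComNzRing_isDifferential m F }.

(* Theta is the free commutative monoid {cmonom 'I_m}, and ord is mdeg. *)
Definition theta m (R : diffRingType m) (t : {cmonom 'I_m}) (x : R) : R :=
  foldr (fun k y => iter (t k) (dder k) y) x (enum 'I_m).

(* The pair (t, i) stands for the derivative t(y_i) of the indeterminate y_i. *)
Definition deriv_of (m : nat) (I : choiceType) : choiceType := ({cmonom 'I_m} * I)%type.

Notation dpoly m R I := {malg R[{cmonom (deriv_of m I)}]} (only parsing).

Section DPoly.
Variables (m : nat) (R : diffRingType m) (I : choiceType).
Local Notation deriv_of := (deriv_of m I).
Local Notation dpoly := {malg R[{cmonom deriv_of}]}.

Definition dshift (k : 'I_m) (v : deriv_of) : deriv_of := (mmul (ucm k) v.1, v.2).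

Definition dvar (i : I) : dpoly := << ucm ((mone, i) : deriv_of) >>.

Definition monder (k : 'I_m) (M : {cmonom deriv_of}) : dpoly :=
  \sum_(v <- finsupp M) << (M v)%:R *g mmul (ucm (dshift k v)) (divcm M (ucm v)) >>.

(* The extension of the derivations of R with delta_k (t y_i) = (delta_k t) y_i. *)
Definition dpoly_der (k : 'I_m) (p : dpoly) : dpoly :=
  \sum_(M <- msupp p) (<< dder k p@_M *g M >> + p@_M *: monder k M).

Lemma dpU a b k l : (<< a *g k >> : dpoly) * << b *g l >> = << a * b *g mmul k l >>.
Proof. exact: (etrans (malgM_def _ _) (fgmulUU _ _ _ _)). Qed.

Lemma dpZ a (p : dpoly) : a *: p = (<< a *g mone >> : dpoly) * p.
Proof. exact: esym (mul_malgC _ _). Qed.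

Lemma dder_add k : zmod_morphism (@dder m R k).
Proof.
have D0 : dder k (0 : R) = 0.
  by have /eqP := dderD k (0 : R) 0; rewrite addr0 addrC -subr_eq subrr eq_sym => /eqP.
move=> x y; rewrite dderD; congr (_ + _).
by apply/eqP; rewrite -addr_eq0 -dderD addrC subrr D0.
Qed.
HB.instance Definition _ k := GRing.isZmodMorphism.Build R R (dder k) (dder_add k).

Lemma dder1 k : dder k (1 : R) = 0.
Proof.
have /eqP := dderM k (1 : R) 1; rewrite !mulr1 mul1r addrC -subr_eq subrr eq_sym.
by move/eqP.
Qed.

Let dterm k (M : {cmonom deriv_of}) (c : R) : dpoly := << dder k c *g M >> + c *: monder k M.

Lemma dpoly_derEw k (p : dpoly) (d : {fset {cmonom deriv_of}}) :
  (msupp p `<=` d)%fset -> dpoly_der k p = \sum_(M <- d) dterm k M p@_M.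
Proof.
move=> le; rewrite [LHS](big_fset_incl _ le) => //= M _ /mcoeff_outdom ->.
by rewrite raddf0 scale0r monalgU0 addr0.
Qed.

Lemma dpoly_derU k c M :
  dpoly_der k << c *g M >> = << dder k c *g M >> + c *: monder k M.
Proof. by rewrite (dpoly_derEw _ msuppU_le) big_seq_fset1 mcoeffUU. Qed.

Lemma dpoly_der_add k : zmod_morphism (dpoly_der k).
Proof.
move=> p q; have le := msuppB_le p q.
rewrite (dpoly_derEw _ le) (dpoly_derEw _ (fsubsetUl (msupp p) (msupp q))).
rewrite (dpoly_derEw _ (fsubsetUr (msupp p) (msupp q))) -sumrB.
apply: eq_bigr => M _; rewrite /dterm mcoeffB raddfB scalerBl.
by rewrite monalgUB addrACA opprD.
Qed.
HB.instance Definition _ k := GRing.isZmodMorphism.Build dpoly dpoly (dpoly_der k) (dpoly_der_add k).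

Lemma monderEw k (M : {cmonom deriv_of}) (d : {fset deriv_of}) :
  (finsupp M `<=` d)%fset -> monder k M = 
  \sum_(v <- d) << (M v)%:R *g mmul (ucm (dshift k v)) (divcm M (ucm v)) >>.
Proof.
move=> le; rewrite [LHS](big_fset_incl _ le) => //= v _.
by rewrite -cmE_eq0 => /eqP->; rewrite monalgU0.
Qed.

Lemma sum_leibniz (A : comNzRingType) (T : Type) (d : seq T) (F G H : T -> A) x y :
  (forall v, H v = F v * x + y * G v) ->
  \sum_(v <- d) H v = (\sum_(v <- d) F v) * x + y * (\sum_(v <- d) G v).
Proof.
by move=> h; rewrite mulr_suml mulr_sumr -big_split; apply: eq_bigr => v _; apply: h.
Qed.

Lemma cm_ext (J : choiceType) (m1 m2 : {cmonom J}) : m1 =1 m2 -> m1 = m2.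
Proof. by move/cmP/eqP. Qed.

Lemma divcm_mull (J : choiceType) (M N : {cmonom J}) v :
  M v != 0%N -> divcm (mmul M N) (ucm v) = mmul (divcm M (ucm v)) N.
Proof.
move=> Mv; apply: cm_ext => w; apply: (etrans (divcmE _ _ _)).
apply: (etrans (f_equal2 subn (cmM w M N) (cmU v w))).
apply: (etrans _ (esym (cmM w _ N))).
apply: (etrans _ (f_equal (addn^~ (N w)) (esym (divcmE M _ w)))).
apply: (etrans _ (f_equal (fun z => M w - z + N w)%N (esym (cmU v w)))).
by case: eqP => [<-|_] /=; rewrite ?subn0 // addnC -addnBA ?lt0n // addnC.
Qed.

Lemma monderM k (M N : {cmonom deriv_of}) :
  monder k (mmul M N) = monder k M * << N >> + << M >> * monder k N.
Proof.
rewrite (@monderEw _ _ (finsupp M `|` finsupp N)%fset) ?mdomD //.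
rewrite (@monderEw k M _ (fsubsetUl _ (finsupp N))).
rewrite (@monderEw k N _ (fsubsetUr (finsupp M) _)).
apply: sum_leibniz => v; rewrite cmM natrD monalgUD; congr (_ + _).
  have [->|Mv] := eqVneq (M v) 0%N; first by rewrite !monalgU0 mul0r.
  by rewrite (divcm_mull _ Mv) mulmA; apply/esym/(etrans (dpU _ _ _ _)); rewrite mulr1.
have [->|Nv] := eqVneq (N v) 0%N; first by rewrite !monalgU0 mulr0.
rewrite (mulmC M N) (divcm_mull _ Nv) mulmA [X in << _ *g X >>]mulmC.
by apply/esym/(etrans (dpU _ _ _ _)); rewrite mul1r.
Qed.

Lemma leibniz_sum (A : comNzRingType) (D : {additive A -> A}) (T : Type)
    (r s : seq T) (f g : T -> A) :
  (forall i j, D (f i * g j) = D (f i) * g j + f i * D (g j)) ->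
  let p := \sum_(i <- r) f i in let q := \sum_(j <- s) g j in
  D (p * q) = D p * q + p * D q.
Proof.
move=> h /=; rewrite !raddf_sum !mulr_suml raddf_sum -big_split.
apply: eq_bigr => i _; rewrite !mulr_sumr raddf_sum -big_split.
by apply: eq_bigr => j _; apply: h.
Qed.

Lemma dpoly_leibniz (D : {additive dpoly -> dpoly}) :
  (forall a b M N, D (<< a *g M >> * << b *g N >>) =
     D << a *g M >> * << b *g N >> + << a *g M >> * D << b *g N >>) ->
  forall p q, D (p * q) = D p * q + p * D q.
Proof.
move=> DM p q; rewrite [q]monalgE [p]monalgE.
by apply: leibniz_sum => M N; apply: DM.
Qed.

Lemma leibniz_alg (K : comNzRingType) (A : comAlgType K) (a b da db : K) (x y dx dy : A) :
  (da * b + a * db) *: (x * y) + (a * b) *: (dx * y + x * dy) =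
  (da *: x + a *: dx) * (b *: y) + (a *: x) * (db *: y + b *: dy).
Proof.
rewrite mulrDl mulrDr -!scalerAl -!scalerAr !scalerA scalerDl scalerDr.
rewrite -!addrA; congr (_ + _); rewrite addrCA; congr (_ + _); rewrite addrC.
Qed.

Lemma dpUZ a M : << a *g M >> = a *: << M >> :> dpoly.
Proof. by rewrite dpZ (dpU a 1 mone M) mulr1 mul1m. Qed.

Lemma dpoly_derZ k a M : dpoly_der k << a *g M >> = dder k a *: << M >> + a *: monder k M.
Proof. by rewrite dpoly_derU dpUZ. Qed.

Lemma dpoly_derM k p q :
  dpoly_der k (p * q) = dpoly_der k p * q + p * dpoly_der k q.
Proof.
apply: (dpoly_leibniz (D := dpoly_der k)) => a b M N.
apply: (etrans (f_equal (dpoly_der k) (dpU a b M N))).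
apply: (etrans (dpoly_derZ _ _ _)); rewrite monderM dderM.
have -> : << mmul M N >> = << M >> * << N >> :> dpoly.
  by apply/esym/(etrans (dpU _ _ _ _)); rewrite mul1r.
apply: (etrans (leibniz_alg _ _ _ _ _ _ _ _)).
apply/esym/(f_equal2 +%R).
  by apply: (f_equal2 *%R (dpoly_derZ _ _ _) (dpUZ _ _)).
by apply: (f_equal2 *%R (dpUZ _ _) (dpoly_derZ _ _ _)).
Qed.

Lemma monder1 k : monder k mone = 0.
Proof. by rewrite /monder mdom1 big_seq_fset0. Qed.

Lemma dpoly_derC k c : dpoly_der k << c *g mone >> = << dder k c *g mone >>.
Proof. by rewrite dpoly_derU monder1 scaler0 addr0. Qed.

Lemma dpoly_derCC k l c :
  dpoly_der k (dpoly_der l << c *g mone >>) = dpoly_der l (dpoly_der k << c *g mone >>).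
Proof.
have E a b : dpoly_der a (dpoly_der b << c *g mone >>) = << dder a (dder b c) *g mone >>.
  exact: (etrans (f_equal (dpoly_der a) (dpoly_derC b c)) (dpoly_derC a _)).
by apply: (etrans (E k l)); rewrite dderC; apply: (esym (E l k)).
Qed.

Lemma dpoly_derV k v : dpoly_der k << ucm v >> = << ucm (dshift k v) >>.
Proof.
apply: (etrans (dpoly_derZ _ _ _)); rewrite dder1 scale0r add0r scale1r.
rewrite /monder mdomU big_seq_fset1 cmUU.
have -> : divcm (ucm v) (ucm v) = mone.
  apply: cm_ext => w; apply: (etrans (divcmE _ _ _)).
  by apply: (etrans (subnn _)); apply/esym/cm1.
by rewrite mulm1.
Qed.

Lemma dshiftC k l v : dshift k (dshift l v) = dshift l (dshift k v).
Proof. by rewrite /dshift /= mulmA (mulmC (ucm k)) -mulmA. Qed.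

Lemma leibnizC (A : comNzRingType) (D1 D2 : {additive A -> A}) :
  (forall p q, D1 (p * q) = D1 p * q + p * D1 q) ->
  (forall p q, D2 (p * q) = D2 p * q + p * D2 q) ->
  forall p q, D1 (D2 p) = D2 (D1 p) -> D1 (D2 q) = D2 (D1 q) ->
  D1 (D2 (p * q)) = D2 (D1 (p * q)).
Proof.
move=> h1 h2 p q hp hq; rewrite h1 h2 !raddfD /= !(h1, h2) hp hq.
by rewrite -!addrA; congr (_ + _); rewrite addrCA; congr (_ + _); rewrite addrCA.
Qed.

Lemma cm_split (J : choiceType) (M : {cmonom J}) v : M v != 0%N ->
  M = mmul (ucm v) (divcm M (ucm v)).
Proof.
move=> Mv; apply: cm_ext => w; apply/esym; apply: (etrans (cmM w _ _)).
apply: (etrans (f_equal2 addn (cmU v w) (divcmE M _ w))).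
apply: (etrans (f_equal (fun z => _ + (M w - z))%N (cmU v w))).
by case: eqP => [<-|_] /=; rewrite ?subn0 // subnKC ?lt0n.
Qed.

Lemma dpoly_derCM k l M :
  dpoly_der k (dpoly_der l << M >>) = dpoly_der l (dpoly_der k << M >>).
Proof.
have [n] := ubnP (mdeg M); elim: n M => [|n IHn] M le_Mn; first by case: (elimF idP (ltn0 (mdeg M)) le_Mn).
have [|[v vM]] := fset_0Vmem (finsupp M).
  move=> M0; have -> : M = mone.
    by apply: mdeg_eq0I; rewrite mdegE M0 big_seq_fset0.
  exact: dpoly_derCC.
have Mv : M v != 0%N by rewrite cmE_neq0.
have EM := cm_split Mv; move: (divcm M (ucm v)) EM => N EM.
have -> : << M >> = << ucm v >> * << N >> :> dpoly.
  by apply/esym/(etrans (dpU _ _ _ _)); rewrite mul1r -EM.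
apply: (leibnizC (D1 := dpoly_der k) (D2 := dpoly_der l)).
- exact: dpoly_derM.
- exact: dpoly_derM.
- by apply: (etrans (f_equal _ (dpoly_derV l v))); apply: (etrans (dpoly_derV k _)); rewrite dshiftC; apply/esym/(etrans (f_equal _ (dpoly_derV k v)))/dpoly_derV.
by apply: IHn; rewrite -ltnS (leq_trans _ le_Mn) // EM mdegM mdegU.
Qed.

Lemma comm_sum (A : zmodType) (D1 D2 : {additive A -> A}) (T : Type) (r : seq T) (f : T -> A) :
  (forall i, D1 (D2 (f i)) = D2 (D1 (f i))) ->
  D1 (D2 (\sum_(i <- r) f i)) = D2 (D1 (\sum_(i <- r) f i)).
Proof. by move=> h; rewrite !raddf_sum; apply: eq_bigr => i _; apply: h. Qed.

Lemma dpoly_der_comm k l p :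
  dpoly_der k (dpoly_der l p) = dpoly_der l (dpoly_der k p).
Proof.
have H c M : dpoly_der k (dpoly_der l << c *g M >>) = dpoly_der l (dpoly_der k << c *g M >>).
  have -> : << c *g M >> = << c *g mone >> * << M >> :> dpoly.
    by apply/esym/(etrans (dpU _ _ _ _)); rewrite mulr1 mul1m.
  apply: (leibnizC (D1 := dpoly_der k) (D2 := dpoly_der l)).
  - exact: dpoly_derM.
  - exact: dpoly_derM.
  - exact: dpoly_derCC.
  exact: dpoly_derCM.
rewrite [p]monalgE; apply: (comm_sum (D1 := dpoly_der k) (D2 := dpoly_der l)) => M.
exact: H.
Qed.

HB.instance Definition _ := ComNzRing_isDifferential.Build m dpoly
  (fun k => raddfD (dpoly_der k)) dpoly_derM dpoly_der_comm.

End DPoly.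

Section DPolyAttributes.
Variables (m : nat) (R : diffRingType m) (I : choiceType).
Local Notation deriv_of := (deriv_of m I).
Local Notation dpoly := {malg R[{cmonom deriv_of}]}.

Definition dvars (p : dpoly) : seq deriv_of :=
  flatten [seq enum_fset (finsupp M) | M : {cmonom deriv_of} <- enum_fset (msupp p)].

Definition dord (p : dpoly) : nat := \max_(v <- dvars p) mdeg v.1.

Definition is_ranking (lt : rel deriv_of) : Prop :=
  [/\ irreflexive lt, transitive lt, (forall u v, u != v -> lt u v || lt v u),
      (forall k u, lt u (dshift k u)) &
      (forall k u v, lt v u -> lt (dshift k v) (dshift k u))].

Definition is_leader (lt : rel deriv_of) (p : dpoly) (u : deriv_of) : Prop :=
  u \in dvars p /\ forall v, v \in dvars p -> v != u -> lt v u.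

Definition ddeg (p : dpoly) (u : deriv_of) : nat := \max_(M <- msupp p) (M u).

(* The coefficient of u ^ (ddeg p u) in p. *)
Definition dinitial (p : dpoly) (u : deriv_of) : dpoly :=
  \sum_(M <- msupp p | M u == ddeg p u)
     << p@_M *g divcm M (expcmn (ucm u) (ddeg p u)) >>.

(* The formal partial derivative of p with respect to u. *)
Definition dseparant (p : dpoly) (u : deriv_of) : dpoly :=
  \sum_(M <- msupp p) << p@_M *+ M u *g divcm M (ucm u) >>.

End DPolyAttributes.

Definition is_dideal m (R : diffRingType m) (J : R -> Prop) : Prop :=
  [/\ J 0, (forall x y, J x -> J y -> J (x + y)), (forall a x, J x -> J (a * x)) &
      (forall k x, J x -> J (dder k x))].

Definition dideal_gen m (R : diffRingType m) (S : R -> Prop) (x : R) : Prop :=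
  forall J : R -> Prop, is_dideal J -> (forall y, S y -> J y) -> J x.

Definition is_prime (R : comNzRingType) (J : R -> Prop) : Prop :=
  ~ J 1 /\ forall x y, J (x * y) -> J x \/ J y.

Definition is_irreducible (R : comNzRingType) (x : R) : Prop :=
  let inv (y : R) := exists z, y * z = 1 in
  [/\ x <> 0, ~ inv x & forall y z, x = y * z -> inv y \/ inv z].

Definition dsat m (R : diffRingType m) (I : choiceType)
    (lt : rel (deriv_of m I)) (G p : dpoly m R I) : Prop :=
  exists u, is_leader lt G u /\
  exists a b, dideal_gen (fun q => q = G) (dinitial G u ^+ a * dseparant G u ^+ b * p).

Definition is_dmorphism m (R S : diffRingType m) (f : R -> S) : Prop :=
  forall k x, f (dder k x) = dder k (f x).

(* The value of p at y_i := a i, the coefficients being mapped to S by f. *)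
Definition deval m (R S : diffRingType m) (I : choiceType) (f : R -> S) (a : I -> S)
    (p : dpoly m R I) : S :=
  mmap f (fun M : {cmonom (deriv_of m I)} => \prod_(v <- finsupp M) theta v.1 (a v.2) ^+ M v) p.

Definition drename m (R : diffRingType m) (I J : choiceType) (h : I -> J)
    (p : dpoly m R I) : dpoly m R J :=
  deval malgC (fun i => dvar R (h i)) p.

(* x belongs to the differential subfield F<A> of E. *)
Definition in_dext m (F E : diffFieldType m) (f : F -> E) (A : E -> Prop) (x : E) : Prop :=
  forall K : E -> Prop,
    [/\ (forall y z, K y -> K z -> K (y - z)), (forall y z, K y -> K z -> K (y * z)),
        (forall y, K y -> K y^-1) & (forall k y, K y -> K (dder k y))] ->
    (forall c, K (f c)) -> (forall y, A y -> K y) -> K x.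

Definition dfin_gen m (F E : diffFieldType m) (f : F -> E) : Prop :=
  exists s : seq E, forall x, in_dext f (fun y => y \in s) x.

(* E is universal over F (Kolchin): every finitely generated extension F2 of a
   finitely generated extension F1 of F inside E embeds in E over F1. *)
Definition is_universal m (F E : diffFieldType m) (iota : {rmorphism F -> E}) : Prop :=
  is_dmorphism iota /\
  forall (F1 : diffFieldType m) (f : {rmorphism F -> F1}) (j : {rmorphism F1 -> E}),
    is_dmorphism f -> is_dmorphism j -> j \o f =1 iota -> dfin_gen f ->
  forall (F2 : diffFieldType m) (g : {rmorphism F1 -> F2}),
    is_dmorphism g -> dfin_gen g ->
  exists h : {rmorphism F2 -> E}, is_dmorphism h /\ h \o g =1 j.

(* For a P stable under subfamilies: d is the largest size of a family in P. *)
Definition max_family (T : Type) (P : forall k, ('I_k -> T) -> Prop) (d : nat) : Prop :=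
  (exists b : 'I_d -> T, P d b) /\ ~ (exists b : 'I_d.+1 -> T, P d.+1 b).

Definition binomial_poly (c : rat) (m : nat) : {poly rat} :=
  (m`!%:R)^-1 *: \prod_(i < m) ('X + (c - i%:R)%:P).

Section Variety.
Variables (m n : nat) (F E : diffFieldType m) (iota : {rmorphism F -> E}).
Implicit Type V : ('I_n -> E) -> Prop.

Definition is_dvariety V : Prop :=
  exists S : dpoly m F 'I_n -> Prop,
    forall a, V a <-> forall p, S p -> deval iota a p = 0.

Definition vanishing V (p : dpoly m F 'I_n) : Prop :=
  forall a, V a -> deval iota a p = 0.

Definition is_generic V (a : 'I_n -> E) : Prop :=
  forall p, vanishing V p <-> deval iota a p = 0.

Definition dindependent k (b : 'I_k -> E) : Prop :=
  forall q : dpoly m F 'I_k, deval iota b q = 0 -> q = 0.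

Definition is_ddim V (d : nat) : Prop :=
  exists a, is_generic V a /\
    max_family (fun k (b : 'I_k -> E) =>
      (forall i, in_dext iota (fun x => exists j, x = a j) (b i)) /\ dindependent b) d.

(* Algebraic independence over F of the residue classes modulo J. *)
Definition alg_independent_mod (J : dpoly m F 'I_n -> Prop) k (b : 'I_k -> dpoly m F 'I_n) : Prop :=
  forall q : {malg F[{cmonom 'I_k}]},
    J (mmap malgC (fun M : {cmonom 'I_k} => \prod_i b i ^+ M i) q) -> q = 0.

(* The dimension of the prime ideal I(V) \cap F[theta(y_j) : ord theta <= t] is the
   transcendence degree over F of the corresponding residue class ring. *)
Definition is_dim_upto V (t k : nat) : Prop :=
  max_family (fun l (b : 'I_l -> dpoly m F 'I_n) =>
    (forall i, (dord (b i) <= t)%N) /\ alg_independent_mod (vanishing V) b) k.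

Definition is_kolchin_poly V (w : {poly rat}) : Prop :=
  exists t0 : nat, forall t : nat, (t0 <= t)%N ->
    exists2 k, is_dim_upto V t k & w.[t%:R] = k%:R.

(* The pair (i, j) stands for the indeterminate u_ij. *)
Definition uvar (d : nat) : choiceType := ('I_d.+1 * 'I_n.+1)%type.

Definition hyperplane (d : nat) (i : 'I_d.+1) : dpoly m F ('I_n + uvar d)%type :=
  dvar F (inr (i, ord0)) +
  \sum_(j < n) dvar F (inr (i, lift ord0 j)) * dvar F (inl j).

Definition chow_ideal V (d : nat) : dpoly m F ('I_n + uvar d)%type -> Prop :=
  dideal_gen (fun q => (exists2 p, vanishing V p & q = drename inl p) \/
                       (exists i : 'I_d.+1, q = hyperplane i)).

Definition is_chow_form V (d : nat) (lt : rel (deriv_of m (uvar d)))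
    (G : dpoly m F (uvar d)) : Prop :=
  is_irreducible G /\ forall p, chow_ideal V (drename inr p) <-> dsat lt G p.

End Variety.

(* Main.v *)
Require Import Defs.
From HB Require Import structures.
From mathcomp Require Import all_boot all_order all_algebra.
From mathcomp Require Import finmap.
From mathcomp.multinomials Require Import monalg.
From Stdlib Require Import Classical ClassicalEpsilon.
From mathcomp Require Import ring lra zify.

(** Let xi be a generic point of V, and send y_j to xi_j, u_ij to itself for j positive, and u_i0 to
    zeta_i = - sum_j u_ij xi_j.  The kernel of this map is the differential ideal generated by I(V)
    and the hyperplanes (chow_kernel): modulo the hyperplanes u_i0 can be eliminated, and the u_ij
    that remain are independent over the field of xi.  So the trace P of this ideal on F{u} is prime,
    being the ideal of relations between the zeta_i and the u_ij.

    The Kolchin function of P is that of V plus the number of derivatives of the u_ij, j positive, of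
    order at most t.  It is not larger because the derivatives of zeta_i of order at most t are
    polynomials in those of the u_ij and of xi (size_BU_upper).  It is not smaller (size_BU_lower)
    because the shape of the Kolchin polynomial of V forces all but d + 1 of the xi_j to be
    algebraic, with all their derivatives, over lower derivatives of the coordinates; the others are
    assigned to distinct hyperplanes, and specialising u_ij to -1 when j is assigned to i, and
    to 0 when it is another coordinate, turns zeta_i into xi_j.  A perturbation argument keeps the u_ij
    independent at the same time (lower_indep).  Hence P has Kolchin function
    (d+1)(n+1) C(t+m,m) - C(t+m-s,m) in (d+1)(n+1) indeterminates.

    In a prime differential ideal, the derivatives that are not leaders, for a ranking that
    compares orders first, form a transcendence basis, so the Kolchin function counts them.  For each
    indeterminate the leaders form an ideal of monomials, with gcd of degree e say.  The counting
    function of the complement is that of the nonmultiples of the gcd, plus a term of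
    lower growth.  Comparison with the Kolchin function of P shows that only one indeterminate has
    leaders, and, as all lower terms must vanish, that its leaders are the
    multiples of the gcd, of degree s (kolchin_structure).  So the leaders of P are the
    derivatives of one v0 of order s.

    Take an irreducible G in P with leader v0 (generator_exists).  Remainders modulo G, by Ritt's reduction, of
    elements of P contain no proper derivative of v0, and eliminating v0 between such a remainder and G
    shows that G divides it.  With Rosenfeld's lemma (rosenfeld) this gives P = sat(G) for any
    ranking (ker_sat), so G is a Chow form, and its order is that of v0, namely s.  Finally sat(G)
    determines G up to a constant (generator_unique), so every Chow form has order s.

    All of this uses that irreducible polynomials in infinitely many variables are prime, which
    comes down to Gauss's theorem (ufd_poly), and the exchange property of algebraic
    dependence (steinitz). *)

Set Implicit Arguments.
Unset Strict Implicit.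
Unset Printing Implicit Defensive.

Import GRing.Theory.
Local Open Scope ring_scope.

(** * Unique factorisation *)

Definition propb (P : Prop) : bool := if excluded_middle_informative P then true else false.
Lemma propbP P : reflect P (propb P).
Proof. by rewrite /propb; case: excluded_middle_informative => h; constructor. Qed.

Lemma fun_choice (I T : Type) (P : I -> T -> Prop) :
  (forall i, exists x, P i x) -> exists f, forall i, P i (f i).
Proof.
move=> h; exists (fun i => proj1_sig (constructive_indefinite_description _ (h i))) => i.
by case: constructive_indefinite_description.
Qed.

Lemma lift_poly (R S : nzRingType) (f : {rmorphism R -> S}) (q : {poly S}) :
  (forall i, exists c, f c = q`_i) -> exists p, map_poly f p = q.
Proof.
move=> /fun_choice [c hc]; exists (\poly_(i < size q) c i); apply/polyP => i.
rewrite coef_map /= coef_poly; case: ltnP => h; first exact: hc.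
by rewrite rmorph0 nth_default.
Qed.

Section Divisibility.
Variable B : comNzRingType.
Implicit Types x y z : B.

Definition dvdr x y := exists z, y = z * x.
Definition invertible x := exists y, x * y = 1.
Definition prime_elt x :=
  [/\ x <> 0, ~ invertible x & forall y z, dvdr x (y * z) -> dvdr x y \/ dvdr x z].

Lemma dvdr_mulr x y z : dvdr x y -> dvdr x (y * z).
Proof. by case=> w ->; exists (w * z); rewrite mulrAC. Qed.

Lemma dvdr_mull x y z : dvdr x z -> dvdr x (y * z).
Proof. by case=> w ->; exists (y * w); rewrite mulrA. Qed.

Lemma dvdrr x : dvdr x x.
Proof. by exists 1; rewrite mul1r. Qed.

Lemma dvdr0 x : dvdr x 0.
Proof. by exists 0; rewrite mul0r. Qed.

Lemma dvdrD x y z : dvdr x y -> dvdr x z -> dvdr x (y + z).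
Proof. by case=> a -> [b ->]; exists (a + b); rewrite mulrDl. Qed.

Lemma dvdrB x y z : dvdr x y -> dvdr x z -> dvdr x (y - z).
Proof. by case=> a -> [b ->]; exists (a - b); rewrite mulrBl. Qed.

Lemma dvdr_trans x y z : dvdr x y -> dvdr y z -> dvdr x z.
Proof. by case=> a -> [b ->]; exists (b * a); rewrite mulrA. Qed.

Lemma invertible1 : invertible 1.
Proof. by exists 1; rewrite mulr1. Qed.

Lemma invertibleM x y : invertible x -> invertible y -> invertible (x * y).
Proof.
by case=> a ha [b hb]; exists (a * b); rewrite mulrACA ha hb mulr1.
Qed.

Lemma prime_prod x (s : seq B) : prime_elt x -> dvdr x (\prod_(q <- s) q) ->
  exists2 q, q \in s & dvdr x q.
Proof.
case=> x0 xu xp; elim: s => [|q s IH]; rewrite ?big_nil ?big_cons.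
  by case=> z e; case: xu; exists z; rewrite mulrC.
case/xp => [h|/IH[q' h1 h2]]; first by exists q; rewrite ?mem_head.
by exists q'; rewrite // inE h1 orbT.
Qed.

Lemma prime_exp x y k : prime_elt x -> dvdr x (y ^+ k) -> dvdr x y.
Proof.
case=> x0 xu xp; elim: k => [|k IH]; rewrite ?expr0 ?exprS.
  by case=> z e; case: xu; exists z; rewrite mulrC.
by case/xp.
Qed.

Definition factors x := exists s : seq B, (forall q, q \in s -> prime_elt q) /\
  exists u, invertible u /\ x = u * \prod_(q <- s) q.

Lemma factorsM x y : factors x -> factors y -> factors (x * y).
Proof.
case=> s [hs [u [hu ->]]] [t [ht [v [hv ->]]]]; exists (s ++ t); split.
  by move=> q; rewrite mem_cat => /orP[/hs|/ht].
exists (u * v); split; first exact: invertibleM.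
by rewrite big_cat mulrACA.
Qed.

Lemma prime_factors x : prime_elt x -> factors x.
Proof.
move=> hx; exists [:: x]; split; first by move=> q; rewrite inE => /eqP->.
by exists 1; split; [exact: invertible1 | rewrite mul1r big_seq1].
Qed.

Lemma invertible_factors x : invertible x -> factors x.
Proof.
by move=> hx; exists [::]; split=> //; exists x; split=> //; rewrite big_nil mulr1.
Qed.

End Divisibility.

Definition is_ufd (B : comNzRingType) := forall x : B, x != 0 -> factors x.

Section Gauss.
Variable B : idomainType.
Implicit Types (p q r : {poly B}).

Lemma prime_div_prime (x y : B) : prime_elt x -> prime_elt y -> dvdr x y -> dvdr y x.
Proof.
move=> [x0 xu xp] [y0 yu yp] [k e].
have [h|[m hm]] : dvdr y k \/ dvdr y x by apply: yp; rewrite -e; apply: dvdrr.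
  case: h => m hm; case: xu; exists m.
  by apply: (mulfI (introN eqP y0)); rewrite mulr1 [in RHS]e hm; ring.
by exists m.
Qed.

Lemma coef_dvd_polyC (x : B) p i : dvdr x%:P p -> dvdr x p`_i.
Proof. by case=> q ->; exists q`_i; rewrite coefMC. Qed.

Lemma invertible_polyC p : invertible p <-> exists2 c, invertible c & p = c%:P.
Proof.
split=> [[q e]|[c [d e] ->]]; last by exists d%:P; rewrite -polyCM e.
have p0 : p != 0 by apply: contra_eq_neq e => ->; rewrite mul0r eq_sym oner_eq0.
have q0 : q != 0 by apply: contra_eq_neq e => ->; rewrite mulr0 eq_sym oner_eq0.
have := congr1 (fun r : {poly B} => size r) e; rewrite size_mul // size_poly1.
move: p0 q0; rewrite -!size_poly_gt0 => p0 q0 hs.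
have /size_poly1P [c c0 pc] : size p == 1.
  by move: p0 q0 hs; case: (size p) => // -[|k]; case: (size q) => // l; rewrite ?addnS.
exists c => //; exists q`_0.
by have := congr1 (fun r : {poly B} => r`_0) e; rewrite pc coefCM coef1.
Qed.

(** Reduction modulo a prime of the coefficient ring is a morphism to polynomials over
    a domain; without the quotient, this is an induction on degrees through the leading
    terms, which are the terms on which primality of the constant can be used. *)
Lemma prime_polyC (x : B) : prime_elt x -> prime_elt x%:P.
Proof.
move=> [x0 xu xp]; split.
- by move/eqP; rewrite polyC_eq0 => /eqP.
- by case/invertible_polyC => c hc /polyC_inj e; apply: xu; rewrite e.
have lead_tail p : p = lead_coef p *: 'X^((size p).-1) + take_poly (size p).-1 p.
  have [->|p0] := eqVneq p 0; first by apply/polyP => i; rewrite lead_coef0 scale0r add0r coef_take_poly coef0 if_same.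
  apply/polyP => i; rewrite coefD coefZ coefXn coef_take_poly lead_coefE.
  case: ltngtP => [h|h|->]; rewrite ?mulr0 ?mulr1 ?add0r ?addr0 //.
  by rewrite nth_default //; case: (size p) h.
have step p : p != 0 -> dvdr x (lead_coef p) -> exists p',
    [/\ (size p' < size p)%N, dvdr x%:P (p - p') & p = lead_coef p *: 'X^((size p).-1) + p'].
  move=> p0 h; exists (take_poly (size p).-1 p); split=> //.
    apply: leq_ltn_trans (size_take_poly _ _) _.
    by rewrite prednK // size_poly_gt0.
  rewrite {1}(lead_tail p) addrK; case: h => z ->.
  by exists (z *: 'X^((size p).-1)); rewrite -mul_polyC -mul_polyC polyCM; ring.
move=> p q; have [n] := ubnP (size p + size q); elim: n p q => // n IH p q le_n hpq.
have [->|p0] := eqVneq p 0; first by left; apply: dvdr0.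
have [->|q0] := eqVneq q 0; first by right; apply: dvdr0.
have : dvdr x (lead_coef p * lead_coef q).
  by rewrite -lead_coefM lead_coefE; apply: coef_dvd_polyC.
case/xp => h.
  have [p' [h1 h2 _]] := step p p0 h.
  have [] := IH p' q.
  - by rewrite ltnS in le_n; apply: leq_trans le_n; rewrite ltn_add2r.
  - have -> : p' * q = p * q - (p - p') * q by ring.
    by apply: dvdrB => //; apply: dvdr_mulr.
  - by left; rewrite -(subrK p' p); apply: dvdrD.
  by right.
have [q' [h1 h2 _]] := step q q0 h.
have [] := IH p q'.
- by rewrite ltnS in le_n; apply: leq_trans le_n; rewrite ltn_add2l.
- have -> : p * q' = p * q - p * (q - q') by ring.
  by apply: dvdrB => //; apply: dvdr_mull.
- by left.
by right; rewrite -(subrK q' q); apply: dvdrD.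
Qed.

Hypothesis facB : is_ufd B.

(** Gauss's lemma in the form used below: a constant factor of a product of two
    polynomials can be distributed over the two factors, one prime at a time. *)
Lemma scale_split (c : B) (a p r : {poly B}) : c != 0 -> c *: a = p * r ->
  exists c1 c2 p' r', [/\ c1 != 0, c2 != 0, p = c1 *: p', r = c2 *: r' & a = p' * r'].
Proof.
move=> c0 e; have [s [hs [u [[w uw] ce]]]] := facB c0.
have {c0 e}: (u * \prod_(q <- s) q) *: a = p * r by rewrite -ce.
have u0 : u != 0 by apply: contra_eq_neq uw => ->; rewrite mul0r eq_sym oner_eq0.
clear ce; elim: s p r hs => [|q s IH] p r hs e.
  exists u, 1, (w *: p), r; split; rewrite ?oner_eq0 ?scale1r //.
    by rewrite scalerA uw scale1r.
  by rewrite -scalerAl -e big_nil mulr1 scalerA mulrC uw scale1r.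
have hq : prime_elt q by apply: hs; rewrite mem_head.
have hs' (j : B) : j \in s -> prime_elt j by move=> h; apply: hs; rewrite inE h orbT.
have q0 : q != 0 by case: hq => /eqP.
have qP0 : q%:P != 0 by rewrite polyC_eq0.
have [_ _ hqP] := prime_polyC hq.
have e' : p * r = q *: ((u * \prod_(j <- s) j) *: a).
  by rewrite -e big_cons scalerA; congr (_ *: _); ring.
have [[p1 e1]|[r1 e1]] : dvdr q%:P p \/ dvdr q%:P r.
- by apply: hqP; rewrite e' -mul_polyC; apply/dvdr_mulr/dvdrr.
- have [|c1 [c2 [p' [r' [h1 h2 h3 h4 h5]]]]] := IH p1 r hs'.
    apply: (mulfI qP0); rewrite mul_polyC -e' e1; ring.
  exists (q * c1), c2, p', r'; split; rewrite ?mulf_neq0 //.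
  by rewrite e1 h3 mulrC mul_polyC scalerA.
have [|c1 [c2 [p' [r' [h1 h2 h3 h4 h5]]]]] := IH p r1 hs'.
  apply: (mulfI qP0); rewrite mul_polyC -e' e1; ring.
exists c1, (q * c2), p', r'; split; rewrite ?mulf_neq0 //.
by rewrite e1 h4 mulrC mul_polyC scalerA.
Qed.

Lemma size_not_invertible p : (1 < size p)%N -> ~ invertible p.
Proof.
by move=> h /invertible_polyC [c _ e]; move: h; rewrite e ltnNge size_polyC_leq1.
Qed.

Lemma irr_dvd_scale p (b h : {poly B}) (c : B) : (1 < size p)%N -> is_irreducible p ->
  c != 0 -> c *: b = h * p -> dvdr p b.
Proof.
move=> sp [p0 _ pirr] c0 e.
have [c1 [c2 [h' [p' [h1 h2 e1 e2 ->]]]]] := scale_split c0 e.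
have [||[d e3]] := pirr c2%:P p'; first by rewrite mul_polyC.
  case=> d e3; exists (h' * d); rewrite e2 -mul_polyC -mulrA; congr (_ * _).
  by rewrite mulrA [d * _]mulrC e3 mul1r.
by case: (@size_not_invertible p'); [move: sp; rewrite e2 size_scale | exists d].
Qed.

(** Let p be irreducible and divide a b.  Division with a scalar correction decides
    whether p and a are coprime over the fraction field.  If so, p divides a multiple
    of b by a constant; if not, a gcd is a nonconstant factor of p up to a constant,
    hence p itself divides a multiple of a by a constant.  The constants are then
    removed by Gauss's lemma. *)
Lemma irr_prime p : (1 < size p)%N -> is_irreducible p -> prime_elt p.
Proof.
move=> sp ip; have [p0 pu pirr] := ip; split=> // a b [z e].
have hp : Pdiv.Idomain.dvdp p (a * b).
  by apply/Pdiv.Idomain.dvdpP; exists (1, z); rewrite ?oner_eq0 // scale1r.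
have [cop|ncop] := boolP (Pdiv.Idomain.coprimep p a).
  right; move: hp; rewrite Pdiv.Idomain.Gauss_dvdpr // => /Pdiv.Idomain.dvdpP [[c h] /= c0 eb].
  exact: irr_dvd_scale eb.
left; set g := Pdiv.Idomain.gcdp p a in ncop *.
have /Pdiv.Idomain.dvdpP [[c h] /= c0 e1] := Pdiv.Idomain.dvdp_gcdl p a.
have /Pdiv.Idomain.dvdpP [[c' k] /= c'0 e2] := Pdiv.Idomain.dvdp_gcdr p a.
simpl in c0, c'0, e1, e2; rewrite -/g in e1 e2.
have [c1 [c2 [h' [g' [h1 h2 e3 e4 e5]]]]] := scale_split c0 e1.
have g0 : g != 0.
  apply: contra_not_neq p0 => g0; apply/eqP; move/eqP: e1.
  by rewrite g0 mulr0 -mul_polyC mulf_eq0 polyC_eq0 (negPf c0).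
have sg : (1 < size g')%N.
  have := ncop; rewrite Pdiv.Idomain.coprimep_def -/g.
  move: g0; rewrite -size_poly_gt0 e4 size_scale //.
  by case: (size g') => // -[].
have [[d hd]|] := pirr _ _ e5; last by move/(size_not_invertible sg).
apply: (@irr_dvd_scale p a (c2 *: (k * d)) c') => //.
rewrite e2 e4 e5 -!mul_polyC.
by transitivity (k * (c2%:P * g') * (h' * d)); [rewrite hd mulr1 | ring].
Qed.

(** Induction on the size.  A polynomial that does not split into two smaller ones
    loses the primes of its leading coefficient that divide it, and what remains is
    irreducible, hence prime. *)
Lemma ufd_poly : is_ufd {poly B}.
Proof.
move=> x; have [n] := ubnP (size x); elim: n x => // n IHn x le_n x0.
have polyC_factors (c : B) : c != 0 -> factors c%:P.
  move=> c0; have [s [hs [u [hu ->]]]] := facB c0.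
  exists (map polyC s); split.
    by move=> q /mapP [q' /hs hq ->]; apply: prime_polyC.
  exists u%:P; split; first by apply/invertible_polyC; exists u.
  by rewrite polyCM rmorph_prod big_map.
have [s1|s1] := leqP (size x) 1.
  by move: x0; rewrite (size1_polyC s1) polyC_eq0; apply: polyC_factors.
have [[y [z [ey sy sz]]]|nsplit] := classic (exists y z,
    [/\ x = y * z, (size y < size x)%N & (size z < size x)%N]).
  have y0 : y != 0 by apply: contra_neq x0 => y0; rewrite ey y0 mul0r.
  have z0 : z != 0 by apply: contra_neq x0 => z0; rewrite ey z0 mulr0.
  rewrite ltnS in le_n.
  by rewrite ey; apply: factorsM; apply: IHn => //; apply: leq_trans le_n.
have [s [hs [u [hu es]]]] : factors (lead_coef x) by apply: facB; rewrite lead_coef_eq0.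
(* t collects the primes of the leading coefficient already known not to divide x. *)
pose t : seq B := [::].
have ht (j : B) : j \in t -> prime_elt j by [].
have hnt (j : B) : j \in t -> ~ dvdr j%:P x by [].
have {}es : lead_coef x = u * \prod_(q <- s) q * \prod_(q <- t) q by rewrite big_nil mulr1.
move: t ht hnt es; clear le_n.
elim: s x x0 hs s1 nsplit => [|q s IHs] x x0 hs s1 nsplit t ht hnt es; last first.
  have hq : prime_elt q by apply: hs; rewrite mem_head.
  have hs' (j : B) : j \in s -> prime_elt j by move=> h; apply: hs; rewrite inE h orbT.
  have q0 : q != 0 by case: hq => /eqP.
  have [[x' ex]|nd] := classic (dvdr q%:P x); last first.
    apply: (IHs x x0 hs' s1 nsplit (q :: t)).
    - by move=> q'; rewrite inE => /orP[/eqP->|/ht].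
    - by move=> q'; rewrite inE => /orP[/eqP->|/hnt].
    by rewrite es !big_cons; ring.
  rewrite mulrC mul_polyC in ex.
  have sx : size x = size x' by rewrite ex size_scale.
  rewrite ex -mul_polyC; apply: factorsM; first exact: polyC_factors.
  apply: (IHs x' _ hs' _ _ t ht).
  - by apply: contra_neq x0 => x'0; rewrite ex x'0 scaler0.
  - by rewrite -sx.
  - case=> y [z [e h1 h2]]; apply: nsplit; exists (q *: y), z.
    by rewrite size_scale // sx; split=> //; rewrite ex e scalerAl.
  - by move=> q' /hnt h h'; apply: h; rewrite ex -mul_polyC; apply: dvdr_mull.
  apply: (mulfI q0); rewrite -lead_coefZ -ex es big_cons; ring.
apply/prime_factors/irr_prime => //.
have const_inv (y : B) z : x = y%:P * z -> invertible y.
  move=> e; have y0 : y != 0 by apply: contra_neq x0 => y0; rewrite e y0 mul0r.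
  have [s' [hs' [v [hv ey]]]] := facB y0.
  case: s' => [|r s'] in hs' ey; first by rewrite ey big_nil mulr1.
  have hr : prime_elt r by apply: hs'; rewrite mem_head.
  have [_ _ hrp] := hr.
  have rx : dvdr r%:P x.
    rewrite e ey big_cons !polyCM; exists (v%:P * (\prod_(j <- s') j)%:P * z); ring.
  have : dvdr r (lead_coef x) by rewrite lead_coefE; apply: coef_dvd_polyC.
  rewrite es big_nil mulr1 => /hrp [].
    by case=> w ew; case: hr => _ nu _; case: nu; case: hu => w' e'; exists (w * w'); rewrite -e' ew; ring.
  case/(prime_prod hr) => q hq rq; case: (hnt q hq).
  apply: dvdr_trans rx; have [w ->] := prime_div_prime hr (ht q hq) rq.
  by exists w%:P; rewrite polyCM.
split.
- exact/eqP.
- exact: size_not_invertible.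
move=> y z e.
have y0 : y != 0 by apply: contra_neq x0 => y0; rewrite e y0 mul0r.
have z0 : z != 0 by apply: contra_neq x0 => z0; rewrite e z0 mulr0.
have sxyz : size x = (size y + size z).-1 by rewrite e size_mul.
have [sy|sy] := leqP (size y) 1.
  left; apply/invertible_polyC; exists y`_0; last exact: size1_polyC.
  by apply: (const_inv _ z); rewrite -size1_polyC.
have [sz|sz] := leqP (size z) 1.
  right; apply/invertible_polyC; exists z`_0; last exact: size1_polyC.
  by apply: (const_inv _ y); rewrite -size1_polyC // mulrC.
case: nsplit; exists y, z; split=> //; rewrite sxyz.
  by rewrite -ltnS prednK ?addn_gt0 ?(ltnW sy) //; move: sz; case: (size z) => // -[] // k _; rewrite !addnS ltnS leq_addr.
by rewrite -ltnS prednK ?addn_gt0 ?(ltnW sy) //; move: sy; case: (size y) => // -[] // k _; rewrite !addSn !ltnS leq_addl.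
Qed.
End Gauss.

(** * Polynomial rings through their universal property *)

Section VarsIn.
Variables (W : Type) (R A : comNzRingType) (C : {rmorphism R -> A}) (X : W -> A).
Implicit Types (T : W -> Prop) (p q : A).

(** vin T p: p is a polynomial in the variables of T.  The inductive form lets every
    property preserved by sums and products be proved by induction, for any
    presentation of the polynomial ring. *)
Inductive vin T : A -> Prop :=
| vinC c : vin T (C c)
| vinX v : T v -> vin T (X v)
| vinD x y : vin T x -> vin T y -> vin T (x + y)
| vinM x y : vin T x -> vin T y -> vin T (x * y).

Lemma vin0 T : vin T 0. Proof. by rewrite -(rmorph0 C); apply: vinC. Qed.
Lemma vin1 T : vin T 1. Proof. by rewrite -(rmorph1 C); apply: vinC. Qed.

Lemma vinN T p : vin T p -> vin T (- p).
Proof. by move=> h; rewrite -mulN1r -(rmorphN1 C); apply: vinM => //; apply: vinC. Qed.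

Lemma vinB T p q : vin T p -> vin T q -> vin T (p - q).
Proof. by move=> hp hq; apply: vinD => //; apply: vinN. Qed.

Lemma vin_exp T p k : vin T p -> vin T (p ^+ k).
Proof.
by move=> hp; elim: k => [|k IH]; rewrite ?expr0 ?exprS; [apply: vin1|apply: vinM].
Qed.

Lemma vin_sum T (I : Type) (r : seq I) (P : pred I) (F : I -> A) :
  (forall i, P i -> vin T (F i)) -> vin T (\sum_(i <- r | P i) F i).
Proof. by move=> h; apply: big_ind => //; [apply: vin0 | apply: vinD]. Qed.

Lemma vin_natmul T p k : vin T p -> vin T (p *+ k).
Proof. by move=> hp; rewrite -mulr_natr -(rmorph_nat C); apply: vinM => //; apply: vinC. Qed.

Lemma vinW T T' p : vin T p -> (forall v, T v -> T' v) -> vin T' p.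
Proof.
move=> hp h; elim: hp => [c|v /h|x y _ h1 _ h2|x y _ h1 _ h2].
- exact: vinC.
- exact: vinX.
- exact: vinD.
exact: vinM.
Qed.

Lemma vin_hom_eq (S : nzRingType) (f g : {rmorphism A -> S}) T p : vin T p ->
  (forall c, f (C c) = g (C c)) -> (forall v, T v -> f (X v) = g (X v)) -> f p = g p.
Proof.
move=> hp h1 h2; elim: hp => // x y _ e1 _ e2; first by rewrite !rmorphD e1 e2.
by rewrite !rmorphM e1 e2.
Qed.

Lemma vin_const T p : vin T p -> (forall v, ~ T v) -> exists c, p = C c.
Proof.
move=> vp nT; elim: vp => [c|v /nT//|x y _ [a ->] _ [b ->]|x y _ [a ->] _ [b ->]].
- by exists c.
- by exists (a + b); rewrite rmorphD.
by exists (a * b); rewrite rmorphM.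
Qed.
End VarsIn.

(** A is the polynomial ring over R in the variables X.  All arguments use only this
    characterisation: the rings of the problem have unwieldy concrete terms, and
    several polynomial rings, over different fields, occur at the same time. *)
Record polyring (W : choiceType) (R A : comNzRingType) (C : {rmorphism R -> A})
    (X : W -> A) : Prop := PolyRing {
  pr_gen : forall p, vin C X (fun=> True) p;
  pr_ev : forall (S : comNzRingType) (f : {rmorphism R -> S}) (x : W -> S),
    exists phi : {rmorphism A -> S}, (forall c, phi (C c) = f c) /\ (forall v, phi (X v) = x v)
}.

Section PolyRing.
Variables (W : choiceType) (R A : comNzRingType) (C : {rmorphism R -> A}) (X : W -> A).
Hypothesis H : polyring C X.
Implicit Types (T : W -> Prop) (p q : A) (v w : W).
Local Notation vin := (vin C X).

Section Ev.
Variables (S : comNzRingType) (f : {rmorphism R -> S}) (x : W -> S).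
Definition ev : {rmorphism A -> S} :=
  proj1_sig (constructive_indefinite_description _ (pr_ev H f x)).

Lemma evC c : ev (C c) = f c.
Proof. by rewrite /ev; case: constructive_indefinite_description => phi []. Qed.

Lemma evX v : ev (X v) = x v.
Proof. by rewrite /ev; case: constructive_indefinite_description => phi []. Qed.
End Ev.

Lemma vin_fin T p : vin T p -> exists s : seq W, (forall v, v \in s -> T v) /\ vin (fun v => v \in s) p.
Proof.
elim=> [c|v Tv|x y _ [s [hs sx]] _ [t [ht ty]]|x y _ [s [hs sx]] _ [t [ht ty]]].
- by exists [::]; split => //; apply: vinC.
- exists [:: v]; split; first by move=> w; rewrite inE => /eqP->.
  by apply: vinX; rewrite mem_head.
- exists (s ++ t); split; first by move=> w; rewrite mem_cat => /orP[/hs|/ht].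
  by apply: vinD; [apply: vinW sx _|apply: vinW ty _] => w; rewrite mem_cat => ->; rewrite ?orbT.
exists (s ++ t); split; first by move=> w; rewrite mem_cat => /orP[/hs|/ht].
by apply: vinM; [apply: vinW sx _|apply: vinW ty _] => w; rewrite mem_cat => ->; rewrite ?orbT.
Qed.

Lemma hom_eq (S : nzRingType) (f g : {rmorphism A -> S}) p :
  (forall c, f (C c) = g (C c)) -> (forall v, f (X v) = g (X v)) -> f p = g p.
Proof. by move=> h1 h2; apply: (vin_hom_eq (pr_gen H p)). Qed.

Lemma C_inj : injective C.
Proof.
move=> c d e; pose f : {rmorphism R -> R} := idfun.
by rewrite -[c](evC f (fun=> 0)) e evC.
Qed.

Definition keep (P : pred W) : {rmorphism A -> A} := ev C (fun v => if P v then X v else 0).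

Lemma keep_vin (P : pred W) T p : vin T p -> vin (fun v => P v /\ T v) (keep P p).
Proof.
elim=> [c|v Tv|x y _ hx _ hy|x y _ hx _ hy].
- by rewrite evC; apply: vinC.
- by rewrite evX; case: ifP => Pv; [apply: vinX | apply: vin0].
- by rewrite rmorphD; apply: vinD.
by rewrite rmorphM; apply: vinM.
Qed.

(** p viewed as a polynomial in the single variable v.  The other variables stay in A
    rather than in a smaller ring, so that no change of ring is needed; uni_coef_vin
    records that v has left the coefficients. *)
Definition uni v : {rmorphism A -> {poly A}} :=
  ev (@polyC A \o C) (fun w => if w == v then 'X else (X w)%:P).

Lemma uniC v c : uni v (C c) = (C c)%:P.
Proof. exact: evC. Qed.

Lemma uniX v : uni v (X v) = 'X.
Proof. by rewrite evX eqxx. Qed.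

Lemma uniXn v w : w != v -> uni v (X w) = (X w)%:P.
Proof. by rewrite evX => /negPf->. Qed.

Lemma uniK v p : (uni v p).[X v] = p.
Proof.
elim: (pr_gen H p) => [c|w _|x y _ hx _ hy|x y _ hx _ hy].
- by rewrite uniC hornerC.
- by have [->|h] := eqVneq w v; rewrite ?uniX ?hornerX // uniXn // hornerC.
- by rewrite rmorphD hornerD hx hy.
by rewrite rmorphM hornerM hx hy.
Qed.

Lemma uni_inj v : injective (uni v).
Proof. by move=> p q h; rewrite -(uniK v p) h uniK. Qed.

Lemma uni_eq0 v p : (uni v p == 0) = (p == 0).
Proof. by rewrite -(rmorph0 (uni v)) (inj_eq (@uni_inj v)). Qed.

Lemma uni_coef_vin v T p i : vin T p -> vin (fun w => T w /\ w <> v) (uni v p)`_i.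
Proof.
move=> hp; move: i; elim: hp => [c|w Tw|x y _ hx _ hy|x y _ hx _ hy] i.
- by rewrite uniC coefC; case: eqP => _; [apply: vinC|apply: vin0].
- have [->|h] := eqVneq w v.
    by rewrite uniX coefX; case: (_ == _); [apply: vin1|apply: vin0].
  rewrite uniXn // coefC; case: eqP => _; last exact: vin0.
  by apply: vinX; split=> //; apply/eqP.
- by rewrite rmorphD coefD; apply: vinD.
by rewrite rmorphM coefM; apply: vin_sum => j _; apply: vinM.
Qed.

Lemma uni_const v T p : vin T p -> ~ T v -> uni v p = p%:P.
Proof.
move=> hp hT; elim: hp => [c|w Tw|x y _ hx _ hy|x y _ hx _ hy]; first by rewrite uniC.
- by apply: uniXn; apply: contra_notN hT => /eqP <-.
- by rewrite rmorphD hx hy polyCD.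
by rewrite rmorphM hx hy polyCM.
Qed.

Lemma uni_size1 v T p : vin T p -> (size (uni v p) <= 1)%N -> vin (fun w => T w /\ w <> v) p.
Proof.
move=> hp h; rewrite -(uniK v p) (size1_polyC h) hornerC; exact: uni_coef_vin.
Qed.

Lemma uni_horner v (q : {poly A}) : (forall i, vin (fun w => w <> v) q`_i) -> uni v q.[X v] = q.
Proof.
move=> h; rewrite horner_coef raddf_sum /= -[RHS]coefK poly_def; apply: eq_bigr => i _.
by rewrite rmorphM rmorphXn /= uniX (uni_const (h i)) // mul_polyC.
Qed.

Lemma uni_sum v (I : Type) (r : seq I) (c : I -> A) (e : I -> nat) :
  (forall i, vin (fun w => w <> v) (c i)) ->
  uni v (\sum_(i <- r) c i * X v ^+ e i) = \sum_(i <- r) (c i)%:P * 'X^(e i).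
Proof.
move=> h; rewrite raddf_sum; apply: eq_bigr => i _ /=.
by rewrite rmorphM rmorphXn /= uniX (uni_const (h i)).
Qed.
End PolyRing.

(** * Factorisation and elimination in polynomial rings over a field *)

Definition is_domain (A : comNzRingType) := forall x y : A, x * y = 0 -> x = 0 \/ y = 0.

Section FractionField.
Variables (A : comNzRingType).

(** The hypothesis that A is a domain is only a proposition; the alias carries it, so that
    the fraction field construction, which expects a structure, applies. *)
Definition domain_alias of is_domain A := GRing.ComNzRing.sort A.
Variable domA : is_domain A.
HB.instance Definition _ := GRing.ComNzRing.on (domain_alias domA).

Definition dom_unit : pred (domain_alias domA) :=
  fun x => propb (exists y, y * x = 1).
Definition dom_inv (x : domain_alias domA) : domain_alias domA :=
  match excluded_middle_informative (exists y, y * x = 1) with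
  | left h => proj1_sig (constructive_indefinite_description _ h)
  | right _ => x
  end.

Lemma dom_mulVx : {in dom_unit, left_inverse 1 dom_inv *%R}.
Proof.
move=> x /propbP; rewrite /dom_inv; case: excluded_middle_informative => // h _.
by case: constructive_indefinite_description.
Qed.

Lemma dom_unitP x y : y * x = 1 -> dom_unit x.
Proof. by move=> e; apply/propbP; exists y. Qed.

Lemma dom_inv_out : {in [predC dom_unit], dom_inv =1 id}.
Proof.
by move=> x /propbP nx; rewrite /dom_inv; case: excluded_middle_informative.
Qed.

HB.instance Definition _ := GRing.ComNzRing_hasMulInverse.Build (domain_alias domA)
  dom_mulVx dom_unitP dom_inv_out.

Lemma dom_integral (x y : domain_alias domA) : x * y = 0 -> (x == 0) || (y == 0).
Proof. by case/domA => ->; rewrite eqxx ?orbT. Qed.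

HB.instance Definition _ := GRing.ComUnitRing_isIntegral.Build (domain_alias domA) dom_integral.

Lemma embed_in_field : exists (L : fieldType) (j : {rmorphism A -> L}), injective j.
Proof.
exists {fraction (domain_alias domA)}.
exists (@tofrac (domain_alias domA) : {rmorphism (domain_alias domA) -> _}).
by move=> x y /eqP; rewrite tofrac_eq => /eqP.
Qed.
End FractionField.

Section FieldPoly.
Variables (W : choiceType) (K : fieldType) (A : comNzRingType) (C : {rmorphism K -> A}) (X : W -> A).
Hypothesis H : polyring C X.
Implicit Types (T : W -> Prop) (p q : A) (v w : W).
Local Notation vin := (vin C X).

(** The polynomials in finitely many variables form an iterated univariate ring over a
    field, hence a factorial ring: this is how factorisation reaches infinitely many
    variables, since a computation involves only finitely many of them. *)
Lemma tower (s : seq W) : uniq s -> exists (B : idomainType) (iota : {rmorphism B -> A}),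
  [/\ injective iota, (forall p, vin (fun v => v \in s) p <-> exists b, iota b = p) & is_ufd B].
Proof.
elim: s => [_|v s IH /= /andP[vs /IH [B [i [inji imi facB]]]]].
  exists K, C; split; first exact: (C_inj H).
    move=> p; split=> [|[c <-]]; last exact: vinC.
    elim=> [c|//|x y _ [a <-] _ [b <-]|x y _ [a <-] _ [b <-]]; first by exists c.
      by exists (a + b); rewrite rmorphD.
    by exists (a * b); rewrite rmorphM.
  move=> x x0; apply: invertible_factors; exists x^-1; exact: divff.
pose i' : {rmorphism {poly B} -> A} := (horner_eval (X v) \o map_poly i).
have i'E b : i' b = (map_poly i b).[X v] by [].
have coef_i b k : vin (fun w => w \in s) (map_poly i b)`_k.
  by apply/imi; exists b`_k; rewrite coef_map.
have uni_i b : uni H v (i' b) = map_poly i b.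
  rewrite i'E uni_horner // => k; apply: vinW (coef_i b k) _ => w ws e.
  by move: vs; rewrite -e ws.
exists {poly B}, i'; split.
- move=> b b' e; apply: (map_inj_poly inji (rmorph0 i)).
  by rewrite -!uni_i e.
- move=> p; split=> [hp|[b <-]]; last first.
    rewrite i'E horner_coef; apply: vin_sum => k _; apply: vinM.
      by apply: vinW (coef_i b k) _ => w ws; rewrite inE ws orbT.
    by apply/vin_exp/vinX; rewrite mem_head.
  have hc k : exists b, i b = (uni H v p)`_k.
    apply/imi; apply: vinW (uni_coef_vin H v k hp) _ => w [].
    by rewrite inE => /orP[/eqP|].
  have [b eb] := lift_poly hc.
  by exists b; rewrite i'E eb uniK.
exact: ufd_poly.
Qed.

Lemma tower_of (l : seq A) : exists s : seq W, uniq s /\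
  forall p, p \in l -> vin (fun v => v \in s) p.
Proof.
elim: l => [|p l [s [us hs]]]; first by exists [::].
have [t [_ ht]] := vin_fin (pr_gen H p).
exists (undup (t ++ s)); split; first exact: undup_uniq.
move=> q; rewrite inE => /orP[/eqP->|/hs hq].
  by apply: vinW ht _ => v; rewrite mem_undup mem_cat => ->.
by apply: vinW hq _ => v; rewrite mem_undup mem_cat => ->; rewrite orbT.
Qed.

Lemma poly_domain : is_domain A.
Proof.
move=> x y e; have [s [us hs]] := tower_of [:: x; y].
have [B [i [inji imi _]]] := tower us.
have [|a ea] := (imi x).1; first by apply: hs; rewrite mem_head.
have [|b eb] := (imi y).1; first by apply: hs; rewrite !inE eqxx orbT.
move: e; rewrite -ea -eb -rmorphM -(rmorph0 i) => /inji/eqP.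
by rewrite mulf_eq0 => /orP[/eqP->|/eqP->]; [left|right]; rewrite rmorph0.
Qed.

Lemma poly_mulf_neq0 p q : p != 0 -> q != 0 -> p * q != 0.
Proof.
by move=> p0 q0; apply/eqP => /poly_domain [/eqP|/eqP]; apply/negP.
Qed.

Lemma poly_mulfI p : p != 0 -> injective ( *%R p).
Proof.
move=> p0 x y /eqP; rewrite -subr_eq0 -mulrBr => /eqP /poly_domain [/eqP|/eqP].
  by rewrite (negPf p0).
by rewrite subr_eq0 => /eqP.
Qed.

Lemma size_uniM v p q : p != 0 -> q != 0 ->
  size (uni H v (p * q)) = (size (uni H v p) + size (uni H v q)).-1.
Proof.
move=> p0 q0; rewrite rmorphM size_proper_mul // poly_mulf_neq0 //.
  by rewrite lead_coef_eq0 uni_eq0.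
by rewrite lead_coef_eq0 uni_eq0.
Qed.

Lemma size_uni_gt0 v p : p != 0 -> (0 < size (uni H v p))%N.
Proof. by rewrite size_poly_gt0 uni_eq0. Qed.

Lemma vin_avoid v T p : vin T p -> ~ T v -> (size (uni H v p) <= 1)%N.
Proof. by move=> h1 h2; rewrite (uni_const H h1 h2) size_polyC_leq1. Qed.

Lemma vin_all T p : (forall v, ~ T v -> (size (uni H v p) <= 1)%N) -> vin T p.
Proof.
move=> h; have [s [_ hs]] := vin_fin (pr_gen H p).
suff key (t : seq W) : {subset t <= s} -> vin (fun w => w \in s /\ (w \in t -> T w)) p.
  have {}key := key s (fun w hw => hw).
  by apply: vinW key _ => w [h1 h2]; apply: h2.
elim: t => [_|v t IH hst]; first by apply: vinW hs _ => w.
have {}IH : vin (fun w => w \in s /\ (w \in t -> T w)) p.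
  by apply: IH => w wt; apply: hst; rewrite inE wt orbT.
have [Tv|nTv] := classic (T v).
  apply: vinW IH _ => w [h1 h2]; split=> //.
  by rewrite inE => /orP[/eqP->|].
apply: vinW (uni_size1 IH (h v nTv)) _ => w [[h1 h2] h3]; split=> //.
by rewrite inE => /orP[/eqP|].
Qed.

(** Degrees in each variable add up in a product, so a factor has no variable that the
    product does not have.  Thus factorisation never leaves a subring of polynomials. *)
Lemma vin_factor T p q : p * q != 0 -> vin T (p * q) -> vin T p.
Proof.
move=> pq0 h; have p0 : p != 0 by apply: contra_neq pq0 => ->; rewrite mul0r.
have q0 : q != 0 by apply: contra_neq pq0 => ->; rewrite mulr0.
apply: vin_all => v nTv; have := vin_avoid h nTv; rewrite size_uniM //.
have := size_uni_gt0 v p0; have := size_uni_gt0 v q0; lia.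
Qed.

Lemma invertible_vin p T : invertible p -> vin T p.
Proof.
case=> q e; apply: (@vin_factor T p q); rewrite e; last exact: vin1.
by apply/eqP => e1; have := C_inj H; move=> /(_ 0 1); rewrite rmorph0 rmorph1 e1 => /(_ erefl)/eqP; rewrite eq_sym oner_eq0.
Qed.

Lemma ufd_irr_prime (B : idomainType) (x : B) : is_ufd B -> is_irreducible x -> prime_elt x.
Proof.
move=> facB [x0 xu xirr]; have [s [hs [u [hu ex]]]] := facB x (introN eqP x0).
case: s => [|q s] in hs ex; first by case: xu; rewrite ex big_nil mulr1.
have hq : prime_elt q by apply: hs; rewrite mem_head.
rewrite big_cons in ex; have ex' : x = q * (u * \prod_(j <- s) j) by rewrite ex; ring.
have [_ nq qp] := hq.
have [//|[w ew]] := xirr _ _ ex'.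
split=> // y z h.
have qx : dvdr x q by exists w; rewrite ex' mulrA [w * q]mulrC -mulrA [w * _]mulrC ew mulr1.
have xq : dvdr q x by rewrite ex'; apply/dvdr_mulr/dvdrr.
by case: (qp y z (dvdr_trans xq h)) => h'; [left|right]; apply: dvdr_trans h'.
Qed.

(** Transported from the factorial ring of a finite set of variables that contains those of G
    and of the factors. *)
Lemma irr_prime_poly (G : A) : is_irreducible G -> prime_elt G.
Proof.
move=> [G0 Gu Girr]; split=> // y z [w e].
have [s [us hs]] := tower_of [:: G; y; z; w].
have [B [i [inji imi facB]]] := tower us.
have [g eg] : exists b, i b = G by apply/imi/hs; rewrite mem_head.
have [y' ey] : exists b, i b = y by apply/imi/hs; rewrite !inE eqxx orbT.
have [z' ez] : exists b, i b = z by apply/imi/hs; rewrite !inE eqxx !orbT.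
have [w' ew] : exists b, i b = w by apply/imi/hs; rewrite !inE eqxx !orbT.
have inv_i b : invertible (i b) -> invertible b.
  move=> [t et]; have [|t' et'] := (imi t).1.
    by apply: invertible_vin; exists (i b); rewrite mulrC.
  by exists t'; apply: inji; rewrite rmorphM et' et rmorph1.
have [] : prime_elt g.
  apply: ufd_irr_prime => //; split.
  - by move=> g0; apply: G0; rewrite -eg g0 rmorph0.
  - by move=> [t et]; apply: Gu; exists (i t); rewrite -eg -rmorphM et rmorph1.
  by move=> a b eab; have [|h|h] := Girr (i a) (i b);
    [rewrite -rmorphM -eab eg | left; apply: inv_i | right; apply: inv_i].
move=> _ _ /(_ y' z') [|[t et]|[t et]].
- by exists w'; apply: inji; rewrite !rmorphM ey ez ew eg.
- by left; exists (i t); rewrite -ey et rmorphM eg.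
by right; exists (i t); rewrite -ez et rmorphM eg.
Qed.

(** Factor G0 in a factorial subring: the prime ideal P contains one of the prime factors. *)
Lemma irr_factor (P : A -> Prop) T G0 :
  ~ P 1 -> (forall x y, P (x * y) -> P x \/ P y) -> (forall a x, P x -> P (a * x)) ->
  P G0 -> vin T G0 -> G0 != 0 -> exists G, [/\ is_irreducible G, P G & vin T G].
Proof.
move=> P1 Pp Pi PG0 vG0 nG0.
have [s [us hs]] := tower_of [:: G0]; have [B [i [inji imi facB]]] := tower us.
have [g eg] : exists b, i b = G0 by apply/imi/hs; rewrite mem_head.
have g0 : g != 0 by apply: contra_neq nG0 => g0; rewrite -eg g0 rmorph0.
have [t [ht [u [[u' hu] e]]]] := facB g g0.
have nPu : ~ P (i u).
  by move=> h; apply: P1; rewrite -(rmorph1 i) -hu rmorphM mulrC; apply: Pi.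
have [q qt Pq] : exists2 q, q \in t & P (i q).
  have : P (i (\prod_(q <- t) q)).
    by move: PG0; rewrite -eg e rmorphM => /Pp [].
  elim: (t) => [|q t' IH]; first by rewrite big_nil rmorph1.
  rewrite big_cons rmorphM => /Pp [h|/IH [q' h1 h2]]; first by exists q; rewrite ?mem_head.
  by exists q'; rewrite // inE h1 orbT.
have [m em] : exists m, G0 = i q * m.
  have [t1 [t2 et]] : exists t1 t2, t = t1 ++ q :: t2.
    by case/splitPr: qt => t1 t2; exists t1, t2.
  exists (i (u * \prod_(j <- t1) j * \prod_(j <- t2) j)).
  by rewrite -rmorphM -eg e et big_cat big_cons /=; congr (i _); ring.
have [q0 qu qp] := ht q qt.
exists (i q); split=> //; last by apply: (@vin_factor T _ m); rewrite -em.
have iq0 : i q != 0 by rewrite -(rmorph0 i) (inj_eq inji); apply/eqP.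
split=> [/eqP|[z ez]|y z eyz]; first exact/negP.
- apply: qu; have [|z' ez'] := (imi z).1.
    by apply: invertible_vin; exists (i q); rewrite mulrC.
  by exists z'; apply: inji; rewrite rmorphM ez' ez rmorph1.
have vq : vin (fun v => v \in s) (i q) by apply/imi; exists q.
have [y' ey] : exists b, i b = y by apply/imi/(@vin_factor _ _ z); rewrite -eyz.
have [z' ez] : exists b, i b = z by apply/imi/(@vin_factor _ _ y); rewrite mulrC -eyz.
have e' : q = y' * z' by apply: inji; rewrite rmorphM ey ez.
have [|[k ek]|[k ek]] := qp y' z'; first by rewrite -e'; apply: dvdrr.
  right; rewrite -ez; exists (i k); rewrite -rmorphM -(rmorph1 i); congr (i _).
  apply: (mulfI (introN eqP q0)); rewrite mulr1 [in RHS]e' ek; ring.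
left; rewrite -ey; exists (i k); rewrite -rmorphM -(rmorph1 i); congr (i _).
apply: (mulfI (introN eqP q0)); rewrite mulr1 [in RHS]e' ek; ring.
Qed.

(** If a prime G with positive degree in v does not divide r, then G and r are coprime as
    polynomials in v over the fraction field of the other variables.  Clearing
    denominators in a Bezout relation gives a nonzero combination free of v: the
    role usually played by the resultant. *)
Lemma bezout_elim G r v T : prime_elt G -> vin T G -> vin T r ->
  (1 < size (uni H v G))%N -> ~ dvdr G r ->
  exists a b c, [/\ a * G + b * r = c, c != 0 & vin (fun w => T w /\ w <> v) c].
Proof.
move=> [G0 Gu Gp] vG vr sG ndvd.
have [s [us [sT hs]]] : exists s : seq W, uniq s /\ ((forall w, w \in s -> T w /\ w <> v) /\
    forall i, vin (fun w => w \in s) (uni H v G)`_i /\ vin (fun w => w \in s) (uni H v r)`_i).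
  have [s1 [h1 hs1]] := vin_fin vG; have [s2 [h2 hs2]] := vin_fin vr.
  exists (undup [seq w <- s1 ++ s2 | w != v]); split; first exact: undup_uniq.
  split=> [w|i].
    rewrite mem_undup mem_filter mem_cat => /andP[/eqP h /orP h'].
    by split=> //; case: h' => [/h1|/h2].
  split.
    by apply: vinW (uni_coef_vin H v i hs1) _ => w [h /eqP h']; rewrite mem_undup mem_filter mem_cat h h'.
  by apply: vinW (uni_coef_vin H v i hs2) _ => w [h /eqP h']; rewrite mem_undup mem_filter mem_cat h h' orbT.
have [B [i [inji imi facB]]] := tower us.
pose i' : {rmorphism {poly B} -> A} := (horner_eval (X v) \o map_poly i).
have uni_i b : uni H v (i' b) = map_poly i b.
  rewrite /= /horner_eval uni_horner // => k.
  suff : vin (fun w => w \in s) (map_poly i b)`_k by move=> h; apply: vinW h _ => w /sT [].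
  by apply/imi; exists b`_k; rewrite coef_map.
have lift p : (forall j, vin (fun w => w \in s) (uni H v p)`_j) -> exists b, i' b = p.
  move=> hp; have [b eb] := lift_poly (fun k => (imi _).1 (hp k)).
  by exists b; rewrite /= /horner_eval eb uniK.
have i'C c : i' c%:P = i c by rewrite /= /horner_eval map_polyC hornerC.
have i'Z c b : i' (c *: b) = i c * i' b by rewrite -mul_polyC rmorphM i'C.
have [g eg] : exists b, i' b = G by apply: lift => j; case: (hs j).
have [h eh] : exists b, i' b = r by apply: lift => j; case: (hs j).
have i0 c : c != 0 -> i c != 0 by rewrite -(rmorph0 i) (inj_eq inji).
have size_i c : (size (uni H v (i c)) <= 1)%N.
  by rewrite -i'C uni_i map_polyC size_polyC_leq1.
have G0' : G != 0 by apply/eqP.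
have nGc c : c != 0 -> ~ dvdr G (i c).
  move=> c0 [m em]; have m0 : m != 0 by apply: contra_neq (i0 c c0) => m0; rewrite em m0 mul0r.
  have := size_i c; rewrite em size_uniM //; have := size_uni_gt0 v m0; lia.
have cop : Pdiv.Idomain.coprimep g h.
  rewrite Pdiv.Idomain.coprimep_def; set d := Pdiv.Idomain.gcdp g h.
  have g0 : g != 0 by apply: contra_neq G0' => g0; rewrite -eg g0 rmorph0.
  have d0 : d != 0 by rewrite Pdiv.Idomain.gcdp_eq0 (negPf g0).
  have /Pdiv.Idomain.dvdpP [[c k] c0 e1] := Pdiv.Idomain.dvdp_gcdl g h.
  have /Pdiv.Idomain.dvdpP [[c' k'] c'0 e2] := Pdiv.Idomain.dvdp_gcdr g h.
  simpl in c0, c'0, e1, e2; rewrite -/d in e1 e2.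
  have {}e1 : i c * G = i' k * i' d by rewrite -rmorphM -e1 i'Z eg.
  have {}e2 : i c' * r = i' k' * i' d by rewrite -rmorphM -e2 i'Z eh.
  have [|[m em]|Gd] := Gp (i' k) (i' d).
  - by rewrite -e1; apply/dvdr_mull/dvdrr.
  - have eic : i c = m * i' d by apply: (poly_mulfI G0'); rewrite mulrC e1 em; ring.
    have id0 : i' d != 0 by apply: contra_neq (i0 c c0) => id0; rewrite eic id0 mulr0.
    have m0 : m != 0 by apply: contra_neq (i0 c c0) => m0; rewrite eic m0 mul0r.
    have := size_i c; rewrite eic size_uniM // uni_i size_map_inj_poly ?rmorph0 //.
    move: d0; rewrite -size_poly_gt0; have := size_uni_gt0 v m0; lia.
  case: (Gp (i c') r) => //; last by move/nGc; case.
  by rewrite e2; apply: dvdr_mull.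
have /Pdiv.Idomain.Bezout_coprimepP [[u1 u2] /Pdiv.Idomain.eqpP [[c1 c2] /andP[c10 c20] e]] := cop.
exists (i' (c1 *: u1)), (i' (c1 *: u2)), (i c2); split; last 1 first.
- have h2 : vin (fun w => w \in s) (i c2) by apply/imi; exists c2.
  by apply: vinW h2 _ => w /sT.
- rewrite -eg -eh -!rmorphM -rmorphD -i'C; congr (i' _).
  by move: e => /=; rewrite -alg_polyC => <-; rewrite scalerDr !scalerAl.
exact: i0.
Qed.
End FieldPoly.

(** * The monoid algebra as a polynomial ring *)

Section Eval.
Variables (W : choiceType) (R S : comNzRingType).
Local Notation A := {malg R[{cmonom W}]}.

Definition pX (w : W) : A := << ucm w >>.

Definition pvars (p : A) : seq W :=
  flatten [seq enum_fset (finsupp M) | M : {cmonom W} <- enum_fset (msupp p)].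

Definition mev (x : W -> S) (M : {cmonom W}) : S := \prod_(v <- finsupp M) x v ^+ M v.

(** The evaluation used in the definition of differential polynomials, as a morphism. *)
Definition pev (f : R -> S) (x : W -> S) (p : A) : S := mmap f (mev x) p.

Lemma mevE (x : W -> S) (M : {cmonom W}) (D : {fset W}) :
  (finsupp M `<=` D)%fset -> mev x M = \prod_(v <- D) x v ^+ M v.
Proof.
move=> le; rewrite /mev (big_fset_incl _ le) //= => v _ hv.
by have /eqP-> : M v == 0%N by rewrite cmE_eq0.
Qed.

Lemma mev_mmorphism (x : W -> S) : mmorphism (mev x).
Proof.
split=> [M N|]; last by rewrite /mev mdom1 big_seq_fset0.
rewrite (mevE x (fsubsetUl (finsupp M) (finsupp N))).
rewrite (mevE x (fsubsetUr (finsupp M) (finsupp N))) -big_split /=.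
rewrite /mev mdomD; apply: eq_bigr => v _.
by rewrite cmM exprD.
Qed.
HB.instance Definition _ x := isMultiplicative.Build _ S (mev x) (mev_mmorphism x).

Section Morph.
Variables (f : {rmorphism R -> S}) (x : W -> S).

HB.instance Definition _ := GRing.RMorphism.copy (pev f x) (mmap f (mev x)).

Lemma pevC c : pev f x c%:MP = f c.
Proof. exact: mmapC. Qed.

Lemma pevU c M : pev f x << c *g M >> = f c * mev x M.
Proof. exact: mmapU. Qed.

Lemma pevX w : pev f x (pX w) = x w.
Proof. by rewrite pevU rmorph1 mul1r /mev mdomU big_seq_fset1 cmUU expr1. Qed.
End Morph.

End Eval.

Section Vars.
Variables (W : choiceType) (R : comNzRingType).
Local Notation A := {malg R[{cmonom W}]}.
Implicit Types (p q : A) (T : W -> Prop).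

Lemma pvarsP p v : reflect (exists2 M, M \in msupp p & M v != 0%N) (v \in pvars p).
Proof.
apply: (iffP flattenP) => [[s /mapP[M hM ->] hv]|[M hM hv]].
  by exists M => //; rewrite cmE_neq0.
by exists (enum_fset (finsupp M)); [apply: map_f | rewrite -cmE_neq0].
Qed.

Lemma malgUU c1 c2 (M N : {cmonom W}) :
  << c1 *g M >> * << c2 *g N >> = << c1 * c2 *g mmul M N >> :> A.
Proof. by rewrite malgM_def fgmulUU. Qed.

Lemma expcmnS (M : {cmonom W}) k : expcmn M k.+1 = mmul M (expcmn M k).
Proof. by case: k => [|k] //; exact: (esym (mulm1 M)). Qed.

Lemma expcmnE (M : {cmonom W}) k v : expcmn M k v = (M v * k)%N.
Proof.
elim: k => [|k IH]; first by rewrite muln0 onecmE.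
by rewrite expcmnS cmM IH mulnS.
Qed.

Lemma pXexp (v : W) k : pX R v ^+ k = << expcmn (ucm v) k >>.
Proof.
elim: k => [|k IH]; first by rewrite expr0.
rewrite exprS IH /pX malgUU mulr1.
exact: (congr1 (mkmalgU^~ 1) (esym (expcmnS _ _))).
Qed.

Lemma malgUE c (M : {cmonom W}) : << c *g M >> = c%:MP * mev (pX R) M.
Proof.
have -> : mev (pX R) M = << M >>; last by rewrite malgUU mulr1 mul1m.
have [n] := ubnP (mdeg M); elim: n M => // n IHn M le_Mn.
have [|[v vM]] := fset_0Vmem (finsupp M).
  move=> M0; have -> : M = mone by apply: mdeg_eq0I; rewrite mdegE M0 big_seq_fset0.
  by rewrite mmorph1.
have Mv : M v != 0%N by rewrite cmE_neq0.
have EM := cm_split Mv; move: (divcm M (ucm v)) EM => N EM.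
rewrite EM mmorphM /= (IHn N); last by move: le_Mn; rewrite EM mdegM mdegU add1n.
by rewrite {1}/mev mdomU big_seq_fset1 cmUU expr1 /pX malgUU mulr1.
Qed.

Lemma malg_sumE p : p = \sum_(M <- msupp p) (p@_M)%:MP * mev (pX R) M.
Proof. by rewrite {1}(monalgE p); apply: eq_bigr => M _; rewrite malgUE. Qed.

Lemma malg_ind (Q : A -> Prop) p :
  (forall c, Q c%:MP) -> (forall v, v \in pvars p -> Q (pX R v)) ->
  (forall x y, Q x -> Q y -> Q (x + y)) -> (forall x y, Q x -> Q y -> Q (x * y)) ->
  Q p.
Proof.
move=> hC hX hD hM; rewrite (malg_sumE p) big_seq.
have h0 : Q 0 by rewrite -malgC0E.
have h1 : Q 1 by rewrite -mpolyC1E.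
apply: (big_ind Q h0 hD) => M hMp; apply: (hM); first exact: hC.
rewrite /mev big_seq; apply: (big_ind Q h1 hM) => v hv.
elim: (M v) => [|k IH]; first by rewrite expr0.
rewrite exprS; apply: (hM) IH; apply: hX; apply/pvarsP; exists M; first exact: hMp.
by rewrite cmE_neq0.
Qed.

Lemma polyring_malg : polyring (@malgC {cmonom W} R) (@pX W R).
Proof.
split=> [p|S f x].
  apply: malg_ind => [c|v _|x y|x y]; [exact: vinC|exact: vinX|exact: vinD|exact: vinM].
by exists (pev f x); split=> [c|v]; [apply: pevC | apply: pevX].
Qed.

Lemma vin_pvars T p : vin (@malgC {cmonom W} R) (@pX W R) T p <-> forall v, v \in pvars p -> T v.
Proof.
split=> [|h]; last first.
  by apply: malg_ind => [c|v /h Tv|x y|x y]; [exact: vinC|exact: vinX|exact: vinD|exact: vinM].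
have key q : (forall v, v \in pvars q -> T v) <->
    forall M, M \in msupp q -> forall v, M v != 0%N -> T v.
  split=> [h M hM v hv|h v /pvarsP[M hM hv]]; last exact: h hM _ hv.
  by apply: h; apply/pvarsP; exists M.
elim=> [c|v Tv|x y _ /key hx _ /key hy|x y _ /key hx _ /key hy]; apply/key => M.
- have := @msuppC_le {cmonom W} _ c => /fsubsetP h /h.
  by rewrite in_fset1 => /eqP-> v; rewrite cm1.
- by rewrite msuppU1 in_fset1 => /eqP-> w; rewrite cmU; case: (v =P w) => // <-.
- have := msuppD_le x y => /fsubsetP h /h; rewrite in_fsetU => /orP[/hx|/hy]; exact.
move=> hM v; have [k1 [k2 [h1 h2 ->]]] := msuppM_le hM.
by rewrite cmM addn_eq0 negb_and => /orP[]; [apply: hx | apply: hy].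
Qed.
End Vars.

(** * Algebraic closure and exchange *)

Definition is_subfield (L : fieldType) (S : L -> Prop) :=
  [/\ S 1, (forall x y, S x -> S y -> S (x - y)) & (forall x y, S x -> S y -> S (x / y))].

Definition alg_closed_in (L : fieldType) (S : L -> Prop) :=
  is_subfield S /\
  forall (q : {poly L}) x, q != 0 -> (forall i, S q`_i) -> root q x -> S x.

Section SubfieldType.
Variables (L : fieldType) (S : L -> Prop) (hS : is_subfield S).

Definition subfield_pred of is_subfield S : {pred L} :=
  fun x => propb (S x).

Lemma subfield_predP x : reflect (S x) (x \in subfield_pred hS).
Proof. exact: propbP. Qed.

Lemma subfield_pred_closed : divring_closed (subfield_pred hS).
Proof.
case: (hS) => h1 hB hV; split; first exact/subfield_predP.
  by move=> x y /subfield_predP hx /subfield_predP hy; apply/subfield_predP/hB.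
by move=> x y /subfield_predP hx /subfield_predP hy; apply/subfield_predP/hV.
Qed.
HB.instance Definition _ := GRing.isDivringClosed.Build L (subfield_pred hS) subfield_pred_closed.

Record subfield_type := SubfieldType { sfval : L; _ : sfval \in subfield_pred hS }.
HB.instance Definition _ := [isSub for sfval].
HB.instance Definition _ := [Choice of subfield_type by <:].
HB.instance Definition _ := [SubChoice_isSubIntegralDomain of subfield_type by <:].
HB.instance Definition _ := [SubIntegralDomain_isSubField of subfield_type by <:].

(** A subfield given by a predicate is turned into a field type, so that the library
    results about integral elements over a field apply to it. *)
Lemma subfield_as_type : exists (F : fieldType) (i : {rmorphism F -> L}),
  forall x, S x <-> exists a, i a = x.
Proof.
exists subfield_type, (val : {rmorphism subfield_type -> L}) => x; split.
  by move=> /subfield_predP hx; exists (SubfieldType hx).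
by case=> a <-; apply/subfield_predP; apply: valP.
Qed.
End SubfieldType.

Section Subfields.
Variables (L : fieldType) (S : L -> Prop).
Hypothesis hS : is_subfield S.

Lemma subf1 : S 1. Proof. by case: hS. Qed.
Lemma subfB x y : S x -> S y -> S (x - y). Proof. by case: hS => _ h _; apply: h. Qed.
Lemma subfV x y : S x -> S y -> S (x / y). Proof. by case: hS => _ _ h; apply: h. Qed.
Lemma subf0 : S 0. Proof. by rewrite -(subrr 1); apply: subfB; apply: subf1. Qed.
Lemma subfN x : S x -> S (- x). Proof. by rewrite -sub0r; apply: subfB; apply: subf0. Qed.
Lemma subfD x y : S x -> S y -> S (x + y).
Proof. by move=> hx hy; rewrite -(opprK y); apply: subfB => //; apply: subfN. Qed.
Lemma subfM x y : S x -> S y -> S (x * y).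
Proof.
move=> hx hy; rewrite -[y]invrK; apply: subfV => //; rewrite -[_^-1]mul1r.
by apply: subfV => //; apply: subf1.
Qed.
End Subfields.

Section AlgOverRing.
Variables (L : fieldType) (B : comNzRingType) (psi : {rmorphism B -> L}).

(** The coefficients are taken in B rather than in the field generated by its image; clearing
    denominators, in alg_over_closed, shows that this is the same. *)
Definition alg_over x := exists q : {poly B}, map_poly psi q != 0 /\ root (map_poly psi q) x.

Let frac x := exists a b, psi b != 0 /\ x = psi a / psi b.

Lemma frac_subfield : is_subfield frac.
Proof.
split.
- by exists 1, 1; rewrite rmorph1 oner_eq0 divr1.
- move=> _ _ [a [b [b0 ->]]] [c [d [d0 ->]]]; exists (a * d - c * b), (b * d).
  by rewrite !rmorphM mulf_neq0 // rmorphB !rmorphM; split=> //; field; rewrite ?b0 ?d0.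
move=> _ _ [a [b [b0 ->]]] [c [d [d0 ->]]].
have [c0|c0] := eqVneq (psi c) 0.
  by exists 0, 1; rewrite c0 mul0r invr0 mulr0 rmorph0 mul0r rmorph1 oner_eq0.
by exists (a * d), (b * c); rewrite !rmorphM mulf_neq0 //; split=> //; field; rewrite ?b0 ?c0 ?d0.
Qed.

Lemma alg_over_closed : alg_closed_in alg_over.
Proof.
have [F [i hi]] := subfield_as_type frac_subfield.
have algE x : alg_over x <-> integralOver i x.
  rewrite -integral_algebraic; split.
    case=> q [q0 rq]; have hc k : exists a, i a = (map_poly psi q)`_k.
      by apply/hi; rewrite coef_map; exists q`_k, 1; rewrite rmorph1 oner_eq0 divr1.
    have [p ep] := lift_poly hc; exists p; last by rewrite ep.
    by rewrite -(map_poly_eq0 i) ep.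
  case=> p p0 rp.
  have hc k : exists ab : B * B, psi ab.2 != 0 /\ i p`_k = psi ab.1 / psi ab.2.
    by have [a [b [b0 e]]] := (hi (i p`_k)).2 (ex_intro _ _ erefl); exists (a, b).
  have [ab hab] := fun_choice hc.
  pose n := size p; pose D := \prod_(k < n) (ab k).2.
  have D0 : psi D != 0 by rewrite rmorph_prod; apply/prodf_neq0 => k _; case: (hab k).
  pose c k := (ab k).1 * \prod_(j < n | j != k :> nat) (ab j).2.
  have e : map_poly psi (\poly_(k < n) c k) = psi D *: map_poly i p.
    apply/polyP => k; rewrite coefZ !coef_map /= coef_poly; case: ltnP => h; last first.
      by rewrite nth_default // !rmorph0 mulr0.
    have [b0 ->] := hab k.
    have -> : D = (ab k).2 * \prod_(j < n | j != k :> nat) (ab j).2.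
      by rewrite /D (bigD1 (Ordinal h)).
    by rewrite /c !rmorphM; field.
  exists (\poly_(k < n) c k); rewrite e; split.
    by rewrite scaler_eq0 negb_or D0 map_poly_eq0.
  by rewrite rootE hornerZ (rootP rp) mulr0.
split; first split.
- by apply/algE/integral1.
- by move=> x y /algE hx /algE hy; apply/algE/integral_sub.
- by move=> x y /algE hx /algE hy; apply/algE/integral_div.
move=> q x q0 hq rq; apply/algE; apply: (integral_root q0 rq) => _ /(nthP 0) [k hk <-].
exact/algE.
Qed.

Lemma alg_over_im b : alg_over (psi b).
Proof.
exists ('X - b%:P); rewrite rmorphB /= map_polyX map_polyC /=.
by rewrite polyXsubC_eq0 root_XsubC eqxx.
Qed.
End AlgOverRing.

Section Closure.
Variables (F L : fieldType) (f : {rmorphism F -> L}).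
Implicit Types (A B Z : L -> Prop) (x y : L).

(** The relative algebraic closure of F(A) in L, as an intersection: x lies in every
    algebraically closed subfield that contains F and A. *)
Definition alg_cl A x := forall S, alg_closed_in S -> (forall c, S (f c)) ->
  (forall y, A y -> S y) -> S x.

Lemma alg_cl_id A x : A x -> alg_cl A x.
Proof. by move=> hx S _ _ h; apply: h. Qed.

Lemma alg_cl_base A c : alg_cl A (f c).
Proof. by move=> S _ h _. Qed.

Lemma alg_cl_closed A : alg_closed_in (alg_cl A).
Proof.
split; first split.
- by move=> S hS h1 h2; apply: subf1; case: hS.
- move=> x y hx hy S hS h1 h2; apply: subfB; [by case: hS|by apply: hx|by apply: hy].
- move=> x y hx hy S hS h1 h2; apply: subfV; [by case: hS|by apply: hx|by apply: hy].
move=> q x q0 hq rq S hS h1 h2; case: (hS) => _ h; apply: h q0 _ rq => i.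
exact: hq.
Qed.

Lemma alg_cl_trans A B x : (forall y, A y -> alg_cl B y) -> alg_cl A x -> alg_cl B x.
Proof. by move=> h hx; apply: hx => //; [apply: alg_cl_closed | apply: alg_cl_base]. Qed.

Lemma alg_cl_mono A B x : (forall y, A y -> B y) -> alg_cl A x -> alg_cl B x.
Proof. by move=> h; apply: alg_cl_trans => y /h; apply: alg_cl_id. Qed.

(** If y is algebraic over K(x), where K is the closure of A, then y is a root of a polynomial
    whose coefficients are values at x of polynomials over K.  Reading the relation
    as a polynomial in x with coefficients in K[y], either it is not zero, and x is
    algebraic over K(y), or all its coefficients vanish and one of them shows that y is
    algebraic over K. *)
Lemma alg_cl_exchange A x y : alg_cl (fun z => A z \/ z = x) y -> ~ alg_cl A y ->
  alg_cl (fun z => A z \/ z = y) x.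
Proof.
move=> hy ny; have [K [i hi]] := subfield_as_type (alg_cl_closed A).1.
pose psi : {rmorphism {poly K} -> L} := (horner_eval x \o map_poly i).
have [q [q0 rq]] : alg_over psi y.
  apply: hy; first exact: alg_over_closed.
    move=> c; have [a <-] := (hi (f c)).1 (@alg_cl_base A c).
    have -> : i a = psi a%:P by rewrite /= /horner_eval map_polyC hornerC.
    exact: alg_over_im.
  move=> z [Az|->].
    have [a <-] := (hi z).1 (alg_cl_id Az).
    have -> : i a = psi a%:P by rewrite /= /horner_eval map_polyC hornerC.
    exact: alg_over_im.
  have -> : x = psi 'X by rewrite /= /horner_eval map_polyX hornerX.
  exact: alg_over_im.
pose r := (map_poly (map_poly i) q).[y%:P].
pose n := size q.
have rE : r = \sum_(k < n) map_poly i q`_k * (y ^+ k)%:P.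
  rewrite /r (@horner_coef_wide _ n); last exact: size_poly.
  by apply: eq_bigr => k _; rewrite coef_map -rmorphXn.
have rx : r.[x] = 0.
  have := rootP rq; rewrite (@horner_coef_wide _ n) ?size_poly // => <-.
  rewrite rE horner_sum; apply: eq_bigr => k _.
  by rewrite hornerM hornerC coef_map /= /horner_eval.
have rc l : r`_l = \sum_(k < n) i (q`_k)`_l * y ^+ k.
  by rewrite rE coef_sum; apply: eq_bigr => k _; rewrite coefMC coef_map.
have [r0|r0] := eqVneq r 0; last first.
  have [sf ac] := alg_cl_closed (fun z => A z \/ z = y).
  apply: (ac r x r0); last by apply/rootP.
  move=> l; rewrite rc; apply: big_ind; [exact: subf0|exact: subfD|move=> k _].
  apply: (subfM sf).
    have h : alg_cl A (i (q`_k)`_l) by apply/hi; eexists.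
    by apply: alg_cl_mono h => z; left.
  elim: (val k) => [|j IH]; first by rewrite expr0; apply: (subf1 sf).
  by rewrite exprS; apply: (subfM sf) => //; apply: alg_cl_id; right.
case: ny; have [sf ac] := alg_cl_closed A.
have q0' : q != 0 by apply: contra_neq q0 => ->; rewrite rmorph0.
have [k qk] : exists k, q`_k != 0 by exists (size q).-1; rewrite -lead_coefE lead_coef_eq0.
have [l ql] : exists l, (q`_k)`_l != 0 by exists (size q`_k).-1; rewrite -lead_coefE lead_coef_eq0.
pose t := \poly_(j < n) i (q`_j)`_l.
apply: (ac t y).
- apply: contra_neq ql => t0; have := congr1 (fun p : {poly L} => p`_k) t0.
  rewrite coef_poly coef0; case: ltnP => h; last by move: qk; rewrite nth_default ?eqxx.
  by move/eqP; rewrite fmorph_eq0 => /eqP.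
- move=> j; rewrite coef_poly; case: ifP => _; last exact: (subf0 sf).
  by apply/hi; eexists.
by apply/rootP; rewrite horner_poly -rc r0 coef0.
Qed.

(** Steinitz: vectors of s are exchanged one at a time against elements of ys.  The set Z
    collects those already exchanged. *)
Lemma steinitz (s ys : seq L) Z : uniq ys ->
  (forall y, y \in ys -> ~ alg_cl (fun z => Z z \/ (z \in ys /\ z <> y)) y) ->
  (forall y, y \in ys -> alg_cl (fun z => Z z \/ z \in s) y) -> (size ys <= size s)%N.
Proof.
elim: s Z ys => [|x s IH] Z ys uy ind sp.
  case: ys uy ind sp => // y ys uy ind sp; case: (ind y (mem_head _ _)).
  by apply: alg_cl_mono (sp y (mem_head _ _)) => z [h|//]; left.
have [h|h] := classic (forall y, y \in ys -> alg_cl (fun z => Z z \/ z \in s) y).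
  by apply: leqW; apply: IH h.
have [y [yys ny]] : exists y, y \in ys /\ ~ alg_cl (fun z => Z z \/ z \in s) y.
  have [y ny] := not_all_ex_not _ _ h; exists y.
  by case: (imply_to_and _ _ ny).
have xc : alg_cl (fun z => (Z z \/ z \in s) \/ z = y) x.
  apply: alg_cl_exchange ny; apply: alg_cl_mono (sp y yys) => z [hz|]; first by left; left.
  by rewrite inE => /orP[/eqP->|hz]; [right|left; right].
have {}IH := IH (fun z => Z z \/ z = y) (rem y ys) (rem_uniq _ uy).
rewrite -(ltn_predK (_ : 0 < size ys)%N); last by case: (ys) yys.
rewrite ltnS -(size_rem yys); apply: IH => w.
  rewrite (rem_filter _ uy) mem_filter => /andP[/= wy wys]; have := ind w wys.
  apply: contra_not; apply: alg_cl_mono => z [[hz|->]|[]]; first by left.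
    by right; split=> //; apply/eqP; rewrite eq_sym.
  by rewrite mem_filter => /andP[_ hz]; right.
rewrite (rem_filter _ uy) mem_filter => /andP[/= wy wys].
apply: alg_cl_trans (sp w wys) => z [hz|]; first by apply: alg_cl_id; left; left.
rewrite inE => /orP[/eqP->|hz]; last by apply: alg_cl_id; right.
by apply: alg_cl_mono xc => z' [[h1|h1]|h1]; [left; left|right|left; right].
Qed.
End Closure.

Section Independence.
Variables (W : choiceType) (F L : fieldType) (A : comNzRingType) (C : {rmorphism F -> A}) (X : W -> A).
Hypothesis H : polyring C X.
Variable phi : {rmorphism A -> L}.
Implicit Types (T : W -> Prop).
Local Notation vin := (vin C X).

(** The values under phi of the variables of T are algebraically independent. *)
Definition indep T := forall p, vin T p -> phi p = 0 -> p = 0.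

(** A polynomial relation exhibiting phi (X w) as algebraic over the other values can be
    lifted to A, where it contradicts independence. *)
Lemma indep_cl T w : indep T -> T w ->
  ~ alg_cl (phi \o C) (fun z => exists v, [/\ T v, v <> w & z = phi (X v)]) (phi (X w)).
Proof.
move=> ind Tw hw.
pose P : pred W := fun v => propb (T v /\ v <> w).
have PP v : reflect (T v /\ v <> w) (P v) by exact: propbP.
pose psi : {rmorphism A -> L} := phi \o keep H P.
have [q [q0 rq]] : alg_over psi (phi (X w)).
  apply: hw; first exact: alg_over_closed.
    by move=> c; have := alg_over_im psi (C c); rewrite [psi (C c)]/= evC.
  move=> _ [v [Tv vw ->]]; have -> : phi (X v) = psi (X v); last exact: alg_over_im.
  rewrite /= evX; case: PP => // h; by case: h.
pose Q := map_poly (keep H P) q.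
have vQ k : vin P Q`_k.
  by rewrite coef_map; apply: vinW (keep_vin H P (pr_gen H q`_k)) _ => v [].
have mQ : map_poly psi q = map_poly phi Q by rewrite /Q -map_poly_comp.
have e : Q.[X w] = 0.
  apply: ind.
    rewrite horner_coef; apply: vin_sum => k _; apply: vinM.
      by apply: vinW (vQ k) _ => v /PP [].
    by apply/vin_exp/vinX.
  by move/rootP: rq; rewrite mQ horner_map.
have : uni H w Q.[X w] = Q by apply: uni_horner => k; apply: vinW (vQ k) _ => v /PP [].
rewrite e rmorph0 => Q0; move: q0.
by rewrite mQ -Q0 rmorph0 eqxx.
Qed.

Lemma indep_size (t : seq W) (s : seq L) : uniq t -> indep (fun v => v \in t) ->
  (forall v, v \in t -> alg_cl (phi \o C) (fun z => z \in s) (phi (X v))) ->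
  (size t <= size s)%N.
Proof.
move=> ut ind sp.
have inj v w : v \in t -> w \in t -> phi (X v) = phi (X w) -> v = w.
  move=> hv hw e; have [//|/eqP nvw] := eqVneq v w.
  case: (indep_cl ind hw); rewrite -e; apply: alg_cl_id; by exists v.
rewrite -(size_map (phi \o X)); apply: (@steinitz _ _ (phi \o C) _ _ (fun=> False)).
- rewrite map_inj_in_uniq // => v w; exact: inj.
- move=> _ /mapP [v vt ->] hv; apply: (indep_cl ind vt); apply: alg_cl_mono hv => z [//|[]].
  by case/mapP => w wt -> nw; exists w; split=> // e; apply: nw; rewrite e.
by move=> _ /mapP [v vt ->]; apply: alg_cl_mono (sp v vt) => z; right.
Qed.
End Independence.

(** * Monomials of derivatives, Dickson's lemma and rankings *)

Section Monomials.
Variables (m : nat) (J : choiceType).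
Local Notation W := (deriv_of m J).
Implicit Types (v w : W) (t : {cmonom 'I_m}).

Definition tmul t v : W := (mmul t v.1, v.2).

Lemma tmul1 v : tmul mone v = v.
Proof. by rewrite /tmul mul1m; case: v. Qed.

Lemma tmulA s t v : tmul (mmul s t) v = tmul s (tmul t v).
Proof. by rewrite /tmul /= mulmA. Qed.

Lemma dshiftE k v : dshift k v = tmul (ucm k) v.
Proof. by []. Qed.

Lemma cmonom_split t : t = mone \/ exists k t', t = mmul (ucm k) t'.
Proof.
have [|[k kt]] := fset_0Vmem (finsupp t).
  by move=> t0; left; apply: mdeg_eq0I; rewrite mdegE t0 big_seq_fset0.
by right; exists k, (divcm t (ucm k)); apply: cm_split; rewrite cmE_neq0.
Qed.

Lemma cmonom_ind (P : {cmonom 'I_m} -> Prop) :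
  P mone -> (forall k t, P t -> P (mmul (ucm k) t)) -> forall t, P t.
Proof.
move=> h1 hS t; have [n] := ubnP (mdeg t); elim: n t => // n IH t le_n.
have [->//|[k [t' e]]] := cmonom_split t.
by rewrite e; apply: hS; apply: IH; move: le_n; rewrite e mdegM mdegU add1n ltnS.
Qed.

Lemma dominated_tmul v w : v.2 = w.2 -> (forall k, v.1 k <= w.1 k)%N ->
  w = tmul (divcm w.1 v.1) v.
Proof.
move=> e2 le; rewrite /tmul e2; case: w e2 le => [t j] /= _ le; congr (_, _).
by apply: cm_ext => k; rewrite cmM divcmE subnK.
Qed.

Definition dominating (P : W -> Prop) (Y : seq W) :=
  (forall y, y \in Y -> P y) /\ forall x, P x -> exists y t, y \in Y /\ x = tmul t y.

Lemma dominating_union (I : eqType) (l : seq I) (Q : I -> W -> Prop) :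
  (forall i, i \in l -> exists Y, dominating (Q i) Y) ->
  exists Y, dominating (fun x => exists2 i, i \in l & Q i x) Y.
Proof.
elim: l => [_|i l IH h]; first by exists [::]; split=> [//|x []].
have [Y1 [h1 d1]] := h i (mem_head _ _).
have [j hj|Y2 [h2 d2]] := IH; first by apply: h; rewrite inE hj orbT.
exists (Y1 ++ Y2); split.
  move=> y; rewrite mem_cat => /orP[/h1 hy|/h2 [j hj hy]].
    by exists i; rewrite ?mem_head.
  by exists j; rewrite // inE hj orbT.
move=> x [j]; rewrite inE => /orP[/eqP->|hj] hx.
  by have [y [t [hy ->]]] := d1 x hx; exists y, t; rewrite mem_cat hy.
have [y [t [hy ->]]] := d2 x (ex_intro2 _ _ j hj hx).
by exists y, t; rewrite mem_cat hy orbT.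
Qed.

Lemma dominating_ext (P Q : W -> Prop) Y : (forall x, P x <-> Q x) ->
  dominating P Y -> dominating Q Y.
Proof. by move=> h [h1 h2]; split=> [y /h1/h|x /h/h2]. Qed.

(** Induction on the number of free coordinates.  Pick one element x0 of P: an
    element not above x0 has some coordinate smaller than that of x0, so it lies in one of
    finitely many slices where one more coordinate is fixed. *)
Lemma dickson_slice (T : {set 'I_m}) (P : W -> Prop) :
  (forall x y, P x -> P y -> x.2 = y.2 /\ forall i, i \notin T -> x.1 i = y.1 i) ->
  exists Y, dominating P Y.
Proof.
have [n] := ubnP #|T|; elim: n T P => // n IH T P le_n hP.
have [[x0 Px0]|nP] := classic (exists x, P x); last first.
  by exists [::]; split=> // x Px; case: nP; exists x.
pose l := [seq (i, c) | i <- enum T, c <- iota 0 (x0.1 i)].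
pose Q (ic : 'I_m * nat) x := P x /\ x.1 ic.1 = ic.2.
have [[i c] /allpairsPdep [i' [c' [hi hc [-> ->]]]]|Y [hY dY]] := @dominating_union _ l Q.
  rewrite mem_enum in hi; apply: (IH (T :\ i')).
    by move: le_n; rewrite (cardsD1 i') hi add1n ltnS.
  move=> x y [Px /= xi] [Py /= yi]; have [h1 h2] := hP x y Px Py; split=> // j.
  by rewrite in_setD1 negb_and negbK => /orP[/eqP->|/h2//]; rewrite xi yi.
exists (x0 :: Y); split=> [y|x Px].
  by rewrite inE => /orP[/eqP->//|/hY [ic _ []]].
have [h1 h2] := hP x0 x Px0 Px.
have [le|] := classic (forall k, x0.1 k <= x.1 k)%N.
  by exists x0, (divcm x.1 x0.1); rewrite mem_head; split=> //; apply: dominated_tmul.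
move=> /not_all_ex_not [k /negP]; rewrite -ltnNge => lt_k.
have kT : k \in T by apply: contraTT lt_k => /h2 ->; rewrite ltnn.
have [|y [t [hy ->]]] := dY x.
  exists (k, x.1 k) => //; apply/allpairsPdep; exists k, (x.1 k).
  by rewrite mem_enum kT mem_iota.
by exists y, t; rewrite inE hy orbT.
Qed.

Hypothesis finJ : exists s : seq J, forall j, j \in s.

Lemma dickson (P : W -> Prop) : exists Y, dominating P Y.
Proof.
have [s hs] := finJ.
have [j _|Y dY] := @dominating_union _ s (fun j x => P x /\ x.2 = j).
  apply: (@dickson_slice setT) => x y [Px ->] [Py ->]; split=> // i.
  by rewrite in_setT.
exists Y; apply: dominating_ext dY => x; split=> [[j _ []//]|Px].
by exists x.2.
Qed.

Section Ranking.
Variable lt : rel W.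
Hypothesis rk : is_ranking lt.

Lemma rk_irr v : lt v v = false. Proof. by case: rk => h *; apply: h. Qed.
Lemma rk_trans v u w : lt u v -> lt v w -> lt u w.
Proof. by case: rk => _ h *; apply: (h v). Qed.
Lemma rk_total u v : u != v -> lt u v || lt v u. Proof. by case: rk => _ _ h _ _; apply: h. Qed.
Lemma rk_shift k v : lt v (dshift k v). Proof. by case: rk => _ _ _ h _; apply: h. Qed.
Lemma rk_mono k u v : lt v u -> lt (dshift k v) (dshift k u).
Proof. by case: rk => _ _ _ _ h; apply: h. Qed.

Lemma rk_tmul t v : t != mone -> lt v (tmul t v).
Proof.
elim/cmonom_ind: t => [|k t IH _]; first by rewrite eqxx.
rewrite tmulA -dshiftE; have [->|h] := eqVneq t mone; first by rewrite tmul1 rk_shift.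
exact: rk_trans (IH h) (rk_shift _ _).
Qed.

Lemma rk_neq u v : lt u v -> u <> v.
Proof. by move=> h e; move: h; rewrite e rk_irr. Qed.

Lemma rk_asym u v : lt u v -> lt v u -> False.
Proof. by move=> h1 h2; move: (rk_trans h1 h2); rewrite rk_irr. Qed.

Lemma rk_max (s : seq W) v0 : v0 \in s -> exists2 u, u \in s & forall v, v \in s -> v != u -> lt v u.
Proof.
elim: s v0 => // w s IH v0 _; case: s IH => [|v1 s] IH.
  by exists w; rewrite ?mem_head // => v; rewrite inE => /eqP->; rewrite eqxx.
have [u us umax] := IH v1 (mem_head _ _).
have [e|ne] := eqVneq w u.
  exists u; first by rewrite inE us orbT.
  by move=> v; rewrite inE => /orP[/eqP->|/umax//]; rewrite e eqxx.
have /orP[wu|uw] := rk_total ne.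
  exists u; first by rewrite inE us orbT.
  by move=> v; rewrite inE => /orP[/eqP->|/umax//].
exists w; first exact: mem_head.
move=> v; rewrite inE => /orP[/eqP->|vs]; first by rewrite eqxx.
move=> _; have [->//|vu] := eqVneq v u; exact: rk_trans (umax v vs vu) uw.
Qed.

Lemma rk_min (s : seq W) v0 : v0 \in s -> exists2 u, u \in s & forall v, v \in s -> ~ lt v u.
Proof.
elim: s v0 => // w s IH v0 _; case: s IH => [|v1 s] IH.
  by exists w; rewrite ?mem_head // => v; rewrite inE => /eqP->; rewrite rk_irr.
have [u us umin] := IH v1 (mem_head _ _).
have [wu|wu] := boolP (lt w u).
  exists w; first exact: mem_head.
  move=> v; rewrite inE => /orP[/eqP->|/umin h h']; first by rewrite rk_irr.
  by apply: h; apply: rk_trans wu.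
exists u; first by rewrite inE us orbT.
by move=> v; rewrite inE => /orP[/eqP->|/umin//]; apply/negP.
Qed.

(** A minimal generator, in the sense of Dickson, of the set of non accessible elements would be
    accessible. *)
Lemma rk_wf : well_founded (fun v w => lt v w).
Proof.
move=> x; apply: NNPP => nx.
have [Y [hY dY]] := dickson (fun x => ~ Acc (fun v w => lt v w) x).
have [y0 [_ [hy0 _]]] := dY x nx.
have [y hy ymin] := rk_min hy0.
case: (hY y hy); constructor => v vy; apply: NNPP => nv.
have [y' [t [hy' e]]] := dY v nv; apply: (ymin y' hy').
have [t1|t1] := eqVneq t mone; first by move: vy; rewrite e t1 tmul1.
by apply: rk_trans vy; rewrite e; apply: rk_tmul.
Qed.

(** Compares orders first.  Leaders for this ranking carry the maximal order, which is
    what relates them to the Kolchin polynomial, whatever the given ranking is. *)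
Definition orderly : rel W := fun v w =>
  (mdeg v.1 < mdeg w.1)%N || ((mdeg v.1 == mdeg w.1) && lt v w).

Lemma orderly_ranking : is_ranking orderly.
Proof.
split.
- by move=> v; rewrite /orderly ltnn eqxx rk_irr.
- move=> v u w; rewrite /orderly => /orP[h1|/andP[/eqP h1 h2]] /orP[h3|/andP[/eqP h3 h4]].
  + by rewrite (ltn_trans h1 h3).
  + by rewrite -h3 h1.
  + by rewrite h1 h3.
  by rewrite h1 h3 eqxx (rk_trans h2 h4) orbT.
- move=> u v ne; rewrite /orderly; case: ltngtP => //= _; exact: rk_total.
- by move=> k u; rewrite /orderly /= mdegM mdegU add1n ltnS leqnn.
move=> k u v; rewrite /orderly /= !mdegM !mdegU !add1n ltnS eqSS => /orP[->//|/andP[-> h]].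
by rewrite rk_mono // orbT.
Qed.

Lemma orderly_mdeg v w : orderly v w -> (mdeg v.1 <= mdeg w.1)%N.
Proof. by case/orP => [/ltnW|/andP[/eqP->]]. Qed.
End Ranking.
End Monomials.

(** * The derivatives that lead a prime differential ideal *)

Section DiffPoly.
Variables (m : nat) (J : choiceType) (F : diffFieldType m) (A : diffRingType m).
Local Notation W := (deriv_of m J).
Variables (C : {rmorphism F -> A}) (X : W -> A).
Hypothesis H : polyring C X.
Hypothesis derC : forall k c, dder k (C c) = C (dder k c).
Hypothesis derX : forall k v, dder k (X v) = X (dshift k v).
Implicit Types (T : W -> Prop) (p q : A) (u v w : W).
Local Notation vin := (vin C X).
Local Notation uni := (uni H).

Lemma dder_vin k T T' p : (forall v, T v -> T' v /\ T' (dshift k v)) -> vin T p -> vin T' (dder k p).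
Proof.
move=> h hp; have sub q : vin T q -> vin T' q by move=> hq; apply: vinW hq _ => v /h [].
elim: hp => [c|v /h [_ h2]|x y hx ihx hy ihy|x y hx ihx hy ihy].
- by rewrite derC; apply: vinC.
- by rewrite derX; apply: vinX.
- by rewrite dderD; apply: vinD.
by rewrite dderM; apply: vinD; apply: vinM => //; apply: sub.
Qed.

Lemma dder_exp k p n : dder k (p ^+ n) = p ^+ n.-1 * dder k p *+ n.
Proof.
elim: n => [|n IH]; first by rewrite expr0 mulr0n dder1.
rewrite exprS dderM IH mulrnAr; case: n {IH} => [|n].
  by rewrite !expr0 mulr0n addr0 mulr1 mul1r.
by rewrite /= mulrA -exprS [dder k p * _]mulrC -mulrS.
Qed.

Section Ranked.
Variable lt : rel W.
Hypothesis rk : is_ranking lt.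

Definition below u w := lt w u.
Definition upto u w := w = u \/ lt w u.

Lemma upto_tail u p : vin (upto u) p -> forall i, vin (below u) (uni u p)`_i.
Proof.
move=> hp i; apply: vinW (uni_coef_vin H u i hp) _ => w [[->//|h] _]; exact: h.
Qed.

Definition dsep u p : A := ((uni u p)^`()).[X u].

Lemma dsep_vin u T p : vin T p -> vin T (dsep u p).
Proof.
move=> hp; have [Tu|nTu] := classic (T u).
  rewrite /dsep horner_coef; apply: vin_sum => i _; apply: vinM; last first.
    by apply/vin_exp/vinX.
  rewrite coef_deriv; apply: vin_natmul.
  by apply: vinW (uni_coef_vin H u _ hp) _ => w [].
by rewrite /dsep (uni_const H hp nTu) derivC horner0; apply: vin0.
Qed.

Lemma uni_dsep u p : uni u (dsep u p) = (uni u p)^`().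
Proof.
apply: uni_horner => i; rewrite coef_deriv; apply: vin_natmul.
by apply: vinW (uni_coef_vin H u _ (pr_gen H p)) _ => w [].
Qed.

Lemma der_below k u T p : (forall v, T v -> lt v u) -> vin T p -> vin (below (dshift k u)) (dder k p).
Proof.
move=> h; apply: dder_vin => v /h vu; split; last exact (rk_mono rk k vu).
exact (rk_trans rk vu (rk_shift rk k u)).
Qed.

(** The derivative of p is linear in the derivative of the leader, with the separant of p as
    coefficient: the fact on which all reductions rest. *)
Lemma der_chain k u p : vin (upto u) p ->
  exists2 r, dder k p = dsep u p * X (dshift k u) + r & vin (below (dshift k u)) r.
Proof.
move=> hp; have hc := upto_tail hp.
exists (\sum_(i < size (uni u p)) dder k (uni u p)`_i * X u ^+ i); last first.
  apply: vin_sum => i _; apply: vinM; first exact: der_below (hc i).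
  by apply/vin_exp/vinX/(rk_shift rk).
rewrite -[in LHS](uniK H u p) horner_coef.
have -> : dsep u p = \sum_(i < size (uni u p)) (uni u p)`_i *+ i * X u ^+ i.-1.
  rewrite /dsep (@horner_coef_wide _ (size (uni u p)).-1); last exact: size_poly.
  case: (size (uni u p)) => [|n]; first by rewrite !big_ord0.
  rewrite [RHS]big_ord_recl mulr0n mul0r add0r; apply: eq_bigr => i _.
  by rewrite coef_deriv.
rewrite mulr_suml -big_split /= raddf_sum; apply: eq_bigr => i _ /=.
rewrite dderM dder_exp derX addrC; congr (_ + _).
by rewrite mulrnAr mulrnAl mulrA mulrnAl.
Qed.

Section Ideal.
Variables (L : fieldType) (phi : {rmorphism A -> L}).
Hypothesis phi_der : forall k p, phi p = 0 -> phi (dder k p) = 0.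
Hypothesis char0 : [pchar F] =i pred0.
Hypothesis finJ : exists s : seq J, forall j, j \in s.

Lemma natmul_eq0 (x : L) n : x *+ n.+1 = 0 -> x = 0.
Proof.
move/eqP; rewrite -mulr_natr mulf_eq0 => /orP[/eqP//|].
by rewrite -(rmorph_nat (phi \o C)) fmorph_eq0 ((pcharf0P F).1 char0).
Qed.

(** X v is algebraic, modulo the kernel of phi, over the derivatives below v: p is a relation
    that does not become trivial modulo the kernel. *)
Definition dep v := exists p, [/\ vin (upto v) p, phi p = 0 & exists i, phi (uni v p)`_i != 0].

(** Minimising the degree in v: a leading coefficient in the kernel can be dropped, and so can p itself
    in favour of its separant if the latter lies in the kernel; the degree drops by one
    without reaching 0, by characteristic 0. *)
Lemma dep_min v : dep v -> exists p, [/\ vin (upto v) p, phi p = 0,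
  phi (dsep v p) != 0 & (1 < size (uni v p))%N].
Proof.
move=> [p0 hp0]; have [n] := ubnP (size (uni v p0)).
elim: n p0 hp0 => // n IH p [vp p0 [i ci]] le_n; rewrite ltnS in le_n.
set D := (size (uni v p)).-1; pose c := (uni v p)`_D.
have sz0 : (0 < size (uni v p))%N.
  by rewrite lt0n; apply: contra ci => h; rewrite nth_default ?rmorph0 // (eqP h).
have vc := upto_tail vp.
have [c0|c0] := eqVneq (phi c) 0.
  pose p' := p - c * X v ^+ D.
  have up' : uni v p' = uni v p - c *: 'X^D.
    rewrite rmorphB rmorphM rmorphXn /= uniX -mul_polyC; congr (_ - _ * _).
    by apply: (uni_const H (vc D)); rewrite /below (rk_irr rk).
  apply: (IH p'); last first.
    rewrite (leq_trans _ le_n) // up' -(prednK sz0) ltnS -/D.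
    apply/leq_sizeP => j; rewrite coefB coefZ coefXn leq_eqVlt => /orP[/eqP<-|h].
      by rewrite eqxx mulr1 subrr.
    rewrite [j == D]eq_sym (ltn_eqF h) mulr0 subr0 nth_default //.
    by rewrite -(prednK sz0).
  split.
  - apply: vinB => //; apply: vinM; first by apply: vinW (vc D) _ => w; right.
    by apply/vin_exp/vinX; left.
  - by rewrite rmorphB p0 rmorphM c0 mul0r subr0.
  exists i; rewrite up' coefB coefZ coefXn; have [iD|_] := eqVneq i D.
    by move: ci; rewrite iD -/c c0 eqxx.
  by rewrite mulr0 subr0.
have sz1 : (1 < size (uni v p))%N.
  rewrite ltnNge; apply: contra c0 => h.
  have D0 : D = 0%N by rewrite /D; case: (size _) h => // -[].
  by rewrite /c D0 -p0 -[in X in _ == X](uniK H v p) (size1_polyC h) hornerC coefC.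
have [s0|s0] := eqVneq (phi (dsep v p)) 0; last by exists p.
apply: (IH (dsep v p)); last first.
  by rewrite uni_dsep (leq_trans _ le_n) // lt_size_deriv // -size_poly_gt0.
split=> //; first exact: dsep_vin.
have [n' eD] : exists n', D = n'.+1.
  by rewrite /D; case: (size _) sz1 => // -[//|n'] _; exists n'.
exists n'; rewrite uni_dsep coef_deriv raddfMn.
by apply: contra_neq c0 => /natmul_eq0; rewrite -eD.
Qed.

(** Differentiating a relation of minimal degree gives one that is linear in the derivative of v,
    with coefficient the separant, which is not in the kernel. *)
Lemma dep_shift k v : dep v -> dep (dshift k v).
Proof.
move=> /dep_min [p [vp p0 sp szp]]; exists (dder k p).
have [r e vr] := der_chain k vp.
split; last first.
- exists 1%N; rewrite e rmorphD rmorphM /= uniX.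
  rewrite (uni_const H vr); last by rewrite /below (rk_irr rk).
  rewrite (uni_const H (dsep_vin v vp)); last first.
    move=> [h|h]; first by apply: (rk_neq rk (rk_shift rk k v)).
    exact (rk_asym rk h (rk_shift rk k v)).
  by rewrite coefD coefMX coefC /= coefC addr0.
- exact: phi_der.
rewrite e; apply: vinD; last by apply: vinW vr _ => w; right.
apply: vinM; last by apply: vinX; left.
apply: vinW (dsep_vin v vp) _ => w [->|h]; right; first exact (rk_shift rk _ _).
exact (rk_trans rk h (rk_shift rk _ _)).
Qed.

Lemma dep_tmul t v : dep v -> dep (tmul t v).
Proof.
move=> h; elim/cmonom_ind: t => [|k t IH]; first by rewrite tmul1.
by rewrite tmulA -dshiftE; apply: dep_shift.
Qed.

(** By induction on the highest derivative u in p: the coefficients of p in powers of u lie in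
    the kernel since u leads no relation, hence they vanish. *)
Lemma indep_free : indep C X phi (fun v => ~ dep v).
Proof.
move=> p vp p0.
have phiC c : phi (C c) = 0 -> C c = 0.
  by move=> h; apply/eqP; rewrite -(rmorph0 C) (inj_eq (C_inj H)) -(fmorph_eq0 (phi \o C)); apply/eqP.
have key u : forall p, vin (fun v => ~ dep v /\ upto u v) p -> phi p = 0 -> p = 0.
  elim/(well_founded_ind (rk_wf finJ rk)): u => u IH {}p {}vp {}p0.
  have vpu : vin (upto u) p by apply: vinW vp _ => w [].
  have ci0 i : phi (uni u p)`_i = 0.
    have [du|ndu] := classic (dep u).
      have -> : uni u p = p%:P by apply: (uni_const H vp) => -[].
      by rewrite coefC; case: eqP => _; rewrite ?p0 ?rmorph0.
    by apply/eqP; apply: contraPT ndu => h nd; apply: nd; exists p; split=> //; exists i.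
  apply: (uni_inj (H := H) (v := u)); rewrite rmorph0; apply/polyP => i; rewrite coef0.
  have vi : vin (fun v => ~ dep v /\ lt v u) (uni u p)`_i.
    by apply: vinW (uni_coef_vin H u i vp) _ => w [[h1 [->//|h2]] h3].
  have [s [hs vs]] := vin_fin vi.
  case: s hs vs => [|v0 s] hs vs.
    have [c e] := vin_const vs (fun v => elimF idP (in_nil v)).
    by rewrite e; apply: phiC; rewrite -e.
  have [u' us' umax] := rk_max rk (mem_head v0 s).
  apply: (IH u') => //; first by case: (hs u' us').
  apply: vinW vs _ => w ws; split; first by case: (hs w ws).
  by have [->|ne] := eqVneq w u'; [left|right; apply: umax].
have [s [hs vs]] := vin_fin vp.
case: s hs vs => [|v0 s] hs vs.
  have [c e] := vin_const vs (fun v => elimF idP (in_nil v)).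
  by rewrite e; apply: phiC; rewrite -e.
have [u' us' umax] := rk_max rk (mem_head v0 s).
apply: (key u') => //; apply: vinW vs _ => w ws; split; first exact: hs.
by have [->|ne] := eqVneq w u'; [left|right; apply: umax].
Qed.

Lemma vin_cl T p : vin T p -> alg_cl (phi \o C) (fun z => exists2 v, T v & z = phi (X v)) (phi p).
Proof.
have [sf _] := alg_cl_closed (phi \o C) (fun z => exists2 v, T v & z = phi (X v)).
elim=> [c|v Tv|x y _ hx _ hy|x y _ hx _ hy].
- exact: (@alg_cl_base _ _ (phi \o C)).
- by apply: alg_cl_id; exists v.
- by rewrite rmorphD; apply: (subfD sf).
by rewrite rmorphM; apply: (subfM sf).
Qed.

(** Together with indep_free: the derivatives that are not in dep form a transcendence basis,
    compatibly with the ranking.  For an orderly ranking their number up to order t is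
    therefore the value of the Kolchin function at t. *)
Lemma nondep_span v : alg_cl (phi \o C) (fun z => exists2 w, ~ dep w /\ upto v w & z = phi (X w)) (phi (X v)).
Proof.
elim/(well_founded_ind (rk_wf finJ rk)): v => v IH.
have [[p [vp p0 [i ci]]]|nd] := classic (dep v); last first.
  by apply: alg_cl_id; exists v => //; split=> //; left.
have [sf ac] := alg_cl_closed (phi \o C) (fun z => exists2 w, ~ dep w /\ upto v w & z = phi (X w)).
apply: (ac (map_poly phi (uni v p))).
- by apply: contra_neq ci => e; rewrite -coef_map e coef0.
- move=> j; rewrite coef_map; apply: alg_cl_trans (vin_cl (upto_tail vp j)) => _ [w wv ->].
  apply: alg_cl_mono (IH w wv) => _ [w' [h1 h2] ->]; exists w' => //; split=> //.
  by case: h2 => [->|h2]; right=> //; apply: (rk_trans rk) wv.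
by apply/rootP; rewrite horner_map uniK.
Qed.

End Ideal.
End Ranked.
End DiffPoly.

(** * Reduction and Rosenfeld's lemma for one polynomial *)

Section Theta.
Variables (m : nat) (R : diffRingType m).

Lemma iter_comm (f g : R -> R) n x : (forall y, f (g y) = g (f y)) -> iter n f (g x) = g (iter n f x).
Proof. by move=> h; elim: n => //= n ->. Qed.

Lemma theta1 (x : R) : theta mone x = x.
Proof. by rewrite /theta; elim: (enum 'I_m) => //= k s ->; rewrite cm1. Qed.

Lemma theta_mulU k t (x : R) : theta (mmul (ucm k) t) x = dder k (theta t x).
Proof.
rewrite /theta; have : uniq (enum 'I_m) by apply: enum_uniq.
have : k \in enum 'I_m by rewrite mem_enum.
elim: (enum 'I_m) => //= j s IH; rewrite inE => /orP[/eqP<-|ks] /andP[js us].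
  rewrite cmM cmUU add1n /=; congr (dder k (iter _ _ _)).
  elim: s js {IH us} => //= i s IH; rewrite inE negb_or => /andP[ki ks].
  by rewrite IH // cmM cmU (negPf ki).
rewrite IH // cmM cmU; have /negPf-> : k != j by apply: contraNneq js => <-.
by rewrite add0n iter_comm // => y; apply: dderC.
Qed.
End Theta.

Section IdealGen.
Variables (m : nat) (A : diffRingType m) (S : A -> Prop).

Lemma dideal_gen_ideal : is_dideal (dideal_gen S).
Proof.
split.
- by move=> I [h _ _ _] _.
- by move=> x y hx hy I hI hS; case: (hI) => _ h _ _; apply: h; [apply: hx|apply: hy].
- by move=> a x hx I hI hS; case: (hI) => _ _ h _; apply: h; apply: hx.
by move=> k x hx I hI hS; case: (hI) => _ _ _ h; apply: h; apply: hx.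
Qed.

Lemma dgen_mem x : S x -> dideal_gen S x.
Proof. by move=> hx I _; apply. Qed.
Lemma dgen0 : dideal_gen S 0. Proof. by case: dideal_gen_ideal. Qed.
Lemma dgenD x y : dideal_gen S x -> dideal_gen S y -> dideal_gen S (x + y).
Proof. by case: dideal_gen_ideal => _ h _ _; apply: h. Qed.
Lemma dgenM a x : dideal_gen S x -> dideal_gen S (a * x).
Proof. by case: dideal_gen_ideal => _ _ h _; apply: h. Qed.
Lemma dgenX k x : dideal_gen S x -> dideal_gen S (dder k x).
Proof. by case: dideal_gen_ideal => _ _ _ h; apply: h. Qed.
Lemma dgenB x y : dideal_gen S x -> dideal_gen S y -> dideal_gen S (x - y).
Proof. by move=> hx hy; apply: dgenD => //; rewrite -mulN1r; apply: dgenM. Qed.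
End IdealGen.

Section OneGenerator.
Variables (m : nat) (A : diffRingType m) (G : A).
Local Notation gen := (dideal_gen (fun q => q = G)).

Lemma gen_theta t : gen (theta t G).
Proof.
elim/cmonom_ind: t => [|k t IH]; first by rewrite theta1; apply: dgen_mem.
by rewrite theta_mulU; apply: dgenX.
Qed.

(** The derivatives of G are listed once each, so that the one with the highest leader can be
    singled out in elim_span. *)
Lemma gen_spanned q : gen q -> exists (Ts : seq {cmonom 'I_m}) (c : {cmonom 'I_m} -> A),
  uniq Ts /\ q = \sum_(t <- Ts) c t * theta t G.
Proof.
move=> hq; have [r ->] : exists r : seq (A * {cmonom 'I_m}), q = \sum_(x <- r) x.1 * theta x.2 G.
  apply: (hq (fun q => exists r : seq (A * {cmonom 'I_m}), q = \sum_(x <- r) x.1 * theta x.2 G)); last first.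
    by move=> _ ->; exists [:: (1, mone)]; rewrite big_seq1 mul1r theta1.
  split.
  - by exists [::]; rewrite big_nil.
  - by move=> _ _ [r1 ->] [r2 ->]; exists (r1 ++ r2); rewrite big_cat.
  - move=> a _ [r ->]; exists [seq (a * x.1, x.2) | x <- r].
    by rewrite big_map mulr_sumr; apply: eq_bigr => x _; rewrite mulrA.
  move=> k _ [r ->].
  exists ([seq (dder k x.1, x.2) | x <- r] ++ [seq (x.1, mmul (ucm k) x.2) | x <- r]).
  rewrite big_cat !big_map /= -big_split raddf_sum; apply: eq_bigr => x _ /=.
  by rewrite dderM theta_mulU.
elim: r => [|[a t] r [Ts [c [uT e]]]]; first by exists [::], (fun=> 0); rewrite !big_nil.
rewrite big_cons e {e}; have [tT|tT] := boolP (t \in Ts).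
  exists Ts, (fun s => if s == t then c s + a else c s); split=> //.
  rewrite !(bigD1_seq t) //= eqxx mulrDl addrA [_ + a * _]addrC; congr (_ + _ + _).
  by apply: eq_bigr => s /negPf->.
exists (t :: Ts), (fun s => if s == t then a else c s); split; first by rewrite /= tT.
rewrite big_cons eqxx; congr (_ + _); rewrite !big_seq; apply: eq_bigr => s sT.
by have /negPf-> : s != t by apply: contraNneq tT => <-.
Qed.
End OneGenerator.

Section Reduction.
Variables (m : nat) (J : choiceType) (F : diffFieldType m) (A : diffRingType m).
Local Notation W := (deriv_of m J).
Variables (C : {rmorphism F -> A}) (X : W -> A).
Hypothesis H : polyring C X.
Hypothesis derC : forall k c, dder k (C c) = C (dder k c).
Hypothesis derX : forall k v, dder k (X v) = X (dshift k v).
Hypothesis char0 : [pchar F] =i pred0.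
Hypothesis finJ : exists s : seq J, forall j, j \in s.
Implicit Types (T : W -> Prop) (p q : A) (u v w : W) (t : {cmonom 'I_m}).
Local Notation vin := (vin C X).
Local Notation uni := (uni H).
Local Notation dsep := (dsep H).

Definition pderiv u v := exists t, t != mone /\ v = tmul t u.

Lemma poly_natmul_eq0 p n : p *+ n.+1 = 0 -> p = 0.
Proof.
move=> e; have n0 : n.+1%:R != 0 :> F by rewrite ((pcharf0P F).1 char0).
rewrite -[p]mul1r -(rmorph1 C) -(mulVf n0) rmorphM rmorph_nat -mulrA.
by rewrite mulr_natl e mulr0.
Qed.

Lemma dsep_neq0 u p : (1 < size (uni u p))%N -> dsep u p != 0.
Proof.
move=> sz; apply: contraTneq sz => s0; rewrite -leqNgt.
have := uni_dsep H u p; rewrite s0 rmorph0 => e.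
apply/leq_sizeP => j; case: j => // j _.
have := congr1 (fun q : {poly A} => q`_j) e; rewrite coef0 coef_deriv.
by move/esym/poly_natmul_eq0.
Qed.

Lemma not_dvd_deg u (G x : A) : x != 0 -> (size (uni u x) < size (uni u G))%N -> ~ dvdr G x.
Proof.
move=> x0 sz [z e]; move: sz; rewrite e ltnNge.
have z0 : z != 0 by apply: contra_neq x0 => z0; rewrite e z0 mul0r.
have G0 : G != 0 by apply: contra_neq x0 => G0; rewrite e G0 mulr0.
rewrite (size_uniM H) //; case: (size (uni u z)) (size_uni_gt0 H u z0) => // k _.
by rewrite addSn leq_addl.
Qed.

Section Lead.
Variables (lt : rel W) (G : A) (u : W).
Hypothesis rk : is_ranking lt.
Hypothesis vG : vin (upto lt u) G.
Hypothesis sG : (1 < size (uni u G))%N.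
Hypothesis pG : prime_elt G.
Local Notation S := (dsep u G).
Local Notation gen := (dideal_gen (fun q => q = G)).
Let free v := ~ pderiv u v.

Lemma upto_free v : upto lt u v -> free v.
Proof.
move=> [->|h] [t [t1 e]]; first by apply: (rk_neq rk (rk_tmul rk u t1)).
by apply: (rk_asym rk (rk_tmul rk u t1)); rewrite -e.
Qed.

Lemma sep_upto : vin (upto lt u) S.
Proof. exact: dsep_vin. Qed.

Lemma sep_free : vin free S.
Proof. by apply: vinW sep_upto _ => v; apply: upto_free. Qed.

(** By induction from der_chain: differentiating S X v + r gives S X (dshift k v) plus terms
    below the new leader. *)
Lemma theta_lead t : t != mone ->
  exists2 r, theta t G = S * X (tmul t u) + r & vin (below lt (tmul t u)) r.
Proof.
elim/cmonom_ind: t => [|k t IH _]; first by rewrite eqxx.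
rewrite theta_mulU tmulA -dshiftE; have [->|t1] := eqVneq t mone.
  by rewrite theta1 tmul1; apply: der_chain.
have [r -> vr] := IH t1; set v := tmul t u in vr *.
have uv : lt u v by apply: rk_tmul.
exists (dder k S * X v + dder k r); first by rewrite dderD dderM derX; ring.
apply: vinD; last by apply: (der_below derC derX rk k _ vr).
apply: vinM; last by apply: vinX; apply: (rk_shift rk).
apply: (der_below derC derX rk k _ sep_upto) => w [->//|h].
exact (rk_trans rk h uv).
Qed.

Lemma theta_upto t : vin (upto lt (tmul t u)) (theta t G).
Proof.
have [->|t1] := eqVneq t mone; first by rewrite theta1 tmul1.
have [r -> vr] := theta_lead t1; apply: vinD; last by apply: vinW vr _ => w; right.
apply: vinM; last by apply: vinX; left.
apply: vinW sep_upto _ => w [->|h]; right; first exact: rk_tmul.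
exact (rk_trans rk h (rk_tmul rk u t1)).
Qed.

(** Pseudo-division by l, carried out on the generators; the powers of a add up. *)
Lemma linear_reduce (a l r : A) (v : W) (c : A) : l = a * X v + r ->
  vin (fun w => w <> v) a -> vin (fun w => w <> v) r ->
  exists k q c', a ^+ k * c = q * l + c' /\ vin (fun w => w <> v) c'.
Proof.
move=> el va vr; elim: (pr_gen H c) => [d|w _|x y _ [k1 [q1 [c1 [e1 v1]]]] _ [k2 [q2 [c2 [e2 v2]]]]
  |x y _ [k1 [q1 [c1 [e1 v1]]]] _ [k2 [q2 [c2 [e2 v2]]]]].
- by exists 0%N, 0, (C d); split; [rewrite expr0; ring|apply: vinC].
- have [->|/eqP ne] := eqVneq w v.
    exists 1%N, 1, (- r); split; last exact: vinN.
    by rewrite el; ring.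
  by exists 0%N, 0, (X w); split; [rewrite expr0; ring|apply: vinX].
- exists (k1 + k2)%N, (a ^+ k2 * q1 + a ^+ k1 * q2), (a ^+ k2 * c1 + a ^+ k1 * c2); split.
    have -> : a ^+ (k1 + k2) * (x + y) = a ^+ k2 * (a ^+ k1 * x) + a ^+ k1 * (a ^+ k2 * y).
      by rewrite exprD; ring.
    by rewrite e1 e2; ring.
  by apply: vinD; apply: vinM => //; apply: vin_exp.
exists (k1 + k2)%N, (q1 * q2 * l + q1 * c2 + q2 * c1), (c1 * c2); split; last exact: vinM.
have -> : a ^+ (k1 + k2) * (x * y) = (a ^+ k1 * x) * (a ^+ k2 * y) by rewrite exprD; ring.
by rewrite e1 e2; ring.
Qed.

(** Let q, free of proper derivatives of u, be a combination of derivatives of G.  Let theta t G be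
    the one with the highest leader v.  The other coefficients can be made free of v by
    division by theta t G, at the cost of a power of the separant S.  The total
    coefficient of theta t G then vanishes, since everything else is free of v.  So the number
    of derivatives drops, until only G is left. *)
Lemma elim_span (Ts : seq {cmonom 'I_m}) (c : {cmonom 'I_m} -> A) q : uniq Ts ->
  q = \sum_(t <- Ts) c t * theta t G -> vin free q -> exists k, dvdr G (S ^+ k * q).
Proof.
have [n] := ubnP (size Ts); elim: n Ts c q => // n IH Ts c q le_n uT eq vq.
have [[t0 ht0]|nt] := classic (exists t, t \in Ts /\ t != mone); last first.
  exists 0%N; rewrite expr0 mul1r eq; rewrite big_seq.
  apply: big_ind => [||t tT]; [exact: dvdr0|exact: dvdrD|].
  have -> : t = mone by apply: NNPP => /eqP h; apply: nt; exists t.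
  by rewrite theta1; apply/dvdr_mull/dvdrr.
have [t tT [t1 tmax]] : exists2 t, t \in Ts & t != mone /\
    forall s, s \in Ts -> s != t -> lt (tmul s u) (tmul t u).
  have hm : tmul t0 u \in [seq tmul s u | s <- Ts] by apply: map_f; case: ht0.
  have [_ /mapP [t tT ->] umax] := rk_max rk hm.
  have hmax s : s \in Ts -> s != t -> lt (tmul s u) (tmul t u).
    move=> sT st; apply: umax; first exact: map_f.
    apply: contra_neq st => e; apply: cm_ext => i.
    by have := congr1 (fun w : W => w.1 i) e; rewrite /= !cmM => /eqP; rewrite eqn_add2r => /eqP.
  exists t => //; split=> //; apply/eqP => te.
  case: ht0 => ht0 nt0; have := hmax t0 ht0; rewrite te => /(_ nt0).
  by move/(rk_asym rk); apply; rewrite tmul1; apply: (rk_tmul rk).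
have [r er vr] := theta_lead t1; set v := tmul t u in er vr tmax *.
have uv : lt u v by apply: rk_tmul.
have vS : vin (fun w => w <> v) S.
  apply: vinW sep_upto _ => w [->|h]; first exact: (rk_neq rk uv).
  exact: (rk_neq rk (rk_trans rk h uv)).
have vr' : vin (fun w => w <> v) r by apply: vinW vr _ => w; apply: (rk_neq rk).
have vq' : vin (fun w => w <> v) q by apply: vinW vq _ => w fw ew; apply: fw; exists t.
have vs s : s \in rem t Ts -> vin (fun w => w <> v) (theta s G).
  rewrite rem_filter // mem_filter /= => /andP[st sT].
  apply: vinW (theta_upto s) _ => w [->|h]; first exact: (rk_neq rk (tmax s sT st)).
  exact: (rk_neq rk (rk_trans rk h (tmax s sT st))).
have hr s : exists kqc : nat * A * A, S ^+ kqc.1.1 * c s = kqc.1.2 * theta t G + kqc.2 /\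
    vin (fun w => w <> v) kqc.2.
  have [k [q' [c' [h1 h2]]]] := linear_reduce (c s) er vS vr'.
  by exists (k, q', c').
have [g hg] := fun_choice hr.
pose K := (\sum_(s <- rem t Ts) (g s).1.1)%N.
pose c' s := S ^+ (K - (g s).1.1) * (g s).2.
have vc' s : vin (fun w => w <> v) (c' s).
  by apply: vinM; [apply: vin_exp | case: (hg s)].
have hK s : s \in rem t Ts -> S ^+ K * c s = S ^+ (K - (g s).1.1) * (g s).1.2 * theta t G + c' s.
  move=> sT; have le : ((g s).1.1 <= K)%N by rewrite /K (big_rem s) //= leq_addr.
  transitivity (S ^+ (K - (g s).1.1) * (S ^+ (g s).1.1 * c s)).
    by rewrite mulrA -exprD subnK.
  by rewrite (hg s).1 mulrDr mulrA.
pose E := S ^+ K * c t + \sum_(s <- rem t Ts) S ^+ (K - (g s).1.1) * (g s).1.2 * theta s G.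
have eK : S ^+ K * q = E * theta t G + \sum_(s <- rem t Ts) c' s * theta s G.
  rewrite eq (big_rem t) //= mulrDr mulrA /E mulrDl -addrA; congr (_ + _).
  rewrite mulr_sumr mulr_suml -big_split /= !big_seq; apply: eq_bigr => s sT.
  by rewrite mulrA (hK s sT) mulrDl [_ * theta t G * _]mulrAC.
have vE : vin (fun w => w <> v) (E * theta t G).
  have -> : E * theta t G = S ^+ K * q - \sum_(s <- rem t Ts) c' s * theta s G.
    by rewrite eK addrK.
  apply: vinB; first by apply: vinM => //; apply: vin_exp.
  by rewrite big_seq; apply: vin_sum => s sT; apply: vinM => //; apply: vs.
(* E theta t G is free of v although theta t G has degree 1 in v. *)
have E0 : E = 0.
  apply/eqP; apply: contraT => nE.
  have S0 : S != 0 by apply: dsep_neq0.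
  have ut : uni v (theta t G) = S *: 'X + r%:P.
    rewrite er rmorphD rmorphM /= uniX -mul_polyC (uni_const H vr'); last by move=> h; apply: h.
    by rewrite (uni_const H vS); last by move=> h; apply: h.
  have st : size (uni v (theta t G)) = 2%N.
    rewrite ut size_polyDl.
      have := @size_proper_mul _ S%:P 'X; rewrite lead_coefC lead_coefX mulr1 => /(_ S0).
      by rewrite mul_polyC size_polyC S0 size_polyX.
    rewrite (leq_ltn_trans (size_polyC_leq1 _)) //.
    have := @size_proper_mul _ S%:P 'X; rewrite lead_coefC lead_coefX mulr1 => /(_ S0).
    by rewrite mul_polyC size_polyC S0 size_polyX => ->.
  have t0' : theta t G != 0 by rewrite -(uni_eq0 H v) -size_poly_gt0 st.
  have := vin_avoid H vE (fun h => h erefl); rewrite (size_uniM H) // st.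
  by rewrite addn2 ltnS leqn0 size_poly_eq0 uni_eq0 (negPf nE).
rewrite E0 mul0r add0r in eK.
have [||k hk] := IH (rem t Ts) c' (S ^+ K * q) _ (rem_uniq _ uT) eK.
- by rewrite size_rem //; move: le_n; case: (Ts) tT.
- by apply: vinM => //; apply/vin_exp/sep_free.
by exists (k + K)%N; rewrite exprD -mulrA.
Qed.

Lemma sep_not_dvd : ~ dvdr G S.
Proof.
apply: (@not_dvd_deg u); first exact: dsep_neq0.
rewrite uni_dsep; apply: lt_size_deriv; rewrite -size_poly_gt0; exact: ltnW.
Qed.

(** Rosenfeld's lemma for one polynomial: as a multiple of q by a power of the separant is a
    multiple of G, and G is prime and does not divide its separant, G divides q. *)
Lemma rosenfeld q : gen q -> vin free q -> dvdr G q.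
Proof.
move=> hq vq; have [Ts [c [uT e]]] := gen_spanned hq.
have [k hk] := elim_span uT e vq.
have [_ _ Gp] := pG; case: (Gp _ _ hk) => // /(prime_exp pG) h.
by case: sep_not_dvd.
Qed.

(** It is enough to reduce variables; a proper derivative of the leader is replaced, by
    theta_lead, with lower derivatives, and rankings are well founded. *)
Lemma reduction p : exists b r, gen (S ^+ b * p - r) /\ vin free r.
Proof.
pose Q p := exists b r, gen (S ^+ b * p - r) /\ vin free r.
have QC c : Q (C c).
  by exists 0%N, (C c); rewrite expr0 mul1r subrr; split; [apply: dgen0 | apply: vinC].
have QD x y : Q x -> Q y -> Q (x + y).
  move=> [b1 [r1 [g1 v1]]] [b2 [r2 [g2 v2]]].
  exists (b1 + b2)%N, (S ^+ b2 * r1 + S ^+ b1 * r2); split; last first.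
    by apply: vinD; apply: vinM => //; apply/vin_exp/sep_free.
  have -> : S ^+ (b1 + b2) * (x + y) - (S ^+ b2 * r1 + S ^+ b1 * r2) =
    S ^+ b2 * (S ^+ b1 * x - r1) + S ^+ b1 * (S ^+ b2 * y - r2) by rewrite exprD; ring.
  by apply: dgenD; apply: dgenM.
have QM x y : Q x -> Q y -> Q (x * y).
  move=> [b1 [r1 [g1 v1]]] [b2 [r2 [g2 v2]]].
  exists (b1 + b2)%N, (r1 * r2); split; last exact: vinM.
  have -> : S ^+ (b1 + b2) * (x * y) - r1 * r2 =
    (S ^+ b2 * y) * (S ^+ b1 * x - r1) + r1 * (S ^+ b2 * y - r2) by rewrite exprD; ring.
  by apply: dgenD; apply: dgenM.
have QX v : Q (X v).
  elim/(well_founded_ind (rk_wf finJ rk)): v => v IH.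
  have [[t [t1 ev]]|fv] := classic (pderiv u v); last first.
    by exists 0%N, (X v); rewrite expr0 mul1r subrr; split; [apply: dgen0 | apply: vinX].
  have [r er vr] := theta_lead t1; rewrite -ev in er vr.
  have [b [r' [gr vr']]] : Q r.
    by elim: vr => [c|w wv|x y _ hx _ hy|x y _ hx _ hy]; [exact: QC|exact: IH|exact: QD|exact: QM].
  exists (b + 1)%N, (- r'); split; last exact: vinN.
  have -> : S ^+ (b + 1) * X v - - r' = S ^+ b * theta t G - (S ^+ b * r - r').
    by rewrite er exprD expr1; ring.
  by apply: dgenB; [apply: dgenM; apply: gen_theta | exact: gr].
by elim: (pr_gen H p) => [c|w _|x y _ hx _ hy|x y _ hx _ hy]; [exact: QC|exact: QX|exact: QD|exact: QM].
Qed.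
End Lead.
End Reduction.

(** * General components *)

Section GeneralComponent.
Variables (m : nat) (J : choiceType) (F : diffFieldType m) (A : diffRingType m).
Local Notation W := (deriv_of m J).
Variables (C : {rmorphism F -> A}) (X : W -> A).
Hypothesis H : polyring C X.
Hypothesis derC : forall k c, dder k (C c) = C (dder k c).
Hypothesis derX : forall k v, dder k (X v) = X (dshift k v).
Hypothesis char0 : [pchar F] =i pred0.
Hypothesis finJ : exists s : seq J, forall j, j \in s.
Implicit Types (T : W -> Prop) (p q G : A) (u v w : W) (t : {cmonom 'I_m}).
Local Notation vin := (vin C X).
Local Notation uni := (uni H).
Local Notation dsep := (dsep H).
Local Notation gen G := (dideal_gen (fun q => q = G)).

(** The saturation with I in place of the initial: the arguments only use that I is nonzero, has
    variables of G only, and lies below the leader (lead_at). *)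
Definition sat_by G u I p := exists a b, gen G (I ^+ a * dsep u G ^+ b * p).

Definition lead_at (lt : rel W) G u I :=
  [/\ vin (upto lt u) G, (1 < size (uni u G))%N, I != 0 &
      vin (below lt u) I /\ forall T, vin T G -> vin T I].

Section Sat.
Variables (L : fieldType) (phi : {rmorphism A -> L}).
Hypothesis phi_der : forall k p, phi p = 0 -> phi (dder k p) = 0.

(** The hypothesis on v0 is what the Kolchin polynomial will provide, for an orderly lto; the
    saturation is then described for an arbitrary ranking. *)
Section Principal.
Variables (lto : rel W) (v0 : W).
Hypothesis rko : is_ranking lto.
Hypothesis dep_v0 : forall v, dep H lto phi v <-> exists t, v = tmul t v0.

Lemma ideal_ker G p : phi G = 0 -> gen G p -> phi p = 0.
Proof.
move=> pG hp; apply: (hp (fun q => phi q = 0)); last by move=> _ ->.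
split; [exact: rmorph0 | | | exact: phi_der].
  by move=> x y hx hy; rewrite rmorphD hx hy addr0.
by move=> a x hx; rewrite rmorphM hx mulr0.
Qed.

Lemma below_nondep v : lto v v0 -> ~ dep H lto phi v.
Proof.
move=> h /dep_v0 [t e]; have [t1|t1] := eqVneq t mone.
  by move: h; rewrite e t1 tmul1 (rk_irr rko).
by apply: (rk_asym rko h); rewrite e; apply: rk_tmul.
Qed.

Lemma generator_exists : exists G,
  [/\ is_irreducible G, phi G = 0, vin (upto lto v0) G & (1 < size (uni v0 G))%N].
Proof.
have [p0 [vp p0K [i ci]]] : dep H lto phi v0.
  by apply/dep_v0; exists mone; rewrite tmul1.
have np0 : p0 != 0 by apply: contra_neq ci => ->; rewrite rmorph0 coef0 rmorph0.
have [] := @irr_factor _ _ _ _ _ H (fun p => phi p = 0) _ p0 _ _ _ p0K vp np0.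
- by rewrite rmorph1 => /eqP; rewrite oner_eq0.
- by move=> x y /eqP; rewrite rmorphM mulf_eq0 => /orP[]/eqP; [left|right].
- by move=> a x hx; rewrite rmorphM hx mulr0.
move=> G [iG GK vG]; exists G; split=> //.
rewrite ltnNge; apply/negP => sz; case: (iG) => G0 _ _; apply: G0.
apply: (indep_free (H := H) rko finJ (phi := phi)) => //.
apply: vinW (uni_size1 vG sz) _ => w [[->//|h] _]; exact: below_nondep.
Qed.

Section Generator.
Variable G : A.
Hypothesis iG : is_irreducible G.
Hypothesis GK : phi G = 0.
Hypothesis vG : vin (upto lto v0) G.
Hypothesis sG : (1 < size (uni v0 G))%N.

Let pG : prime_elt G.
Proof. exact: irr_prime_poly H _ iG. Qed.

(** Otherwise elimination of v0 between G and r would give a nonzero element of the kernel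
    without any derivative of v0. *)
Lemma ker_free_dvd r : phi r = 0 -> vin (fun v => ~ pderiv v0 v) r -> dvdr G r.
Proof.
move=> rK vr; apply: NNPP => nd.
have vG' : vin (fun v => ~ pderiv v0 v) G.
  by apply: vinW vG _ => v; apply: upto_free.
have [a [b [c [e c0 vc]]]] := bezout_elim (H := H) pG vG' vr sG nd.
move/eqP: c0; apply; apply: (indep_free (H := H) rko finJ (phi := phi)).
  apply: vinW vc _ => w [h1 h2] /dep_v0 [t ew].
  have [t1|t1] := eqVneq t mone; first by apply: h2; rewrite ew t1 tmul1.
  by apply: h1; exists t.
by rewrite -e rmorphD !rmorphM GK rK !mulr0 addr0.
Qed.

Lemma gen_dvd x : dvdr G x -> gen G x.
Proof. by case=> z ->; apply: dgenM; apply: dgen_mem. Qed.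

(** Conversely to the easy inclusion, reduce p in the kernel modulo G: once for lto, which
    yields a remainder in the kernel and hence a multiple of G, and once for lt, for which u is
    the leader.  Comparing the two remainders,
    Rosenfeld's lemma for lt shows that the second one is a multiple of G too.  Initial and
    separant are outside the kernel because G does not divide them. *)
Lemma ker_sat lt u I p : is_ranking lt -> lead_at lt G u I -> (phi p = 0 <-> sat_by G u I p).
Proof.
move=> rk [vGu sGu I0 [vI vIT]].
have freeS : vin (fun v => ~ pderiv v0 v) (dsep u G).
  by apply: dsep_vin; apply: vinW vG _ => v; apply: upto_free.
have SK : phi (dsep u G) != 0.
  apply/eqP => /ker_free_dvd /(_ freeS); exact: sep_not_dvd.
have IK : phi I != 0.
  apply/eqP => /ker_free_dvd h.
  have [] : ~ dvdr G I.
    apply: (not_dvd_deg (H := H) (u := u)); first exact: I0.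
    apply: leq_ltn_trans sGu; apply: (vin_avoid H vI); by rewrite /below (rk_irr rk).
  by apply: h; apply: vIT; apply: vinW vG _ => v; apply: upto_free.
split=> [pK|[a [b h]]]; last first.
  have := ideal_ker GK h; rewrite !rmorphM !rmorphXn /= => /eqP.
  by rewrite !mulf_eq0 !expf_eq0 (negPf SK) (negPf IK) !andbF => /eqP.
have [b [r [gr vr]]] := reduction H derC derX finJ rko vG p.
have So : gen G (dsep v0 G ^+ b * p).
  have rK : phi r = 0.
    have := ideal_ker GK gr; rewrite rmorphB rmorphM pK mulr0 sub0r => /eqP.
    by rewrite oppr_eq0 => /eqP.
  by rewrite -(subrK r (_ * p)); apply: dgenD gr _; apply: gen_dvd; exact: ker_free_dvd rK vr.
have [c [r' [gr' vr']]] := reduction H derC derX finJ rk vGu p.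
have Sor : gen G (dsep v0 G ^+ b * r').
  have -> : dsep v0 G ^+ b * r' = dsep u G ^+ c * (dsep v0 G ^+ b * p)
     - dsep v0 G ^+ b * (dsep u G ^+ c * p - r') by ring.
  by apply: dgenB; apply: dgenM.
have vSo : vin (fun v => ~ pderiv u v) (dsep v0 G).
  by apply: dsep_vin; apply: vinW vGu _ => v; apply: upto_free.
have Gr' : dvdr G r'.
  have [_ _ Gp] := pG.
  have /Gp [/(prime_exp pG)|//] : dvdr G (dsep v0 G ^+ b * r').
    apply: (rosenfeld derC derX char0 rk vGu sGu pG Sor).
    by apply: vinM => //; apply: vin_exp.
  by move/(sep_not_dvd char0 sG).
exists 0%N, c; rewrite expr0 mul1r -(subrK r' (_ * p)).
by apply: dgenD gr' _; apply: gen_dvd.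
Qed.
End Generator.
End Principal.
End Sat.

Section Uniqueness.
Variables (lt : rel W) (rk : is_ranking lt).
Variables (G G' : A) (u u' : W) (I I' : A).
Hypothesis iG : is_irreducible G.
Hypothesis iG' : is_irreducible G'.
Hypothesis lG : lead_at lt G u I.
Hypothesis lG' : lead_at lt G' u' I'.

(** Rosenfeld's lemma, initial and separant being cancelled since G is prime. *)
Lemma sat_free_dvd p : sat_by G u I p -> vin (fun v => ~ pderiv u v) p -> dvdr G p.
Proof.
case: lG => vGu sGu I0 [vI vIT] [a [b h]] vp.
have pG : prime_elt G by exact: irr_prime_poly H _ iG.
have fr v : upto lt u v -> ~ pderiv u v by apply: upto_free.
have : dvdr G (I ^+ a * dsep u G ^+ b * p).
  apply: (rosenfeld derC derX char0 rk vGu sGu pG h).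
  apply: vinM => //; apply: vinM; apply: vin_exp.
    by apply: vinW vI _ => v hv; apply: fr; right.
  by apply: vinW (dsep_vin H u vGu) _.
have [_ _ Gp] := pG; case/Gp => // /Gp [] /(prime_exp pG).
  move=> hI; exfalso; move: hI; apply: (not_dvd_deg (H := H) (u := u)); first exact: I0.
  by apply: leq_ltn_trans sGu; apply: (vin_avoid H vI); rewrite /below (rk_irr rk).
by move/(sep_not_dvd char0 sGu).
Qed.

Lemma sat_self : sat_by G u I G.
Proof. by exists 0%N, 0%N; rewrite !expr0 !mul1r; apply: dgen_mem. Qed.
End Uniqueness.

Lemma irr_associates (G G' : A) : is_irreducible G -> is_irreducible G' -> dvdr G G' ->
  exists2 c, invertible c & G' = c * G.
Proof.
move=> [_ nG _] [_ _ h] [c e]; exists c => //.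
by case: (h c G e).
Qed.

(** If the leader of G' is not below that of G, or conversely, one of the two polynomials is
    free of proper derivatives of the leader of the other, which divides it. *)
Lemma generator_unique lt G G' u u' I I' : is_ranking lt ->
  is_irreducible G -> is_irreducible G' -> lead_at lt G u I -> lead_at lt G' u' I' ->
  (forall p, sat_by G u I p <-> sat_by G' u' I' p) ->
  exists2 c, invertible c & G' = c * G \/ G = c * G'.
Proof.
move=> rk iG iG' lG lG' e.
have sub v w x : ~ lt w v -> upto lt v x -> ~ pderiv w x.
  move=> nwv h [t [t1 ex]]; have wx : lt w x by rewrite ex; apply: rk_tmul.
  by case: h => [xv|h]; apply: nwv; [rewrite -xv | apply: (rk_trans rk wx h)].
have [vG _ _ _] := lG; have [vG' _ _ _] := lG'.
have [h|h] := boolP (lt u u'); last first.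
  have [|c hc ec] := irr_associates iG iG'; last by exists c => //; left.
  apply: (sat_free_dvd rk iG lG); first by apply/e; apply: sat_self.
  by apply: vinW vG' _ => v; apply: sub; apply/negP.
have [|c hc ec] := irr_associates iG' iG; last by exists c => //; right.
apply: (sat_free_dvd rk iG' lG'); first by apply/e; apply: sat_self.
by apply: vinW vG _ => v; apply: sub => h'; apply: (rk_asym rk h h').
Qed.
End GeneralComponent.

(** * Growth of the counting functions *)

Local Open Scope nat_scope.

Section Growth.
Variable k : nat.
Local Notation n0 t := 'C(k + t, k).
Local Notation n1 t := 'C(k.+1 + t, k.+1).
Local Notation N t := 'C(k.+2 + t, k.+2).

Lemma binom_step l t : 'C(l.+1 + t.+1, l.+1) = 'C(l.+1 + t, l.+1) + 'C(l + t.+1, l).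
Proof. by rewrite addnS binS addSnnS. Qed.

Lemma expn_mono a b l : a <= b -> a ^ l <= b ^ l.
Proof. by move=> h; elim: l => // l IH; rewrite !expnS leq_mul. Qed.

(** This bound and the next one give the order of growth of the binomial coefficients, with
    explicit constants so that limits are avoided. *)
Lemma binom_upper l t : 'C(l + t, l) <= t.+1 ^ l.
Proof.
elim: l t => [|l IH] t; first by rewrite bin0.
have key : forall u, u <= t -> 'C(l.+1 + u, l.+1) <= u.+1 * t.+1 ^ l.
  elim=> [|u IHu] hu; first by rewrite addn0 binn mul1n expn_gt0.
  rewrite binom_step [u.+2 * _]mulSn addnC leq_add ?IHu ?(ltnW hu) //.
  by apply: leq_trans (IH _) _; exact: expn_mono.
by rewrite expnS; apply: key.
Qed.

Lemma binom_lower l t : t.+1 ^ l <= l`! * 'C(l + t, l).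
Proof.
elim: l => [|l IH]; first by rewrite bin0.
have e : l.+1 * 'C(l.+1 + t, l.+1) = (l.+1 + t) * 'C(l + t, l) by rewrite -mul_bin_diag addSn.
rewrite factS mulnAC e expnS -mulnA leq_mul //; first by rewrite addSn ltnS leq_addl.
by rewrite mulnC.
Qed.

(** N t - N (t - e), the number of monomials of degree at most t in k + 2 variables that
    are not multiples of a given monomial of degree e, written as a sum of positive
    terms to avoid truncated subtraction. *)
Definition nondiv e t := \sum_(i < e) n1 (t - i).

Lemma binom_nondiv e t : e <= t -> N t = N (t - e) + nondiv e t.
Proof.
elim: e => [|e IH] h; first by rewrite /nondiv big_ord0 subn0 addn0.
rewrite IH ?(ltnW h) // /nondiv big_ord_recr /= -/(nondiv e t).
have -> : t - e = (t - e.+1).+1 by rewrite subnSK.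
by rewrite binom_step; lia.
Qed.

Lemma n1_mono s t : s <= t -> n1 s <= n1 t.
Proof. by move=> h; apply: leq_bin2l; rewrite leq_add2l. Qed.

Lemma n1_smono s t : s < t -> n1 s < n1 t.
Proof.
case: t => // t; rewrite ltnS => h; apply: leq_ltn_trans (n1_mono h) _.
rewrite binom_step -[X in X < _]addn0 ltn_add2l bin_gt0; lia.
Qed.

Lemma N_smono s t : s < t -> N s < N t.
Proof.
elim: t => // t IH; rewrite ltnS leq_eqVlt => /orP[/eqP->|/IH h].
  by rewrite binom_step -[X in X < _]addn0 ltn_add2l bin_gt0; lia.
by apply: ltn_trans h _; rewrite binom_step -[X in X < _]addn0 ltn_add2l bin_gt0; lia.
Qed.

Lemma nondiv_le e t : nondiv e t <= e * n1 t.
Proof.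
rewrite -[e in leqRHS]card_ord -sum_nat_const; apply: leq_sum => i _.
by apply: n1_mono; apply: leq_subr.
Qed.

Lemma nondiv_ge e t : e * n1 (t - e) <= nondiv e t.
Proof.
rewrite -{1}(card_ord e) -sum_nat_const; apply: leq_sum => i _.
by apply: n1_mono; apply: leq_sub2l; exact: ltnW (ltn_ord i).
Qed.

Lemma n1_diff e t : e <= t -> n1 t <= n1 (t - e) + e * n0 t.
Proof.
elim: e => [|e IH] h; first by rewrite subn0 mul0n addn0.
apply: leq_trans (IH (ltnW h)) _.
have -> : t - e = (t - e.+1).+1 by rewrite subnSK.
rewrite binom_step mulSn addnA leq_add2r leq_add2l; apply: leq_bin2l; lia.
Qed.

Lemma nondiv_add e1 e2 t : nondiv (e1 + e2) t = nondiv e1 t + nondiv e2 (t - e1).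
Proof.
rewrite /nondiv big_split_ord /=; congr (_ + _); apply: eq_bigr => i _.
by rewrite subnDA.
Qed.

Lemma nondiv_mono e s t : s <= t -> nondiv e s <= nondiv e t.
Proof. by move=> h; apply: leq_sum => i _; apply: n1_mono; apply: leq_sub2r. Qed.

Lemma nondiv_smono e s t : 0 < e -> s < t -> nondiv e s < nondiv e t.
Proof.
case: e => // e _ h; rewrite /nondiv !big_ord_recl -addSn leq_add //.
  by rewrite !subn0; apply: n1_smono.
by apply: leq_sum => i _; apply: n1_mono; apply: leq_sub2r; apply: ltnW.
Qed.

Lemma nondiv_subadd (I : Type) (l : seq I) (e : I -> nat) t :
  nondiv (\sum_(j <- l) e j) t <= \sum_(j <- l) nondiv (e j) t.
Proof.
elim: l => [|j l IH]; first by rewrite !big_nil /nondiv big_ord0.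
rewrite !big_cons nondiv_add leq_add2l; apply: leq_trans IH; apply: nondiv_mono; exact: leq_subr.
Qed.

Lemma count_pos_sum (I : Type) (l : seq I) (e : I -> nat) :
  0 < count (fun j => 0 < e j) l -> 0 < \sum_(j <- l) e j.
Proof.
elim: l => //= j l IH; rewrite big_cons; case: (posnP (e j)) => [->|h _]; first exact: IH.
by rewrite addn_gt0 h.
Qed.

(** nondiv is strictly concave in e, so equality in the subadditivity forces all of the order
    to sit in one term.  This is where at least two derivations are needed: with one,
    nondiv would be linear in e. *)
Lemma nondiv_subadd_eq (I : Type) (l : seq I) (e : I -> nat) t : \sum_(j <- l) e j <= t ->
  \sum_(j <- l) nondiv (e j) t <= nondiv (\sum_(j <- l) e j) t -> count (fun j => 0 < e j) l <= 1.
Proof.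
elim: l => //= j l IH; rewrite !big_cons => le_t.
rewrite nondiv_add leq_add2l => h.
have le2 : \sum_(i <- l) nondiv (e i) t <= nondiv (\sum_(i <- l) e i) t.
  by apply: leq_trans h _; apply: nondiv_mono; exact: leq_subr.
have {}IH := IH (leq_trans (leq_addl _ _) le_t) le2.
have [_|ej] := posnP (e j); first by [].
rewrite leqNgt; apply/negP => hc.
have El : 0 < \sum_(i <- l) e i by apply: count_pos_sum; move: hc; rewrite add1n ltnS.
have lt_t : t - e j < t by lia.
by have := leq_trans (nondiv_smono El lt_t) (leq_trans (nondiv_subadd l e t) h); rewrite ltnn.
Qed.

(** The equation eqn between counting functions: a is the number of indeterminates without leading
    derivatives; for each of the others, j in l, the monomials that do not lead are the
    nonmultiples of a monomial of degree e j, and h j t more, where h j is of lower growth. *)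
Section Asymptotics.
Variables (I : eqType) (l : seq I) (e : I -> nat) (h : I -> nat -> nat) (K a D s t0 : nat).
Hypothesis hK : forall j t, j \in l -> h j t <= K * t.+1 ^ k.
Hypothesis eqn : forall t, t0 <= t ->
  a * N t + \sum_(j <- l) (nondiv (e j) t + h j t) + N (t - s) = D * N t.
Local Notation E := (\sum_(j <- l) e j).
Local Notation M := (K * size l).

Lemma sum_h t : \sum_(j <- l) h j t <= M * t.+1 ^ k.
Proof.
have -> : M * t.+1 ^ k = \sum_(j <- l) K * t.+1 ^ k.
  by rewrite big_const_seq count_predT iter_addn_0 mulnAC.
rewrite big_seq [X in _ <= X]big_seq.
by apply: leq_sum => j hj; apply: hK.
Qed.

Lemma n1_big c : exists t1, forall t, t1 <= t -> c * t.+1 ^ k < n1 t.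
Proof.
exists (k.+1`! * c) => t ht; rewrite -(ltn_pmul2l (fact_gt0 k.+1)).
apply: leq_trans (binom_lower k.+1 t); rewrite expnS mulnA ltn_pmul2r ?expn_gt0 //.
Qed.

Lemma N_big c : exists t1, forall t, t1 <= t -> c * n1 t < N t.
Proof.
exists (k.+2 * c) => t ht; rewrite -(ltn_pmul2l (ltn0Sn k.+1)).
have -> : k.+2 * N t = (k.+2 + t) * n1 t by rewrite -mul_bin_diag addSn.
by rewrite mulnA ltn_pmul2r ?bin_gt0 ?leq_addr //; lia.
Qed.

(** Comparison of the terms of degree k + 2 in t. *)
Lemma count_empty : a.+1 = D.
Proof.
have Npos t : 0 < N t by rewrite bin_gt0 leq_addr.
apply/eqP; rewrite eqn_leq; apply/andP; split; last first.
  rewrite leqNgt; apply/negP => lt_aD.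
  have [t1 h1] := N_big (E + M); have [t2 h2] := n1_big 1.
  pose t := t0 + t1 + t2.
  have e0 := eqn (_ : t0 <= t); have le1 : N (t - s) <= N t.
    by apply: leq_bin2l; rewrite leq_add2l leq_subr.
  have le2 : \sum_(j <- l) (nondiv (e j) t + h j t) <= (E + M) * n1 t.
    rewrite big_split mulnDl /= leq_add //.
      by rewrite big_distrl /=; apply: leq_sum => j _; apply: nondiv_le.
    apply: leq_trans (sum_h t) _; rewrite leq_mul2l orbC ltnW //.
    by rewrite -[X in X < _]mul1n h2 // /t leq_addl.
  have lt3 := h1 t; have : (a.+2) * N t <= D * N t by rewrite leq_mul2r lt_aD orbT.
  rewrite -e0 ?mulSn; last by rewrite /t; lia.
  have : t1 <= t by rewrite /t; lia.
  by move/lt3; lia.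
rewrite ltnNge; apply/negP => le_Da.
have e0 := eqn (leqnn t0); have := Npos (t0 - s).
have : D * N t0 <= a * N t0 by rewrite leq_mul2r le_Da orbT.
by rewrite -e0; lia.
Qed.

Lemma eqn_reduced t : t0 <= t -> s <= t -> \sum_(j <- l) nondiv (e j) t + \sum_(j <- l) h j t = nondiv s t.
Proof.
move=> ht hs; have := eqn ht; rewrite -count_empty mulSn big_split /=.
by have := binom_nondiv hs; lia.
Qed.

(** Comparison of the terms of degree k + 1 in t. *)
Lemma total_order : E = s.
Proof.
have [t1 h1] := n1_big (E.+1 * E.+1 + M).
pose t := t0 + s + E.+1 + t1.
have et : \sum_(j <- l) nondiv (e j) t + \sum_(j <- l) h j t = nondiv s t.
  by apply: eqn_reduced; rewrite /t; lia.
apply/eqP; rewrite eqn_leq; apply/andP; split; rewrite leqNgt; apply/negP => lt_.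
  have h2 : nondiv E t <= nondiv s t by rewrite -et; apply: leq_trans (nondiv_subadd _ _ _) (leq_addr _ _).
  have hs : s <= t by rewrite /t; lia. have hE : E <= t by rewrite /t; lia.
  have e1 := binom_nondiv hs; have e2 := binom_nondiv hE.
  have h3 : N (t - E) < N (t - s) by apply: N_smono; rewrite /t; lia.
  lia.
have h2 : nondiv E.+1 t <= nondiv s t.
  by rewrite -(subnKC lt_) nondiv_add leq_addr.
have h3 := nondiv_ge E.+1 t.
have h4 : \sum_(j <- l) nondiv (e j) t <= E * n1 t.
  by rewrite big_distrl /=; apply: leq_sum => j _; apply: nondiv_le.
have h5 := sum_h t.
have h6 : n1 t <= n1 (t - E.+1) + E.+1 * n0 t by apply: n1_diff; rewrite /t; lia.
have h7 := binom_upper k t.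
have h8 : (E.+1 * E.+1 + M) * t.+1 ^ k < n1 t by apply: h1; rewrite /t; lia.
have h9 : E.+1 * n1 t <= E.+1 * n1 (t - E.+1) + E.+1 * E.+1 * t.+1 ^ k.
  by apply: leq_trans (leq_mul (leqnn E.+1) h6) _; rewrite mulnDr leq_add2l mulnA leq_mul2l h7 orbT.
have h10 : E.+1 * n1 t = n1 t + E * n1 t by rewrite mulSn.
have h11 : (E.+1 * E.+1 + M) * t.+1 ^ k = E.+1 * E.+1 * t.+1 ^ k + M * t.+1 ^ k by rewrite mulnDl.
lia.
Qed.

(** Subadditivity of nondiv leaves no room for the lower order terms. *)
Lemma no_excess t : t0 <= t -> s <= t -> forall j, j \in l -> h j t = 0.
Proof.
move=> ht hs j jl; have := eqn_reduced ht hs; rewrite -total_order => et.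
have := nondiv_subadd l e t; rewrite -et -[X in _ <= X]addn0 leq_add2l leqn0 => /eqP h0.
by apply/eqP; rewrite -leqn0 -h0 (big_rem j) //= leq_addr.
Qed.

Lemma one_positive : count (fun j => 0 < e j) l <= 1.
Proof.
apply: (@nondiv_subadd_eq _ _ _ (t0 + s)); first by rewrite total_order leq_addl.
by rewrite total_order -(@eqn_reduced (t0 + s)) ?leq_addr ?leq_addl.
Qed.
End Asymptotics.
End Growth.
Local Open Scope ring_scope.

(** * Counting monomials of bounded degree *)

Local Open Scope nat_scope.

Section Counting.
Variable m : nat.
Local Notation Theta := {cmonom 'I_m}.
Implicit Types (g t : Theta) (E : Theta -> Prop).

Definition cm_of (f : 'I_m -> nat) : Theta := \big[mmul/mone]_(i < m) expcmn (ucm i) (f i).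

Lemma cm_ofE f k : cm_of f k = f k.
Proof.
rewrite /cm_of (big_morph (fun M : Theta => M k) (id1 := 0) (op1 := addn)); last exact: cm1.
  rewrite (bigD1 k) //= expcmnE cmUU mul1n big1 ?addn0 // => i ik.
  by rewrite expcmnE cmU (negPf ik).
by move=> x y; rewrite cmM.
Qed.

Lemma mdeg_sum t : mdeg t = \sum_(i < m) t i.
Proof.
rewrite (mdegEw (d := [fset i | i in 'I_m]%fset)); last by apply/fsubsetP => i _; rewrite inE.
rewrite big_imfset //= ?big_enum //=.
Qed.

Lemma coord_le t i : t i <= mdeg t.
Proof. by rewrite mdeg_sum (bigD1 i) //= leq_addr. Qed.

Definition mons n : seq Theta :=
  [seq cm_of (fun i => val (tnth x i)) | x <- enum [set x : m.-tuple 'I_n.+1 | \sum_(i <- x) i <= n]].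

Lemma mons_uniq n : uniq (mons n).
Proof.
rewrite map_inj_uniq ?enum_uniq // => x y e; apply: eq_from_tnth => i.
by apply: val_inj; rewrite /= -(cm_ofE (fun i => val (tnth x i))) e cm_ofE.
Qed.

Lemma size_mons n : size (mons n) = 'C(m + n, m).
Proof. by rewrite size_map -cardE card_partial_ord_partitions. Qed.

Lemma mem_mons n t : (t \in mons n) = (mdeg t <= n).
Proof.
apply/mapP/idP => [[x]|le_t].
  rewrite mem_enum inE big_tuple => hx ->; rewrite mdeg_sum.
  by rewrite (eq_bigr (fun i => tnth x i : nat)) // => i _; rewrite cm_ofE.
exists [tuple inord (t i) : 'I_n.+1 | i < m].
  rewrite mem_enum inE big_tuple (eq_bigr (fun i => t i)) -?mdeg_sum // => i _.
  by rewrite tnth_mktuple inordK // ltnS (leq_trans (coord_le t i)).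
apply: cm_ext => i; rewrite cm_ofE tnth_mktuple /= inordK // ltnS.
exact: leq_trans (coord_le t i) le_t.
Qed.

Definition cdvd g t := propb (forall k, g k <= t k).

Lemma cdvdP g t : reflect (exists t', t = mmul g t') (cdvd g t).
Proof.
apply: (iffP (propbP _)) => [h|[t' ->] k]; last by rewrite cmM leq_addr.
by exists (divcm t g); apply: cm_ext => k; rewrite cmM divcmE subnKC.
Qed.

Lemma mmul_inj g : injective (mmul g).
Proof.
move=> s t e; apply: cm_ext => k; have := congr1 (fun M : Theta => M k) e.
by rewrite !cmM => /eqP; rewrite eqn_add2l => /eqP.
Qed.

Lemma count_cdvd g n : mdeg g <= n -> count (cdvd g) (mons n) = size (mons (n - mdeg g)).
Proof.
move=> le; rewrite -size_filter -(size_map (mmul g) (mons (n - _))).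
apply/eqP; rewrite eqn_leq; apply/andP; split; apply: uniq_leq_size.
- by rewrite filter_uniq ?mons_uniq.
- move=> t; rewrite mem_filter mem_mons => /andP[/cdvdP [t' ->]].
  rewrite mdegM => h; apply: map_f; rewrite mem_mons; lia.
- by rewrite map_inj_uniq ?mons_uniq //; apply: mmul_inj.
move=> _ /mapP [t ht ->]; rewrite mem_filter mem_mons mdegM.
rewrite mem_mons in ht; apply/andP; split; last by lia.
by apply/cdvdP; exists t.
Qed.

(** Fixing two coordinates in a finite range leaves m - 2 free coordinates. *)
Lemma count_two_small B n :
  count (fun t : Theta => propb (exists i j, [/\ i != j, t i < B & t j < B])) (mons n)
   <= #|'I_m| * #|'I_m| * (B * B) * n.+1 ^ (m - 2).
Proof.
pose tof (t : Theta) : {ffun 'I_m -> 'I_n.+1} := [ffun i => inord (t i)].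
rewrite -size_filter; set l := filter _ _.
have tofE t i : t \in mons n -> val (tof t i) = t i.
  by rewrite mem_mons ffunE => h; rewrite /= inordK // ltnS (leq_trans (coord_le t i)).
have linj : {in l &, injective tof}.
  move=> s t; rewrite !mem_filter => /andP[_ hs] /andP[_ ht] e; apply: cm_ext => i.
  by rewrite -(tofE s i hs) -(tofE t i ht) e.
have ul : uniq (map tof l) by rewrite map_inj_in_uniq // filter_uniq // mons_uniq.
rewrite -(size_map tof).
pose Fij (p : 'I_m * 'I_m) : {set {ffun 'I_m -> 'I_n.+1}} :=
  [set f in family (fun k => [pred x : 'I_n.+1 | ((k == p.1) || (k == p.2)) ==> (x < B)])].
pose U := \bigcup_(p | p.1 != p.2) Fij p.
have -> : size (map tof l) = #|[set x in map tof l]|.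
  by rewrite cardsE; apply/esym/card_uniqP.
apply: (@leq_trans #|U|).
  apply: subset_leq_card; apply/subsetP => f; rewrite inE => /mapP [t].
  rewrite mem_filter => /andP[/propbP [i [j [ij hi hj]]] ht] ->.
  apply/bigcupP; exists (i, j) => //; rewrite inE; apply/familyP => k.
  rewrite inE; apply/implyP => /orP[]/eqP->; by rewrite (tofE t _ ht).
have cardF p : p.1 != p.2 -> #|Fij p| <= B * B * n.+1 ^ (m - 2).
  case: p => i j /= ij; rewrite cardsE card_family foldrE big_map big_enum /=.
  rewrite (bigD1 i) //= (bigD1 j) /=; last by rewrite eq_sym.
  have small k : (k == i) || (k == j) ->
      #|[pred x : 'I_n.+1 | ((k == i) || (k == j)) ==> (x < B)]| <= B.
    move=> hk; rewrite -[X in _ <= X]card_ord.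
    rewrite cardE; have /(_ _) := @uniq_leq_size _ [seq val x | x <- enum [pred x : 'I_n.+1 | ((k == i) || (k == j)) ==> (x < B)]] (iota 0 B).
    rewrite size_map size_iota card_ord; apply.
      by rewrite map_inj_uniq ?enum_uniq //; apply: val_inj.
    move=> x /mapP [y]; rewrite mem_enum inE hk /= => hy ->.
    by rewrite mem_iota.
  rewrite mulnA; apply: leq_mul.
    by apply: leq_mul; apply: small; rewrite eqxx ?orbT.
  apply: (@leq_trans (\prod_(k < m | (k != i) && (k != j)) n.+1)).
    by apply: leq_prod => k _; rewrite -[X in _ <= X]card_ord max_card.
  rewrite prod_nat_const; apply: leq_pexp2l => //.
  have -> : m - 2 = #|~: [set i; j]|.
    by rewrite cardsCs setCK card_ord cards2 ij.
  apply/subset_leq_card/subsetP => k; rewrite !inE => /andP[/negPf-> /negPf->] //.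
have UF : #|U| <= \sum_(p | p.1 != p.2) #|Fij p|.
  rewrite /U; elim/big_rec2: _ => [|p x S _ h]; first by rewrite cards0.
  by apply: leq_trans (leq_card_setU _ _).1 _; rewrite leq_add2l.
apply: leq_trans UF _.
apply: (@leq_trans (\sum_(p : 'I_m * 'I_m) B * B * n.+1 ^ (m - 2))).
  by rewrite big_mkcond; apply: leq_sum => p _; case: ifP => // /cardF.
by rewrite sum_nat_const card_prod mulnA.
Qed.

End Counting.
Local Open Scope ring_scope.

(** * From the Kolchin function to the leading derivatives *)

Local Open Scope nat_scope.

(** Let g be the gcd of E, and a_i an element of E with the least i-th exponent.  A multiple t
    of g outside E is not divisible by any a_i, so for each i some coordinate j of t is bounded, and
    j differs from i since t_i is at least g_i.  Starting again from j gives a second bounded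
    coordinate, so that such t are few. *)
Lemma gcd_structure m (E : {cmonom 'I_m} -> Prop) : 2 <= m ->
  (forall t x, E x -> E (mmul t x)) -> (exists x, E x) ->
  exists gK : {cmonom 'I_m} * nat, (forall x, E x -> cdvd gK.1 x) /\
    forall n, count (fun t => cdvd gK.1 t && ~~ propb (E t)) (mons m n) <= gK.2 * n.+1 ^ (m - 2).
Proof.
move=> m2 Eup [x0 Ex0].
have hmin i : exists a, E a /\ forall x, E x -> a i <= x i.
  have ex : exists c, propb (exists2 a, E a & a i = c) by exists (x0 i); apply/propbP; exists x0.
  have [c /propbP [a Ea <-] cmin] := ex_minnP ex.
  by exists a; split=> // x Ex; apply: cmin; apply/propbP; exists x.
have [a ha] := fun_choice hmin.
pose g := cm_of (fun i => a i i).
pose B := (\sum_i \sum_j a i j).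
have aB i j : a i j <= B.
  by rewrite /B (bigD1 i) //= (bigD1 j) //= -addnA leq_addr.
exists (g, #|'I_m| * #|'I_m| * (B * B)); split=> /= [x Ex|n].
  by apply/propbP => i; rewrite cm_ofE; apply: (ha i).2.
apply: leq_trans (@count_two_small m B n); apply: sub_count => t /andP[/propbP gt /propbP nE].
apply/propbP; have small i : exists2 j, j != i & t j < B.
  have [j hj] : exists j, ~ a i j <= t j.
    apply: not_all_ex_not => h; apply: nE.
    have -> : t = mmul (divcm t (a i)) (a i).
      by apply: cm_ext => j; rewrite cmM divcmE subnK.
    by apply: Eup; case: (ha i).
  move/negP: hj; rewrite -ltnNge => hj; exists j.
    by apply: contraTneq hj => ->; rewrite -leqNgt; have := gt i; rewrite cm_ofE.
  exact: leq_trans hj (aB i j).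
have [j _ hj] := small (Ordinal (leq_trans (isT : 0 < 2) m2)).
by have [j' ne hj'] := small j; exists j', j.
Qed.

Lemma count_split (T : Type) (c P : pred T) (l : seq T) : (forall t, ~~ P t -> c t) ->
  count P l = count (predC c) l + count (fun t => c t && P t) l.
Proof.
move=> h; elim: l => //= t l ->; have := h t.
by case: (P t) => [|/(_ isT) ->]; case: (c t) => //= _; lia.
Qed.

(** In each indeterminate the set of leading monomials is compared with its gcd.  The asymptotic
    comparison shows that exactly D - 1 indeterminates are without leading derivatives, that the
    degrees of the gcds add up to s, that at most one of them is not 1, and that each
    nonempty set consists of all the multiples of its gcd.  If there are D indeterminates, a single one has
    leading derivatives, and they are the derivatives of one v0 of order s. *)
Lemma kolchin_structure m (J : choiceType) (sJ : seq J) (dep : deriv_of m J -> Prop) D s t0 :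
  2 <= m -> uniq sJ -> (forall j, j \in sJ) -> (forall t v, dep v -> dep (tmul t v)) ->
  (forall t, t0 <= t ->
     \sum_(j <- sJ) count (fun th => ~~ propb (dep (th, j))) (mons m t) + 'C(m + (t - s), m) =
     D * 'C(m + t, m)) ->
  count (fun j => propb (exists th, ~ dep (th, j))) sJ <= D /\
  (size sJ = D -> exists v0, mdeg v0.1 = s /\ forall v, dep v <-> exists t, v = tmul t v0).
Proof.
move=> m2 uJ allJ dep_up; case: m m2 dep dep_up => [//|[//|k]] m2 dep dep_up hcount.
pose ne j := propb (exists th, dep (th, j)).
have hg j : exists gK : {cmonom 'I_k.+2} * nat, ne j -> (forall x, dep (x, j) -> cdvd gK.1 x) /\
    forall n, count (fun t => cdvd gK.1 t && ~~ propb (dep (t, j))) (mons k.+2 n) <= gK.2 * n.+1 ^ k.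
  have [hj|hj] := boolP (ne j); last by exists (mone, 0).
  have [||gK hgK] := @gcd_structure k.+2 (fun x => dep (x, j)) m2; last first.
    by exists gK => _; move: hgK; rewrite subn2.
    exact: (elimT (propbP _) hj).
  by move=> t x h; apply: (dep_up t _ h).
have [gK hgK] := fun_choice hg.
pose l := filter ne sJ; pose e j := mdeg (gK j).1.
pose h j t := count (fun t => cdvd (gK j).1 t && ~~ propb (dep (t, j))) (mons k.+2 t).
pose K := \sum_(j <- sJ) (gK j).2.
have hK j t : j \in l -> h j t <= K * t.+1 ^ k.
  rewrite mem_filter => /andP[nj _]; apply: leq_trans ((hgK j nj).2 t) _.
  by rewrite leq_mul2r /K (big_rem j) //= leq_addr orbT.
pose t1 := t0 + \sum_(j <- sJ) e j.
have count_ne j t : ne j -> t1 <= t ->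
    count (fun th => ~~ propb (dep (th, j))) (mons k.+2 t) = nondiv k (e j) t + h j t.
  move=> nj ht; have le : e j <= t.
    by apply: leq_trans ht; rewrite /t1 (big_rem j) //=; lia.
  have h1 := binom_nondiv k le; have h2 := count_cdvd le; rewrite size_mons in h2.
  have h3 := count_predC (cdvd (gK j).1) (mons k.+2 t); rewrite size_mons in h3.
  have -> : count (fun th => ~~ propb (dep (th, j))) (mons k.+2 t) =
      count (predC (cdvd (gK j).1)) (mons k.+2 t) + h j t.
    apply: count_split => th; rewrite negbK => /propbP; exact: (hgK j nj).1.
  by apply/eqP; rewrite eqn_add2r -(eqn_add2l (count (cdvd (gK j).1) (mons k.+2 t))) h3 h2 h1.
have count_nne j t : ~~ ne j ->
    count (fun th => ~~ propb (dep (th, j))) (mons k.+2 t) = 'C(k.+2 + t, k.+2).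
  move=> nj; rewrite -size_mons -count_predT; apply: eq_count => th /=.
  by apply/negP => /propbP d; case/negP: nj; apply/propbP; exists th.
have eqn t : t1 <= t -> count (predC ne) sJ * 'C(k.+2 + t, k.+2) +
    \sum_(j <- l) (nondiv k (e j) t + h j t) + 'C(k.+2 + (t - s), k.+2) = D * 'C(k.+2 + t, k.+2).
  move=> ht; rewrite -hcount; last by rewrite /t1 in ht; lia.
  congr (_ + _); rewrite [RHS](bigID ne) /= addnC; congr (_ + _).
    by rewrite /l big_filter; apply: eq_bigr => j nj; rewrite count_ne.
  rewrite (eq_bigr (fun=> 'C(k.+2 + t, k.+2))); last by move=> j; apply: count_nne.
  by rewrite big_const_seq iter_addn_0 mulnC.
have aD := count_empty hK eqn; have tot := total_order hK eqn.
have nex := no_excess hK eqn; have onep := one_positive hK eqn.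
have cJ : count (predC ne) sJ + size l = size sJ.
  by rewrite /l size_filter addnC count_predC.
have full j th : j \in l -> cdvd (gK j).1 th -> dep (th, j).
  move=> jl hth; have nj : ne j by move: jl; rewrite mem_filter => /andP[].
  pose t := t1 + s + mdeg th.
  have h0 : h j t = 0 by apply: nex jl; rewrite /t; lia.
  apply: NNPP => nd; move/eqP: h0; rewrite -leqn0 leqNgt -has_count; move/negP; apply.
  apply/hasP; exists th; first by rewrite mem_mons /t; lia.
  by rewrite hth; apply/negP => /propbP.
split.
  apply: (@leq_trans (count (predC ne) sJ + count (fun j => 0 < e j) l)); last first.
    by rewrite -aD -[X in _ <= X]addn1 leq_add2l.
  rewrite /l count_filter -count_predUI.
  apply: leq_trans (leq_addr _ _); apply: sub_count => j /propbP [th nd] /=.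
  have [nj|//] := boolP (ne j); rewrite /= andbT lt0n; apply/eqP => e0; apply: nd.
  apply: full; first by rewrite mem_filter nj allJ.
  have -> : (gK j).1 = mone by apply: mdeg_eq0I.
  by apply/cdvdP; exists th; rewrite mul1m.
move=> sD; have sl : size l = 1.
  by apply/eqP; rewrite -(eqn_add2l (count (predC ne) sJ)) cJ sD -aD addn1.
have [j lj] : exists j, l = [:: j] by case: (l) sl => // j [|//] _; exists j.
have jl : j \in l by rewrite lj mem_head.
exists ((gK j).1, j); split; first by rewrite -tot lj big_seq1.
move=> [th j']; split=> [d|[t [-> ->]]]; last first.
  by apply: full => //; apply/cdvdP; exists t; rewrite mulmC.
have j'l : j' \in l by rewrite mem_filter allJ andbT; apply/propbP; exists th.
move: (j'l); rewrite lj inE => /eqP e'; rewrite e' in d *.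
have nj : ne j by move: jl; rewrite mem_filter => /andP[].
by have /cdvdP [t ->] := (hgK j nj).1 th d; exists t; rewrite /tmul /= mulmC.
Qed.
Local Open Scope ring_scope.

(** * Differential evaluation and elimination of independent variables *)

Section DMorphism.
Variables (m : nat) (R S : diffRingType m) (g : {rmorphism R -> S}).
Hypothesis gD : is_dmorphism g.

Lemma dmorph_theta t x : g (theta t x) = theta t (g x).
Proof.
by elim/cmonom_ind: t => [|k t IH]; rewrite ?theta1 // !theta_mulU gD IH.
Qed.
End DMorphism.

Section ThetaLinear.
Variables (m : nat) (R : diffRingType m).

Lemma theta_is_zmod t : zmod_morphism (@theta m R t).
Proof.
move=> x y; elim/cmonom_ind: t => [|k t IH]; first by rewrite !theta1.
by rewrite !theta_mulU IH raddfB.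
Qed.
HB.instance Definition _ t := GRing.isZmodMorphism.Build R R (theta t) (theta_is_zmod t).

End ThetaLinear.

Section DiffEval.
Variables (m : nat) (J : choiceType) (F : diffFieldType m) (A : diffRingType m).
Local Notation W := (deriv_of m J).
Variables (C : {rmorphism F -> A}) (X : W -> A).
Hypothesis H : polyring C X.
Hypothesis derC : forall k c, dder k (C c) = C (dder k c).
Hypothesis derX : forall k v, dder k (X v) = X (dshift k v).

Lemma theta_X t v : theta t (X v) = X (tmul t v).
Proof.
elim/cmonom_ind: t => [|k t IH]; first by rewrite theta1 tmul1.
by rewrite theta_mulU IH derX dshiftE -tmulA.
Qed.

Lemma theta_X1 v : theta v.1 (X (mone, v.2)) = X v.
Proof. by rewrite theta_X /tmul /= mulm1; case: v. Qed.

Section Target.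
Variables (S : diffRingType m) (f : {rmorphism F -> S}) (a : J -> S).

Definition dev : {rmorphism A -> S} := ev H f (fun v => theta v.1 (a v.2)).

Lemma devC c : dev (C c) = f c. Proof. exact: evC. Qed.
Lemma devX v : dev (X v) = theta v.1 (a v.2). Proof. exact: evX. Qed.

Hypothesis fD : is_dmorphism f.

Lemma dev_dmorph : is_dmorphism dev.
Proof.
move=> k p; elim: (pr_gen H p) => [c|v _|x y _ hx _ hy|x y _ hx _ hy].
- by rewrite derC !devC fD.
- by rewrite derX !devX /= theta_mulU.
- by rewrite dderD !rmorphD dderD hx hy.
by rewrite dderM rmorphD !rmorphM dderM hx hy.
Qed.
End Target.

Lemma dmorph_ext (S : diffRingType m) (g h : {rmorphism A -> S}) :
  is_dmorphism g -> is_dmorphism h -> (forall c, g (C c) = h (C c)) ->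
  (forall j, g (X (mone, j)) = h (X (mone, j))) -> forall p, g p = h p.
Proof.
move=> gD hD e1 e2 p; apply: (hom_eq H) => // v.
by rewrite -theta_X1 (dmorph_theta gD) (dmorph_theta hD) e2.
Qed.
End DiffEval.

Section Elimination.
Variables (W W' : choiceType) (K E : fieldType) (A B : comNzRingType).
Variables (C : {rmorphism K -> A}) (X : W -> A) (CB : {rmorphism E -> B}) (XB : W' -> B).
Hypothesis H : polyring C X.
Hypothesis HB : polyring CB XB.
Variables (kap : {rmorphism A -> B}) (T0 Us : W -> Prop).
Hypothesis kapC : forall c, exists e, kap (C c) = CB e.
Hypothesis kap0 : forall v, T0 v -> exists e, kap (X v) = CB e.
Hypothesis kapU : forall w, Us w -> exists w', kap (X w) = XB w'.
Hypothesis kap_inj : forall v w, Us v -> Us w -> kap (X v) = kap (X w) -> v = w.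
Variable Q : A -> Prop.
Hypothesis Q0 : Q 0.
Hypothesis QD : forall x y, Q x -> Q y -> Q (x + y).
Hypothesis QM : forall a x, Q x -> Q (a * x).
Hypothesis base : forall q, vin C X T0 q -> kap q = 0 -> Q q.

(** The variables of Us are removed one at a time: kap sends w to a variable that occurs in
    no other image, so the coefficients of q in powers of w lie in the kernel as well. *)
Lemma eliminate_independent q : vin C X (fun v => T0 v \/ Us v) q -> kap q = 0 -> Q q.
Proof.
move=> vq kq; have [s [hs vs]] := vin_fin vq.
have {vs}: vin C X (fun v => T0 v \/ (v \in s /\ Us v)) q.
  by apply: vinW vs _ => v vs; case: (hs v vs) => h; [left|right].
clear vq hs; elim: s q kq => [|w s IH] q kq vq.
  by apply: base => //; apply: vinW vq _ => v [|[]].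
have [Uw|nUw] := classic (Us w); last first.
  apply: IH => //; apply: vinW vq _ => v [h|[]]; first by left.
  by rewrite inE => /orP[/eqP->|h1 h2]; [|right].
have vc i : vin C X (fun v => (T0 v \/ (v \in s /\ Us v)) /\ v <> w) (uni H w q)`_i.
  apply: vinW (uni_coef_vin H w i vq) _ => v [[h|[hin hU]] h3]; first by split=> //; left.
  by move: hin; rewrite inE => /orP[/eqP//|h1]; split=> //; right.
have [w' ew'] := kapU Uw.
have vk p : vin C X (fun v => (T0 v \/ (v \in s /\ Us v)) /\ v <> w) p ->
    vin CB XB (fun v => v <> w') (kap p).
  elim=> [c|v [[/kap0 [e ->] _|[_ Uv] nvw]]|x y _ hx _ hy|x y _ hx _ hy].
  - by have [e ->] := kapC c; apply: vinC.
  - exact: vinC.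
  - have [v' ev'] := kapU Uv; rewrite ev'; apply: vinX => e; apply: nvw.
    by apply: kap_inj => //; rewrite ev' ew' e.
  - by rewrite rmorphD; apply: vinD.
  by rewrite rmorphM; apply: vinM.
have eq : uni HB w' (kap q) = map_poly kap (uni H w q).
  rewrite -{1}(uniK H w q) -horner_map ew'; apply: uni_horner => i.
  by rewrite coef_map; apply: vk.
have ck i : kap (uni H w q)`_i = 0 by rewrite -coef_map -eq kq rmorph0 coef0.
rewrite -(uniK H w q) horner_coef; apply: big_ind => // i _; rewrite mulrC; apply: QM.
by apply: IH (ck i) _; apply: vinW (vc i) _ => v [].
Qed.
End Elimination.

(** * The differential ideal of the Chow form *)

Lemma alg_cl_base_eq (F L : fieldType) (f g : {rmorphism F -> L}) (A : L -> Prop) x :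
  f =1 g -> alg_cl f A x -> alg_cl g A x.
Proof. by move=> e h S hS hb hA; apply: h => // c; rewrite e. Qed.

Lemma ranking_pull m (J J' : choiceType) (f : J -> J') (lt : rel (deriv_of m J')) : injective f ->
  is_ranking lt -> is_ranking (fun v w : deriv_of m J => lt (v.1, f v.2) (w.1, f w.2)).
Proof.
move=> fi rk; split.
- by move=> v; rewrite (rk_irr rk).
- move=> v u w; exact: (rk_trans rk).
- move=> u v ne; apply: (rk_total rk); apply: contra ne => /eqP [e1 /fi e2].
  by case: u v e1 e2 => [a b] [a' b'] /= -> ->.
- move=> k u; exact: (rk_shift rk k (u.1, f u.2)).
by move=> k u v h; apply: (rk_mono rk k h).
Qed.

Section FreeList.
Variables (m : nat) (J : choiceType).
Local Notation W := (deriv_of m J).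

Definition derivs_upto (sJ : seq J) t (P : pred W) : seq W :=
  [seq v <- [seq ((th, j) : W) | j <- sJ, th <- mons m t] | P v].

Lemma size_derivs_upto sJ t P :
  size (derivs_upto sJ t P) = (\sum_(j <- sJ) count (fun th => P (th, j)) (mons m t))%N.
Proof.
rewrite /derivs_upto; elim: sJ => [|j sJ IH]; first by rewrite big_nil.
by rewrite big_cons allpairs_cons filter_cat size_cat IH filter_map size_map size_filter.
Qed.

Lemma derivs_upto_uniq sJ t P : uniq sJ -> uniq (derivs_upto sJ t P).
Proof.
move=> u; apply/filter_uniq/allpairs_uniq => //; first exact: mons_uniq.
by move=> [a b] [a' b'] _ _ [-> ->].
Qed.

Lemma mem_derivs_upto sJ t P v :
  (v \in derivs_upto sJ t P) = [&& P v, v.2 \in sJ & (mdeg v.1 <= t)%N].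
Proof.
rewrite mem_filter; congr (_ && _); rewrite -mem_mons.
apply/allpairsP/andP => [[[j th] /= [h1 h2 ->]] //|[h1 h2]].
by exists (v.2, v.1); split=> //; case: v h1 h2.
Qed.

Variables (F : diffFieldType m) (A : diffRingType m).
Variables (C : {rmorphism F -> A}) (X : W -> A).
Hypothesis H : polyring C X.
Variables (lt : rel W) (L : fieldType) (phi : {rmorphism A -> L}) (sJ : seq J).
Hypothesis rk : is_ranking lt.
Hypothesis all_sJ : forall j, j \in sJ.

Definition nondep : pred W := fun v => ~~ propb (dep H (orderly lt) phi v).

Lemma free_list_span t v : (mdeg v.1 <= t)%N ->
  alg_cl (phi \o C) (fun z => z \in [seq phi (X w) | w <- derivs_upto sJ t nondep]) (phi (X v)).
Proof.
move=> ht; have := nondep_span (H := H) (orderly_ranking rk) (ex_intro _ sJ all_sJ) (phi := phi) (v := v).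
apply: alg_cl_mono => _ [w [nd uw] ->]; apply: map_f; rewrite mem_derivs_upto all_sJ /=.
apply/andP; split; first by apply/negP => /propbP.
by apply: leq_trans ht; case: uw => [->//|]; apply: orderly_mdeg.
Qed.

Lemma free_list_indep t : indep C X phi (fun v => v \in derivs_upto sJ t nondep).
Proof.
move=> p vp; apply: (indep_free (H := H) (orderly_ranking rk) (ex_intro _ sJ all_sJ)).
apply: vinW vp _ => v; rewrite mem_derivs_upto => /andP[/negP h _] hd.
by apply: h; apply/propbP.
Qed.
End FreeList.

(** The rings of the problem, in abstract form: AV = F{Y}, AU = F{u}, AY = F{Y, u}, and B, the
    differential polynomial ring over E in the u_ij with j positive.  The point xi is
    generic for V. *)
Section ChowKernel.
Variables (m n d : nat) (F E : diffFieldType m) (iota : {rmorphism F -> E}).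
Hypothesis iotaD : is_dmorphism iota.
Local Notation JU := (uvar n d).
Definition JY : choiceType := ('I_n + uvar n d)%type.
Definition JB : choiceType := ('I_d.+1 * 'I_n)%type.
Variables AV AU AY B : diffRingType m.
Variables (CV : {rmorphism F -> AV}) (XV : deriv_of m 'I_n -> AV).
Variables (CU : {rmorphism F -> AU}) (XU : deriv_of m JU -> AU).
Variables (CY : {rmorphism F -> AY}) (XY : deriv_of m JY -> AY).
Variables (CB : {rmorphism E -> B}) (XB : deriv_of m JB -> B).
Hypothesis HV : polyring CV XV.
Hypothesis HU : polyring CU XU.
Hypothesis HY : polyring CY XY.
Hypothesis HB : polyring CB XB.
Hypothesis dCV : forall k c, dder k (CV c) = CV (dder k c).
Hypothesis dXV : forall k v, dder k (XV v) = XV (dshift k v).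
Hypothesis dCU : forall k c, dder k (CU c) = CU (dder k c).
Hypothesis dXU : forall k v, dder k (XU v) = XU (dshift k v).
Hypothesis dCY : forall k c, dder k (CY c) = CY (dder k c).
Hypothesis dXY : forall k v, dder k (XY v) = XY (dshift k v).
Hypothesis dCB : forall k c, dder k (CB c) = CB (dder k c).
Hypothesis dXB : forall k v, dder k (XB v) = XB (dshift k v).
Variable xi : 'I_n -> E.

(** The value of u_i0 for which the i-th hyperplane passes through xi. *)
Definition zeta (i : 'I_d.+1) : B := - \sum_j XB (mone, (i, j)) * CB (xi j).
Definition yU (u : JU) : B := oapp (fun j => XB (mone, (u.1, j))) (zeta u.1) (unlift ord0 u.2).
Definition yY (x : JY) : B := match x with inl j => CB (xi j) | inr u => yU u end.

Definition phiV : {rmorphism AV -> E} := dev HV iota xi.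
Definition psi : {rmorphism AU -> B} := dev HU (CB \o iota) yU.
Definition kap : {rmorphism AY -> B} := dev HY (CB \o iota) yY.
Definition renL : {rmorphism AV -> AY} := dev HV CY (fun j => XY (mone, inl j)).
Definition renR : {rmorphism AU -> AY} := dev HU CY (fun u => XY (mone, inr u)).
Definition hypY i : AY :=
  XY (mone, inr (i, ord0)) + \sum_(j < n) XY (mone, inr (i, lift ord0 j)) * XY (mone, inl j).

Definition chowY : AY -> Prop :=
  dideal_gen (fun q => (exists2 p, phiV p = 0 & q = renL p) \/ exists i, q = hypY i).

Lemma CBiotaD : is_dmorphism (CB \o iota).
Proof. by move=> k c; rewrite /= iotaD dCB. Qed.

Lemma phiV_D : is_dmorphism phiV. Proof. exact: dev_dmorph. Qed.
Lemma psi_D : is_dmorphism psi. Proof. apply: dev_dmorph => //; exact: CBiotaD. Qed.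
Lemma kap_D : is_dmorphism kap. Proof. apply: dev_dmorph => //; exact: CBiotaD. Qed.
Lemma renL_D : is_dmorphism renL. Proof. by apply: dev_dmorph => // k c; rewrite dCY. Qed.
Lemma renR_D : is_dmorphism renR. Proof. by apply: dev_dmorph => // k c; rewrite dCY. Qed.

Lemma kapX1 x : kap (XY (mone, x)) = yY x.
Proof. by rewrite /kap devX /= theta1. Qed.

Lemma kap_renR p : kap (renR p) = psi p.
Proof.
apply: (dmorph_ext HU dXU (g := kap \o renR) (h := psi)).
- by move=> k x; rewrite /= renR_D kap_D.
- exact: psi_D.
- by move=> c; rewrite /= /renR devC /kap devC /psi devC.
by move=> u; rewrite /= /renR devX /= theta1 kapX1 /psi devX /= theta1.
Qed.

Lemma kap_renL p : kap (renL p) = CB (phiV p).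
Proof.
apply: (dmorph_ext HV dXV (g := kap \o renL) (h := CB \o phiV)).
- by move=> k x; rewrite /= renL_D kap_D.
- by move=> k x; rewrite /= phiV_D dCB.
- by move=> c; rewrite /= /renL devC /kap devC /phiV devC.
by move=> u; rewrite /= /renL devX /= theta1 kapX1 /phiV devX /= theta1.
Qed.

Lemma yU0 i : yU (i, ord0) = zeta i.
Proof. by rewrite /yU unlift_none. Qed.

Lemma yUlift i j : yU (i, lift ord0 j) = XB (mone, (i, j)).
Proof. by rewrite /yU liftK. Qed.

Lemma kap_hyp i : kap (hypY i) = 0.
Proof.
rewrite /hypY rmorphD raddf_sum kapX1 /= yU0 /zeta addrC; apply/eqP.
rewrite subr_eq0; apply/eqP; apply: eq_bigr => j _.
by rewrite rmorphM !kapX1 /= yUlift.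
Qed.

Lemma chowY_ker q : chowY q -> kap q = 0.
Proof.
move=> hq; apply: (hq (fun q => kap q = 0)).
  split; first exact: rmorph0.
  - by move=> x y hx hy; rewrite rmorphD hx hy addr0.
  - by move=> a x hx; rewrite rmorphM hx mulr0.
  by move=> k x hx; rewrite kap_D hx raddf0.
move=> _ [[p p0 ->]|[i ->]]; last exact: kap_hyp.
by rewrite kap_renL p0 rmorph0.
Qed.

(** Rewrites u_i0 through the equation of the i-th hyperplane, modulo the ideal. *)
Definition rhoX (v : deriv_of m JY) : AY :=
  match v.2 with
  | inl _ => XY v
  | inr u => if unlift ord0 u.2 is Some _ then XY v else
      theta v.1 (- \sum_(j < n) XY (mone, inr (u.1, lift ord0 j)) * XY (mone, inl j))
  end.
Definition rho : {rmorphism AY -> AY} := ev HY CY rhoX.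

Lemma chowY_theta t q : chowY q -> chowY (theta t q).
Proof.
move=> hq; elim/cmonom_ind: t => [|k t IH]; first by rewrite theta1.
by rewrite theta_mulU; apply: dgenX.
Qed.

Lemma rho_cong q : chowY (q - rho q).
Proof.
elim: (pr_gen HY q) => [c|[t x] _|x y _ hx _ hy|x y _ hx _ hy].
- by rewrite /rho evC subrr; apply: dgen0.
- rewrite /rho evX /rhoX /=; case: x => [j|[i k]] /=; first by rewrite subrr; apply: dgen0.
  case: unliftP => [j ->|->]; first by rewrite subrr; apply: dgen0.
  rewrite -(theta_X1 dXY (t, inr (i, ord0))) /= -raddfB opprK.
  by apply: chowY_theta; apply: dgen_mem; right; exists i.
- have -> : x + y - rho (x + y) = (x - rho x) + (y - rho y) by rewrite rmorphD; ring.
  exact: dgenD.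
have -> : x * y - rho (x * y) = y * (x - rho x) + rho x * (y - rho y) by rewrite rmorphM; ring.
by apply: dgenD; apply: dgenM.
Qed.

Definition isY (v : deriv_of m JY) := exists j, v.2 = inl j.
Definition isU (v : deriv_of m JY) := exists i j, v.2 = inr (i, lift ord0 j).

Lemma rho_vin q : vin CY XY (fun v => isY v \/ isU v) (rho q).
Proof.
elim: (pr_gen HY q) => [c|[t x] _|x y _ hx _ hy|x y _ hx _ hy].
- by rewrite /rho evC; apply: vinC.
- rewrite /rho evX /rhoX /=; case: x => [j|[i k]] /=; first by apply: vinX; left; exists j.
  case: unliftP => [j ->|_]; first by apply: vinX; right; exists i, j.
  elim/cmonom_ind: t => [|k' t IH].
    rewrite theta1; apply: vinN; apply: vin_sum => j _; apply: vinM; apply: vinX.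
      by right; exists i, j.
    by left; exists j.
  rewrite theta_mulU; apply: (dder_vin dCY dXY _ IH) => v [[j e]|[i' [j e]]].
    by split; left; exists j.
  by split; right; exists i', j.
- by rewrite rmorphD; apply: vinD.
by rewrite rmorphM; apply: vinM.
Qed.

Lemma vin_renL q : vin CY XY isY q -> exists p, renL p = q.
Proof.
elim=> [c|[t x] [j /= ->]|x y _ [a <-] _ [b <-]|x y _ [a <-] _ [b <-]].
- by exists (CV c); rewrite /renL devC.
- by exists (XV (t, j)); rewrite /renL devX /= -(theta_X1 dXY (t, inl j)).
- by exists (a + b); rewrite rmorphD.
by exists (a * b); rewrite rmorphM.
Qed.

Lemma CB_inj : injective CB. Proof. exact: C_inj HB. Qed.

Lemma XB_inj v w : XB v = XB w -> v = w.
Proof.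
move=> e; apply/eqP; apply: contraT => ne.
have := uniX HB v; rewrite e uniXn; last by rewrite eq_sym.
move/(congr1 (fun p : {poly B} => p`_1)); rewrite coefC coefX /= => /eqP.
by rewrite eq_sym oner_eq0.
Qed.

Lemma kapX v : kap (XY v) = theta v.1 (yY v.2).
Proof. exact: devX. Qed.

(** After the rewriting rho, q is a polynomial in the y_j and the u_ij with j positive; the latter are sent
    to independent variables, so its coefficients vanish at xi. *)
Lemma chow_kernel q : chowY q <-> kap q = 0.
Proof.
split; first exact: chowY_ker.
move=> kq; rewrite -(subrK (rho q) q); apply: dgenD (rho_cong q) _.
have kr : kap (rho q) = 0.
  by have := chowY_ker (rho_cong q); rewrite rmorphB kq sub0r => /eqP; rewrite oppr_eq0 => /eqP.
have kU i j t : kap (XY (t, inr (i, lift ord0 j))) = XB (t, (i, j)).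
  by rewrite kapX /= yUlift -(theta_X1 dXB (t, (i, j))).
apply: (eliminate_independent HY HB (kap := kap) (T0 := isY) (Us := isU)) kr.
- by move=> c; exists (iota c); rewrite /kap devC.
- move=> [t x] [j /= ->]; exists (theta t (xi j)); rewrite kapX /=.
  by rewrite (dmorph_theta (g := CB)) // => k c; rewrite dCB.
- by move=> [t x] [i [j /= ->]]; exists (t, (i, j)); apply: kU.
- move=> [t x] [t' x'] [i [j /= ->]] [i' [j' /= ->]]; rewrite !kU => /XB_inj [-> -> ->] //.
- exact: dgen0.
- by move=> x y; apply: dgenD.
- by move=> a x; apply: dgenM.
- move=> p /vin_renL [p' <-]; rewrite kap_renL -(rmorph0 CB) => /CB_inj p0.
  by apply: dgen_mem; left; exists p'.
exact: rho_vin.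
Qed.

Lemma chow_renR p : chowY (renR p) <-> psi p = 0.
Proof. by rewrite chow_kernel kap_renR. Qed.

(** The indeterminates in P0 are given distinct rows.  The derivatives of y_j in Bt, independent
    at xi, are to stay independent when xi_j is replaced with zeta in row r j, even
    together with all derivatives of the u_ij, j positive.  If u_(r j, j) is specialised to -1 and the rest
    of its row to 0, then zeta_(r j) becomes xi_j; but this
    specialisation destroys the independence of the u_ij.  So the specialised values are
    perturbed: u_ij is written as a sign plus a parameter times a new indeterminate, and
    the term of lowest degree in the parameter is examined. *)
Section LowerBound.
Variables (P0 : 'I_n -> Prop) (r : 'I_n -> 'I_d.+1) (Bt : deriv_of m 'I_n -> Prop).
Hypothesis r_inj : forall i j, P0 i -> P0 j -> r i = r j -> i = j.
Hypothesis BtP0 : forall v, Bt v -> P0 v.2.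
Hypothesis Bt_indep : indep CV XV phiV Bt.

(** The specialised value of a derivative of u_ij. *)
Definition sgnF (v : deriv_of m JB) : F :=
  if (v.1 == mone) && propb (P0 v.2.2 /\ r v.2.2 = v.2.1) then -1 else 0.
Definition sgn v : E := iota (sgnF v).

Lemma sgn_der k v : dder k (sgn v) = 0.
Proof.
rewrite /sgn -iotaD /sgnF; case: ifP => _; last by rewrite raddf0 rmorph0.
by rewrite raddfN /= dder1 oppr0 rmorph0.
Qed.

(** The perturbation; the polynomial variable is the parameter. *)
Definition tau : {rmorphism B -> {poly B}} :=
  ev HB (@polyC B \o CB) (fun v => (CB (sgn v))%:P + (XB v)%:P * 'X).
Definition sigma : {rmorphism B -> B} := ev HB CB (fun v => CB (sgn v)).

Lemma tau0 x : (tau x).[0] = sigma x.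
Proof.
apply: (hom_eq HB (f := horner_eval 0 \o tau) (g := sigma)) => [c|v].
  by rewrite /= /horner_eval /tau /sigma !evC hornerC.
by rewrite /= /horner_eval /tau /sigma !evX hornerD hornerC hornerMX mulr0 addr0.
Qed.

Lemma sigma_D : is_dmorphism sigma.
Proof.
move=> k p; elim: (pr_gen HB p) => [c|v _|x y _ hx _ hy|x y _ hx _ hy].
- by rewrite dCB /sigma !evC dCB.
- rewrite dXB /sigma !evX dCB sgn_der rmorph0 /sgn /sgnF /=.
  by rewrite cmM_eq1 cm1_eq1 /= !rmorph0.
- by rewrite dderD !rmorphD dderD hx hy.
by rewrite dderM rmorphD !rmorphM dderM hx hy.
Qed.

Lemma sigma_zeta j : P0 j -> sigma (zeta (r j)) = CB (xi j).
Proof.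
move=> Pj; rewrite /zeta rmorphN raddf_sum (bigD1 j) //= big1 => [|i ij].
  rewrite rmorphM /sigma evX evC /sgn /sgnF /= eqxx /=.
  by case: propbP => [_|[]]; [rewrite !rmorphN1 mulN1r addr0 opprK | split].
rewrite rmorphM /sigma evX evC /sgn /sgnF /= eqxx /=.
case: propbP => [[Pi e]|_]; last by rewrite !rmorph0 mul0r.
by move/eqP: ij; case; apply: r_inj.
Qed.

(** The same perturbation on the side of F{u}: here the parameter multiplies the u_ij
    themselves, with u_i0 unchanged. *)
Definition gamX (v : deriv_of m JU) : {poly AU} :=
  if unlift ord0 v.2.2 is Some j then (XU v)%:P * 'X + (CU (sgnF (v.1, (v.2.1, j))))%:P
  else (XU v)%:P.
Definition gam : {rmorphism AU -> {poly AU}} := ev HU (@polyC AU \o CU) gamX.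

(** Inverts gam at the value 1 of the parameter. *)
Definition backX (v : deriv_of m JU) : AU :=
  if unlift ord0 v.2.2 is Some j then XU v - CU (sgnF (v.1, (v.2.1, j))) else XU v.
Definition back : {rmorphism AU -> AU} := ev HU CU backX.

Lemma gamK q : back (gam q).[1] = q.
Proof.
apply: (hom_eq HU (f := back \o (horner_eval 1 \o gam)) (g := idfun)) => [c|v].
  by rewrite /= /horner_eval /gam evC hornerC /back evC.
rewrite /= /horner_eval /gam evX /gamX /back; case e : (unlift _ _) => [j|].
  by rewrite hornerD hornerMX !hornerC mulr1 rmorphD /= evX evC /backX e subrK.
by rewrite hornerC evX /backX e.
Qed.

(** The coefficients of gam q, in powers of the parameter, are mapped so that the parameter in gam
    and the one in tau can be identified (psi_gam). *)
Definition Psi2X (v : deriv_of m JU) : {poly B} :=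
  if unlift ord0 v.2.2 is Some j then (XB (v.1, (v.2.1, j)))%:P
  else tau (theta v.1 (zeta v.2.1)).
Definition Psi2 : {rmorphism AU -> {poly B}} := ev HU (@polyC B \o (CB \o iota)) Psi2X.

Lemma psiX v : psi (XU v) = theta v.1 (yU v.2).
Proof. exact: devX. Qed.

Lemma Psi2C c : Psi2 (CU c) = (CB (iota c))%:P.
Proof. by rewrite /Psi2 evC. Qed.

Lemma psi_gam q : tau (psi q) = (map_poly Psi2 (gam q)).['X].
Proof.
apply: (hom_eq HU (f := tau \o psi) (g := horner_eval 'X \o (map_poly Psi2 \o gam))) => [c|v].
  by rewrite /= /horner_eval /psi devC /tau evC /gam evC map_polyC hornerC /= /Psi2 evC.
rewrite /= /horner_eval psiX /gam evX /gamX /yU; case e : (unlift _ _) => [j|] /=.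
  rewrite (theta_X1 dXB (v.1, (v.2.1, j))) /tau evX rmorphD rmorphM /= !map_polyC map_polyX /=.
  rewrite hornerD hornerMX !hornerC.
  have -> : Psi2 (XU v) = (XB (v.1, (v.2.1, j)))%:P by rewrite /Psi2 evX /Psi2X e.
  by rewrite Psi2C addrC.
by rewrite map_polyC hornerC /= /Psi2 evX /Psi2X e.
Qed.

Definition isUu (v : deriv_of m JU) := exists i j, v.2 = (i, lift ord0 j).
Definition isZ (v : deriv_of m JU) := exists j, v.2 = (r j, ord0) /\ Bt (v.1, j).

Lemma gam_vin q : vin CU XU (fun v => isZ v \/ isUu v) q ->
  forall k, vin CU XU (fun v => isZ v \/ isUu v) (gam q)`_k.
Proof.
elim=> [c|v Tv|x y _ hx _ hy|x y _ hx _ hy] k.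
- by rewrite /gam evC coefC; case: eqP => _; [apply: vinC|apply: vin0].
- rewrite /gam evX /gamX; case: (unlift _ _) => [j|].
    rewrite coefD coefMX !coefC; apply: vinD; last by case: ifP => _; [apply: vinC|apply: vin0].
    case: ifP => _; first exact: vin0.
    by case: ifP => _; [apply: vinX|apply: vin0].
  by rewrite coefC; case: ifP => _; [apply: vinX|apply: vin0].
- by rewrite rmorphD coefD; apply: vinD.
by rewrite rmorphM coefM; apply: vin_sum => i _; apply: vinM.
Qed.

(** The parameter is set to 0, so that zeta_(r j) becomes xi_j. *)
Definition Phi : {rmorphism AU -> B} := horner_eval 0 \o Psi2.

Lemma PhiU t i j : Phi (XU (t, (i, lift ord0 j))) = XB (t, (i, j)).
Proof. by rewrite /= /horner_eval /Psi2 evX /Psi2X liftK hornerC. Qed.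

Lemma PhiZ t j : P0 j -> Phi (XU (t, (r j, ord0))) = CB (theta t (xi j)).
Proof.
move=> Pj; rewrite /= /horner_eval /Psi2 evX /Psi2X unlift_none tau0.
by rewrite (dmorph_theta sigma_D) sigma_zeta // (dmorph_theta (g := CB)).
Qed.

Lemma PhiC c : Phi (CU c) = CB (iota c).
Proof. by rewrite /= /horner_eval Psi2C hornerC. Qed.

(** The u_ij are sent to independent variables and the u_(r j, 0) to xi_j. *)
Lemma Phi_inj q : vin CU XU (fun v => isZ v \/ isUu v) q -> Phi q = 0 -> q = 0.
Proof.
apply: (eliminate_independent HU HB (kap := Phi) (T0 := isZ) (Us := isUu) _ _ _ _ (Q := fun q => q = 0)) => //.
- by move=> c; exists (iota c); apply: PhiC.
- move=> [t u] [j [/= -> hb]]; exists (theta t (xi j)); apply: PhiZ; exact: BtP0 hb.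
- by move=> [t u] [i [j /= ->]]; exists (t, (i, j)); apply: PhiU.
- move=> [t u] [t' u'] [i [j e]] [i' [j' e']]; simpl in e, e'.
  by rewrite e e' !PhiU => /XB_inj [-> -> ->].
- by move=> x y -> ->; rewrite addr0.
- by move=> a x ->; rewrite mulr0.
move=> p vp p0.
pose toU : {rmorphism AV -> AU} := ev HV CU (fun v => XU (v.1, (r v.2, ord0))).
have [p' vp' e] : exists2 p', vin CV XV Bt p' & toU p' = p.
  elim: vp => [c|[t u] [j [/= -> hb]]|x y _ [a va <-] _ [b vb <-]|x y _ [a va <-] _ [b vb <-]].
  - by exists (CV c); [apply: vinC | rewrite /toU evC].
  - by exists (XV (t, j)); [apply: vinX | rewrite /toU evX].
  - by exists (a + b); [apply: vinD | rewrite rmorphD].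
  by exists (a * b); [apply: vinM | rewrite rmorphM].
have e' : Phi (toU p') = CB (phiV p').
  apply: (vin_hom_eq (f := Phi \o toU) (g := CB \o phiV) vp') => [c|[t j] hb].
    have h : toU (CV c) = CU c by exact: evC.
    transitivity (Phi (toU (CV c))); first by [].
    by rewrite h PhiC -(devC HV iota xi c).
  have h : toU (XV (t, j)) = XU (t, (r j, ord0)) by exact: evX.
  transitivity (Phi (toU (XV (t, j)))); first by [].
  by rewrite h (PhiZ t (BtP0 hb)) -(devX HV iota xi (t, j)).
rewrite -e (Bt_indep vp') ?rmorph0 //.
by apply: CB_inj; rewrite rmorph0 -e' e.
Qed.

(** Were some coefficient of gam q in the parameter nonzero, the lowest one would be the lowest coefficient
    of tau (psi q) = 0 up to the injective map Phi. *)
Lemma lower_indep q : vin CU XU (fun v => isZ v \/ isUu v) q -> psi q = 0 -> q = 0.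
Proof.
move=> vq q0; have := psi_gam q; rewrite q0 rmorph0 => /esym e.
have g0 k : (gam q)`_k = 0.
  have [n'] := ubnP k; elim: n' k => // n' IH k le_k.
  apply: Phi_inj; first exact: gam_vin.
  rewrite /= /horner_eval horner_coef0.
  have := congr1 (fun p : {poly B} => p`_k) e; rewrite coef0.
  rewrite (@horner_coef_wide _ (maxn (size (gam q)) k.+1)); last first.
    by apply: leq_trans (size_poly _ _) _; rewrite leq_maxl.
  rewrite coef_sum (bigD1 (Ordinal (leq_maxr (size (gam q)) k.+1))) //= big1 ?addr0.
    by rewrite coef_map coefMXn ltnn subnn.
  move=> i ik; rewrite coef_map coefMXn; case: ltnP => // le_ik.
  have z l : (Psi2 0)`_l = 0 by rewrite (rmorph0 Psi2) coef0.
  rewrite (_ : (gam q)`_i = 0); [exact: z | apply: IH]; rewrite ltnS in le_k; apply: leq_trans le_k.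
  by rewrite ltn_neqAle le_ik andbT; apply: contra ik => /eqP h; apply/eqP/val_inj.
rewrite -(gamK q); have -> : gam q = 0 by apply/polyP => k; rewrite g0 coef0.
by rewrite horner0 rmorph0.
Qed.

End LowerBound.

(** Transcendence degrees are computed in a field L that contains B. *)
Section Count.
Variables (L : fieldType) (hL : {rmorphism B -> L}).
Hypothesis hL_inj : injective hL.
Hypothesis char0 : [pchar F] =i pred0.
Variable lt : rel (deriv_of m JU).
Hypothesis rk : is_ranking lt.
Hypothesis m2 : (2 <= m)%N.

Definition phiL : {rmorphism AV -> L} := hL \o (CB \o phiV).
Definition psiL : {rmorphism AU -> L} := hL \o psi.

Lemma phiL0 p : phiL p = 0 <-> phiV p = 0.
Proof.
split=> [h|h]; last by rewrite /= h !rmorph0.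
by apply: CB_inj; apply: hL_inj; rewrite rmorph0 [RHS]rmorph0.
Qed.

Lemma psiL0 p : psiL p = 0 <-> psi p = 0.
Proof.
split=> [h|h]; last by rewrite /= h !rmorph0.
by apply: hL_inj; rewrite rmorph0.
Qed.

Lemma phiL_der k p : phiL p = 0 -> phiL (dder k p) = 0.
Proof. by rewrite !phiL0 phiV_D => ->; rewrite raddf0. Qed.

Lemma psiL_der k p : psiL p = 0 -> psiL (dder k p) = 0.
Proof. by rewrite !psiL0 psi_D => ->; rewrite raddf0. Qed.

Definition rowV (j : 'I_n) : JU := (ord0, lift ord0 j).
Lemma rowV_inj : injective rowV. Proof. by move=> i j /(congr1 snd); apply: lift_inj. Qed.
(** Any ranking of the derivatives of the y_j serves to select leaders in F{Y}; this one is
    read off the first row of indeterminates. *)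
Definition ltV : rel (deriv_of m 'I_n) := fun v w => lt (v.1, rowV v.2) (w.1, rowV w.2).
Lemma rkV : is_ranking ltV. Proof. exact: ranking_pull rowV_inj rk. Qed.

Local Notation depV := (dep HV (orderly ltV) phiL).
Local Notation depU := (dep HU (orderly lt) psiL).
Definition sU : seq JU := [seq (i, k) | i <- enum 'I_d.+1, k <- enum 'I_n.+1].
Definition BV t := derivs_upto (enum 'I_n) t (nondep HV ltV phiL).
Definition BU t := derivs_upto sU t (nondep HU lt psiL).

Lemma all_sV (j : 'I_n) : j \in enum 'I_n. Proof. by rewrite mem_enum. Qed.
Lemma all_sU (u : JU) : u \in sU.
Proof. by case: u => i k; apply/allpairsP; exists (i, k); rewrite !mem_enum. Qed.
Lemma sU_uniq : uniq sU.
Proof. by apply: allpairs_uniq; rewrite ?enum_uniq // => -[a b] [a' b'] _ _ [-> ->]. Qed.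
Lemma size_sU : size sU = (d.+1 * n.+1)%N.
Proof. by rewrite size_allpairs !size_enum_ord. Qed.

Definition alg_family t k (b : 'I_k -> AV) : Prop :=
  (forall i, vin CV XV (fun v => mdeg v.1 <= t)%N (b i)) /\
  forall q : {malg F[{cmonom 'I_k}]}, phiV (pev CV b q) = 0 -> q = 0.
Definition dim_upto t k : Prop :=
  (exists b : 'I_k -> AV, alg_family t b) /\ ~ (exists b : 'I_k.+1 -> AV, alg_family t b).

(** Both inequalities are Steinitz exchange against the transcendence basis of nondep_span. *)
Lemma dim_upto_size t k : dim_upto t k -> k = size (BV t).
Proof.
move=> [[b [vb ib]] nb]; apply/eqP; rewrite eqn_leq; apply/andP; split.
  pose phi : {rmorphism {malg F[{cmonom 'I_k}]} -> L} := phiL \o pev CV b.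
  have := @indep_size _ _ _ _ _ _ (polyring_malg 'I_k F) phi (enum 'I_k)
    [seq phiL (XV w) | w <- BV t] (enum_uniq _).
  rewrite size_enum_ord size_map; apply.
    by move=> p _ p0; apply: ib; apply/phiL0.
  move=> i _; have -> : phi (pX F i) = phiL (b i) by rewrite /phi /= pevX.
  apply: (@alg_cl_base_eq _ _ (phiL \o CV)); first by move=> c; rewrite /phi /= pevC.
  apply: alg_cl_trans (vin_cl (phi := phiL) (vb i)) => _ [v hv ->].
  exact: (free_list_span (H:=HV) (phi:=phiL) rkV all_sV hv).
rewrite leqNgt; apply/negP => lt_k; apply: nb.
have [v0 _] : exists v0, v0 \in BV t by case: (BV t) lt_k => // v0 l _; exists v0; rewrite mem_head.
exists (fun i => XV (nth v0 (BV t) i)).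
have hn (i : 'I_k.+1) : nth v0 (BV t) i \in BV t by apply: mem_nth; apply: leq_trans lt_k.
split=> [i|q].
  by apply: vinX; have := hn i; rewrite mem_derivs_upto => /and3P[].
set b' := fun i : 'I_k.+1 => _.
move/phiL0 => q0; have vq : vin CV XV (fun v => v \in BV t) (pev CV b' q).
  elim: (pr_gen (polyring_malg 'I_k.+1 F) q) => [c|i _|x y _ hx _ hy|x y _ hx _ hy].
  - by rewrite pevC; apply: vinC.
  - by rewrite pevX; apply: vinX; apply: hn.
  - by rewrite rmorphD; apply: vinD.
  by rewrite rmorphM; apply: vinM.
have {}q0 := free_list_indep (H:=HV) (phi:=phiL) rkV all_sV vq q0.
pose g : {rmorphism AV -> {malg F[{cmonom 'I_k.+1}]}} :=
  ev HV malgC (fun v => pX F (inord (index v (BV t)))).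
have gK x : g (pev CV b' x) = x.
  apply: (hom_eq (polyring_malg 'I_k.+1 F) (f := g \o pev CV b') (g := idfun)) => [c|i].
    by rewrite /= pevC /g evC.
  rewrite /= pevX /g /b' evX index_uniq ?inord_val //.
    exact: leq_trans lt_k.
  by apply: derivs_upto_uniq; apply: enum_uniq.
by rewrite -(gK q) q0 rmorph0.
Qed.

Variables (s t0 : nat).
Hypothesis kolchin : forall t, (t0 <= t)%N ->
  exists2 k, dim_upto t k & (k + 'C(m + (t - s), m) = d.+1 * 'C(m + t, m))%N.

Lemma depV_up t v : depV v -> depV (tmul t v).
Proof. exact: (dep_tmul dCV dXV (orderly_ranking rkV) phiL_der char0). Qed.

Lemma depU_up t v : depU v -> depU (tmul t v).
Proof. exact: (dep_tmul dCU dXU (orderly_ranking rk) psiL_der char0). Qed.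

Lemma sizeBV t : (t0 <= t)%N -> (size (BV t) + 'C(m + (t - s), m) = d.+1 * 'C(m + t, m))%N.
Proof. by move=> /kolchin [k /dim_upto_size <-]. Qed.

(** Only the y_j with this property contribute to a transcendence basis, and there are at most
    d + 1 of them, so that they can be given distinct rows. *)
Definition nonfull j := exists th, ~ depV (th, j).
Definition nonfulls : seq 'I_n := [seq j <- enum 'I_n | propb (nonfull j)].
Definition row (j : 'I_n) : 'I_d.+1 := inord (index j nonfulls).

Lemma size_nonfulls : (size nonfulls <= d.+1)%N.
Proof.
rewrite size_filter; apply: (@kolchin_structure m _ (enum 'I_n) depV d.+1 s t0 m2 _ all_sV depV_up _).1.
  exact: enum_uniq.
by move=> t /sizeBV; rewrite size_derivs_upto.
Qed.

Lemma mem_nonfulls j : (j \in nonfulls) = propb (nonfull j).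
Proof. by rewrite mem_filter mem_enum andbT. Qed.

Lemma row_inj i j : nonfull i -> nonfull j -> row i = row j -> i = j.
Proof.
move=> ni nj.
have hi : i \in nonfulls by rewrite mem_nonfulls; apply/propbP.
have hj : j \in nonfulls by rewrite mem_nonfulls; apply/propbP.
move/(congr1 val).
have lt_d x : x \in nonfulls -> (index x nonfulls < d.+1)%N.
  by rewrite -index_mem => h; apply: leq_trans h size_nonfulls.
rewrite /= !inordK ?lt_d // => e.
by rewrite -(nth_index i hi) e nth_index.
Qed.

Lemma BV_indep : indep CV XV phiV (fun v => ~ depV v).
Proof.
move=> p vp /phiL0 p0.
exact: (indep_free (H := HV) (orderly_ranking rkV) (ex_intro _ _ all_sV) vp p0).
Qed.

Definition isUb : pred (deriv_of m JU) := fun v => v.2.2 != ord0.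
Definition ZU t := derivs_upto sU t isUb.

Lemma ord_lift0 (k : 'I_n.+1) : k != ord0 -> exists j, k = lift ord0 j.
Proof. by case: (unliftP ord0 k) => [j ->|->]; [exists j | rewrite eqxx]. Qed.

Lemma mem_ZU t v : v \in ZU t <-> isUu v /\ (mdeg v.1 <= t)%N.
Proof.
rewrite mem_derivs_upto all_sU /= /isUb; split=> [/andP[h ht]|[[i [j e]] ht]].
  split=> //; have [j e] := ord_lift0 h; exists v.2.1, j.
  by rewrite -e; case: (v.2).
by rewrite e /= ht.
Qed.

Lemma size_ZU t : size (ZU t) = (d.+1 * n * 'C(m + t, m))%N.
Proof.
rewrite size_derivs_upto (bigID (fun u : JU => u.2 != ord0)) /= [X in (_ + X)%N]big1 ?addn0.
  rewrite (eq_bigr (fun=> 'C(m + t, m))) => [|u hu]; last first.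
    by rewrite -size_mons -count_predT; apply: eq_count => th; rewrite /isUb.
  rewrite big_const_seq iter_addn_0 mulnC; congr (_ * _)%N.
  rewrite /sU; have -> : forall l : seq 'I_d.+1,
      count (fun u : JU => u.2 != ord0) [seq (i, k) | i <- l, k <- enum 'I_n.+1] = (size l * n)%N.
    elim=> //= i l IH; rewrite count_cat IH mulSn; congr (_ + _)%N.
    rewrite count_map enum_ordSl /= add0n count_map -[RHS](size_enum_ord n) -count_predT.
    exact: eq_count.
  by rewrite size_enum_ord.
by move=> u /negbNE /eqP hu; apply/eqP; rewrite -leqn0 leqNgt -has_count -all_predC; apply/allP => th _; rewrite /= /isUb hu.
Qed.

Definition linY i : AY :=
  - \sum_(j < n) XY (mone, inr (i, lift ord0 j)) * XY (mone, inl j).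

Lemma kap_linY i : kap (linY i) = zeta i.
Proof.
rewrite /linY rmorphN rmorph_sum /zeta; congr (- _); apply: eq_bigr => j _ /=.
by rewrite (rmorphM kap) !kapX1 /= yUlift.
Qed.

Lemma theta_linY t i :
  vin CY XY (fun v => (isY v \/ isU v) /\ (mdeg v.1 <= mdeg t)%N) (theta t (linY i)).
Proof.
elim/cmonom_ind: t => [|k t IH].
  rewrite theta1; apply: vinN; apply: vin_sum => j _; apply: vinM; apply: vinX; split=> //=.
    by right; exists i, j.
  by left; exists j.
rewrite theta_mulU mdegM mdegU; apply: (dder_vin dCY dXY _ IH) => v [h hv].
split; (split; last by rewrite /= ?mdegM ?mdegU ?leq_add2l // (leq_trans hv) // leq_addl).
  exact: h.
by case: h => [[j e]|[i' [j e]]]; [left; exists j|right; exists i', j].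
Qed.

Let upper_gens t : seq L := [seq psiL (XU w) | w <- ZU t] ++ [seq phiL (XV w) | w <- BV t].

(** A derivative of zeta_i of order at most t is a polynomial in derivatives of the u_ij and the
    xi_j of order at most t. *)
Lemma upper_span t v : (mdeg v.1 <= t)%N ->
  alg_cl (psiL \o CU) (fun z => z \in upper_gens t) (psiL (XU v)).
Proof.
move=> ht; have [h|h] := eqVneq v.2.2 ord0; last first.
  apply: alg_cl_id; rewrite mem_cat; apply/orP; left; apply: map_f; apply/mem_ZU.
  by split=> //; have [j e] := ord_lift0 h; exists v.2.1, j; rewrite -e; case: (v.2).
have [sf _] := alg_cl_closed (psiL \o CU) (fun z => z \in upper_gens t).
have -> : psiL (XU v) = hL (kap (theta v.1 (linY v.2.1))).
  rewrite (dmorph_theta kap_D) kap_linY /= psiX; congr (hL (theta _ _)).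
  by case: v h {ht} => th [i k] /= ->; apply: yU0.
elim: (theta_linY v.1 v.2.1) => [c|[th x] [hx hth]|x y _ hx _ hy|x y _ hx _ hy].
- have -> : hL (kap (CY c)) = (psiL \o CU) c by rewrite /= /kap /psi !devC.
  exact: alg_cl_base.
- simpl in hth; rewrite kapX; case: hx => [[j /= ->]|[i [j /= ->]]] /=.
    have -> : hL (theta th (CB (xi j))) = phiL (XV (th, j)).
      by rewrite /= /phiV devX /= -(dmorph_theta (g := CB)).
    have := free_list_span (H := HV) (phi := phiL) rkV all_sV (leq_trans hth ht : (mdeg (th, j).1 <= t)%N).
    move/(@alg_cl_base_eq _ _ _ (psiL \o CU)) => /(_ _) h1.
    have {}h1 := h1 (fun c => _); apply: alg_cl_mono (h1 _) => [z hz|c].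
      by rewrite mem_cat hz orbT.
    by rewrite /= /phiV /psi !devC.
  apply: alg_cl_id; rewrite mem_cat; apply/orP; left; apply/mapP; exists (th, (i, lift ord0 j)).
    by apply/mem_ZU; split; [exists i, j | apply: leq_trans hth ht].
  by rewrite /= psiX.
- by rewrite !rmorphD; apply: (subfD sf).
by rewrite !rmorphM; apply: (subfM sf).
Qed.

(** With size_BU_lower: up to order t, passing from V to the ideal of the Chow form adds to the
    dimension all the derivatives of the u_ij with j positive. *)
Lemma size_BU_upper t : (size (BU t) <= d.+1 * n * 'C(m + t, m) + size (BV t))%N.
Proof.
rewrite -size_ZU; have <- : size (upper_gens t) = (size (ZU t) + size (BV t))%N.
  by rewrite size_cat !size_map.
apply: (indep_size HU (phi := psiL) (t := BU t)).
- exact: derivs_upto_uniq sU_uniq.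
- by move=> p; apply: (free_list_indep (H := HU) (phi := psiL) rk all_sU).
by move=> v; rewrite mem_derivs_upto => /and3P[_ _ h]; apply: upper_span.
Qed.

Let lower_vars t : seq (deriv_of m JU) := ZU t ++ [seq (v.1, (row v.2, ord0)) | v <- BV t].

Lemma memBV t v : v \in BV t -> ~ depV v /\ (mdeg v.1 <= t)%N.
Proof. by rewrite mem_derivs_upto => /and3P[/negP h _ ht]; split=> // h'; apply: h; apply/propbP. Qed.

Lemma size_BU_lower t : (d.+1 * n * 'C(m + t, m) + size (BV t) <= size (BU t))%N.
Proof.
rewrite -size_ZU; have <- : size (lower_vars t) = (size (ZU t) + size (BV t))%N.
  by rewrite size_cat !size_map.
rewrite -[X in (_ <= X)%N](size_map (fun w => psiL (XU w))).
apply: (indep_size HU (phi := psiL) (t := lower_vars t)).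
- rewrite cat_uniq derivs_upto_uniq ?sU_uniq //=; apply/andP; split.
    apply/hasPn => _ /mapP [v _ ->]; apply/negP => /mem_ZU [[i [j e]] _].
    by have := congr1 snd e => /= /eqP; rewrite (negPf (neq_lift ord0 j)).
  rewrite map_inj_in_uniq ?derivs_upto_uniq ?enum_uniq // => v w hv hw [e1 e2].
  have [nv _] := memBV hv; have [nw _] := memBV hw.
  have e3 : v.2 = w.2.
    apply: row_inj; [exists v.1 | exists w.1 |]; first by case: (v) nv.
      by case: (w) nw.
    by apply: val_inj; move: e2; rewrite /row => ->.
  by case: v w e1 e3 {hv hw e2 nv nw} => [a b] [a' b'] /= -> ->.
- move=> p vp /psiL0 p0.
  apply: (lower_indep (P0 := nonfull) (r := row) (Bt := fun v => ~ depV v) row_inj _ BV_indep _ p0).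
    by move=> [th j] h; exists th.
  apply: vinW vp _ => v; rewrite mem_cat => /orP[/mem_ZU [h _]|/mapP [w hw ->]]; first by right.
  by left; exists w.2; split=> //; have [nw _] := memBV hw; case: (w) nw.
move=> v hv; apply: (free_list_span (H := HU) (phi := psiL) rk all_sU).
move: hv; rewrite mem_cat => /orP[/mem_ZU [_ //]|/mapP [w hw ->]] /=.
by case: (memBV hw).
Qed.

(** There are (d + 1)(n + 1) indeterminates u_ij and the Kolchin function of the ideal is
    (d + 1)(n + 1) C(t + m, m) - C(t + m - s, m): the extremal case of kolchin_structure. *)
Lemma chow_principal : exists v0, mdeg v0.1 = s /\ forall v, depU v <-> exists t, v = tmul t v0.
Proof.
apply: (@kolchin_structure m _ sU depU (d.+1 * n.+1) s t0 m2 sU_uniq all_sU depU_up _).2.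
  move=> t ht; rewrite -(size_derivs_upto sU t (nondep HU lt psiL)) -/(BU t).
  have -> : size (BU t) = (d.+1 * n * 'C(m + t, m) + size (BV t))%N.
    by apply/eqP; rewrite eqn_leq size_BU_upper size_BU_lower.
  by rewrite -addnA sizeBV // -mulnDl mulnS addnC.
exact: size_sU.
Qed.

End Count.
End ChowKernel.

(** * Initials and separants of explicit polynomials *)

Lemma bigmax_witness (T : eqType) (f : T -> nat) (s : seq T) x0 : x0 \in s ->
  exists2 x, x \in s & f x = \max_(y <- s) f y.
Proof.
elim: s x0 => // x s IH x0 _; rewrite big_cons; case: s IH => [|x1 s] IH.
  by exists x; rewrite ?inE // big_nil maxn0.
have [y hy ey] := IH x1 (mem_head _ _).
have [h|h] := leqP (f x) (\max_(j <- x1 :: s) f j).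
  by exists y => //; rewrite inE hy orbT.
by exists x; rewrite ?mem_head.
Qed.

Section RawUni.
Variables (W : choiceType) (R : comNzRingType).
Local Notation A := {malg R[{cmonom W}]}.
Let H := polyring_malg W R.
Implicit Types (p : A) (v : W) (M : {cmonom W}).

(** Defined by a division, as the initial is; strip_eq shows that at the exponent of v in M it removes v. *)
Definition strip v k M : {cmonom W} := divcm M (expcmn (ucm v) k).

Lemma strip_eq v M : mmul (strip v (M v) M) (expcmn (ucm v) (M v)) = M.
Proof.
apply: cm_ext => w; rewrite cmM divcmE expcmnE cmU.
by have [->|_] := eqVneq v w; rewrite ?mul1n ?subnK // mul0n subn0 addn0.
Qed.

Lemma malg_decomp v p :
  p = \sum_(M <- msupp p) << p@_M *g strip v (M v) M >> * pX R v ^+ M v.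
Proof.
rewrite {1}(monalgE p); apply: eq_bigr => M _.
by rewrite pXexp malgUU mulr1 strip_eq.
Qed.

Lemma strip_vin v c M : vin (@malgC {cmonom W} R) (@pX W R) (fun w => w <> v) << c *g strip v (M v) M >>.
Proof.
apply/vin_pvars => w /pvarsP [N hN].
have /fsubsetP/(_ _ hN) := @msuppU_le {cmonom W} R (strip v (M v) M) c.
rewrite in_fset1 => /eqP->; apply: contra_neq_not => ->.
by rewrite /strip divcmE expcmnE cmUU mul1n subnn.
Qed.

Lemma uni_decomp v p :
  uni H v p = \sum_(M <- msupp p) (<< p@_M *g strip v (M v) M >>)%:P * 'X^(M v).
Proof.
rewrite {1}(malg_decomp v p).
exact: (@uni_sum _ _ _ _ _ H v _ (msupp p) (fun M => << p@_M *g strip v (M v) M >>)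
  (fun M => M v) (fun M => strip_vin v _ M)).
Qed.

Lemma separant_uni v p :
  \sum_(M <- msupp p) << p@_M *+ M v *g divcm M (ucm v) >> = ((uni H v p)^`()).[pX R v].
Proof.
rewrite uni_decomp [X in X.[_]]raddf_sum horner_sum; apply: eq_bigr => M _.
rewrite /= derivM derivC mul0r add0r derivXn hornerM hornerC hornerMn hornerXn.
have [->|h] := posnP (M v); first by rewrite mulr0n monalgU0 mulr0n mulr0.
rewrite mulrnAr pXexp malgUU mulr1 -monalgUMn.
apply: (congr1 (fun N : {cmonom W} => << p@_M *+ M v *g N >>)).
apply: cm_ext => w; rewrite cmM /strip !divcmE !expcmnE cmU.
have [<-|_] := eqVneq v w; last by rewrite !mul0n !subn0 addn0.
by rewrite !mul1n subnn add0n subn1.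
Qed.

Definition degv v p : nat := \max_(M <- msupp p) M v.

Lemma initial_uni v p :
  \sum_(M <- msupp p | M v == degv v p) << p@_M *g strip v (degv v p) M >> = (uni H v p)`_(degv v p).
Proof.
rewrite uni_decomp coef_sum big_mkcond /=; apply: eq_bigr => M _.
rewrite coefCM coefXn eq_sym; case: eqP => [<-|_]; first by rewrite mulr1.
by rewrite mulr0.
Qed.

Lemma degv_witness v p : p != 0 -> exists2 M, M \in msupp p & M v = degv v p.
Proof.
rewrite -msupp_eq0 => /fset0Pn [M0 hM0].
exact: (bigmax_witness (fun M : {cmonom W} => M v) hM0).
Qed.

(** Distinct monomials with the same exponent of v stay distinct when v is removed. *)
Lemma initial_neq0 v p : p != 0 -> (uni H v p)`_(degv v p) != 0.
Proof.
move=> p0; have [M hM MD] := degv_witness v p0.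
apply: contraTneq (hM) => h0; rewrite -mcoeff_neq0 negbK.
have := congr1 (fun q => q * pX R v ^+ degv v p) h0.
rewrite mul0r -initial_uni mulr_suml => h1.
have := congr1 (mcoeff M) h1; rewrite mcoeff0 raddf_sum /=.
rewrite (eq_bigr (fun M' => p@_M' *+ (M' == M))); last first.
  move=> M' /eqP e; rewrite pXexp malgUU mulr1 -e strip_eq.
  exact: mcoeffU.
rewrite big_mkcond (bigD1_seq M hM (fset_uniq _)) /= -MD !eqxx mulr1n big1 => [|M' /negPf->].
  by rewrite addr0 => ->.
by rewrite mulr0n if_same.
Qed.
End RawUni.

(** * Differential polynomials *)

Lemma rmorph_invertible (K : fieldType) (A : comNzRingType) (f : {rmorphism K -> A}) c :
  c != 0 -> invertible (f c).
Proof. by move=> c0; exists (f c^-1); rewrite -rmorphM divff // rmorph1. Qed.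

Section Dpoly.
Variables (m : nat) (F : diffFieldType m) (I : choiceType).
Local Notation W := (deriv_of m I).
(** The ring of differential polynomials under a name that keeps unification from unfolding it. *)
Definition dpA : diffRingType m := dpoly m F I.
Definition dpC : {rmorphism F -> dpA} := @malgC {cmonom W} F.
Definition dpX : W -> dpA := @pX W F.

Definition dp_ring : polyring dpC dpX := polyring_malg W F.
Lemma dp_dC k c : dder k (dpC c) = dpC (dder k c). Proof. exact: dpoly_derC. Qed.
Lemma dp_dX k v : dder k (dpX v) = dpX (dshift k v). Proof. exact: dpoly_derV. Qed.

Lemma dp_vin T (p : dpA) : vin dpC dpX T p <-> forall v, v \in dvars p -> T v.
Proof. exact: vin_pvars. Qed.

Lemma deval_dev (S : diffRingType m) (f : {rmorphism F -> S}) (a : I -> S) (p : dpA) :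
  deval f a p = dev dp_ring f a p.
Proof.
apply: (hom_eq dp_ring (f := pev f (fun v : W => theta v.1 (a v.2))) (g := dev dp_ring f a)).
  by move=> c; rewrite devC; apply: pevC.
by move=> v; rewrite devX; apply: pevX.
Qed.

Lemma dord_le (p : dpA) t : (dord p <= t)%N <-> vin dpC dpX (fun v => mdeg v.1 <= t)%N p.
Proof.
rewrite dp_vin /dord; split=> [h v hv|h].
  by apply: leq_trans h; apply: (leq_bigmax_seq (F := fun v : W => mdeg v.1)).
by apply/bigmax_leqP_seq => v hv _; apply: h.
Qed.

Lemma dseparant_dsep u (p : dpA) : dseparant p u = dsep dp_ring u p.
Proof. exact: (separant_uni u p). Qed.

Lemma dinitial_coef u (p : dpA) : dinitial p u = (uni dp_ring u p)`_(ddeg p u).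
Proof. exact: (initial_uni u p). Qed.

Lemma dinitial_neq0 u (p : dpA) : p != 0 -> dinitial p u != 0.
Proof. by move=> p0; rewrite dinitial_coef; apply: (initial_neq0 u p0). Qed.

Section Leader.
Variable lt : rel W.
Hypothesis rk : is_ranking lt.

Lemma leader_lead (G : dpA) u : G != 0 -> is_leader lt G u -> lead_at dp_ring lt G u (dinitial G u).
Proof.
move=> G0 [uG uM].
have vG : vin dpC dpX (upto lt u) G.
  apply/dp_vin => v hv; have [->|ne] := eqVneq v u; first by left.
  by right; apply: uM.
split=> //.
- rewrite ltnNge; apply/negP => h.
  by have /dp_vin /(_ u uG) [_] := uni_size1 vG h; apply.
- exact: dinitial_neq0.
split=> [|T hT]; rewrite dinitial_coef; first exact: upto_tail.
by apply: vinW (uni_coef_vin dp_ring u _ hT) _ => v [].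
Qed.

Lemma leader_uniq (G : dpA) u u' : is_leader lt G u -> is_leader lt G u' -> u = u'.
Proof.
move=> [uG uM] [u'G u'M]; apply: NNPP => /eqP ne.
by apply: (rk_asym rk (u'M _ uG ne) (uM _ u'G _)); rewrite eq_sym.
Qed.

Lemma irreducible_leader (G : dpA) : is_irreducible G -> exists u, is_leader lt G u.
Proof.
move=> [G0 Gu _].
have [[v hv]|nv] := classic (exists v, v \in dvars G).
  by have [u h1 h2] := rk_max rk hv; exists u.
case: Gu; have vG : vin dpC dpX (fun=> False) G.
  by apply/dp_vin => v hv; apply: nv; exists v.
have [c e] := vin_const vG (fun _ h => h).
have c0 : c != 0 by apply/eqP => c0; apply: G0; rewrite e c0 rmorph0.
rewrite e; exact: rmorph_invertible c0.
Qed.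

Lemma dsat_by (G : dpA) u p : is_leader lt G u ->
  (dsat lt G p <-> sat_by dp_ring G u (dinitial G u) p).
Proof.
move=> lu; split=> [[u' [lu' [a [b h]]]]|[a [b h]]].
  rewrite -(leader_uniq lu lu') in h; exists a, b.
  by rewrite -dseparant_dsep.
by exists u; split=> //; exists a, b; rewrite dseparant_dsep.
Qed.
End Leader.
End Dpoly.

(** * The differential Chow form *)

(** At natural numbers t that are at least s the polynomial binomial coefficient is the
    combinatorial one; below s it need not be, hence the threshold t0 + s used later on. *)
Lemma binomial_eval (m s t : nat) : (s <= t)%N ->
  (binomial_poly (m%:R - s%:R) m).[t%:R] = 'C(m + (t - s), m)%:R.
Proof.
move=> st; rewrite /binomial_poly hornerZ horner_prod.
have -> : \prod_(i < m) ('X + (m%:R - s%:R - i%:R)%:P : {poly rat}).[t%:R] = ((m + (t - s)) ^_ m)%:R.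
  rewrite ffact_prod natr_prod; apply: eq_bigr => i _.
  rewrite hornerD hornerX hornerC natrB ?natrD ?natrB //; first by ring.
  by apply: leq_trans (leq_addr _ _); apply: ltnW.
by rewrite -bin_ffact natrM mulrC mulfK // Num.Theory.pnatr_eq0 -lt0n fact_gt0.
Qed.

Lemma dideal_gen_ext m (R : diffRingType m) (S S' : R -> Prop) x :
  (forall y, S y -> S' y) -> dideal_gen S x -> dideal_gen S' x.
Proof. by move=> h hx I hI hS; apply: hx => // y /h; apply: hS. Qed.

Section Link.
Variables (m n d : nat) (F E : diffFieldType m) (iota : {rmorphism F -> E}).
Variables (V : ('I_n -> E) -> Prop) (xi : 'I_n -> E).
Hypothesis gen_xi : is_generic iota V xi.
Local Notation HV := (dp_ring F 'I_n).
Local Notation HU := (dp_ring F (uvar n d)).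
Local Notation HY := (dp_ring F (JY n d)).

Lemma vanishing_phi p : vanishing iota V p <-> phiV iota HV xi p = 0.
Proof. by rewrite gen_xi deval_dev. Qed.

Lemma mev_ord (k : nat) (S : comNzRingType) (x : 'I_k -> S) (M : {cmonom 'I_k}) :
  mev x M = \prod_i x i ^+ M i.
Proof.
rewrite /mev (big_uniq _ (fset_uniq _)) big_mkcond /=; apply: eq_bigr => i _.
by case: ifP => // /negbT; rewrite -cmE_eq0 => /eqP ->; rewrite expr0.
Qed.

Lemma alg_independent_pev k (b : 'I_k -> dpA F 'I_n) (q : {malg F[{cmonom 'I_k}]}) :
  mmap malgC (fun M : {cmonom 'I_k} => \prod_i b i ^+ M i) q = pev (dpC F 'I_n) b q.
Proof. by apply: eq_bigr => M _; rewrite mev_ord. Qed.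

Lemma is_dim_upto_dim t k : is_dim_upto iota V t k -> dim_upto iota HV xi t k.
Proof.
have e l (b : 'I_l -> dpoly m F 'I_n) :
    ((forall i, (dord (b i) <= t)%N) /\ alg_independent_mod (vanishing iota V) b) <->
    alg_family iota HV xi t b.
  split=> [[h1 h2]|[h1 h2]]; split.
  - by move=> i; apply/dord_le.
  - by move=> q /vanishing_phi hq; apply: h2; rewrite alg_independent_pev.
  - by move=> i; apply/dord_le.
  by move=> q; rewrite alg_independent_pev => /vanishing_phi; apply: h2.
move=> [[b hb] nb]; split; first by exists b; apply/e.
by move=> [b' hb']; apply: nb; exists b'; apply/e.
Qed.

Lemma kolchin_nat s t0 t k : (t0 + s <= t)%N ->
  ((d.+1)%:R *: binomial_poly m%:R m - binomial_poly (m%:R - s%:R) m).[t%:R] = k%:R ->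
  (k + 'C(m + (t - s), m) = d.+1 * 'C(m + t, m))%N.
Proof.
move=> st; have st' : (s <= t)%N by apply: leq_trans (leq_addl _ _) st.
rewrite hornerD hornerN hornerZ binomial_eval //.
have -> : binomial_poly m%:R m = binomial_poly (m%:R - 0%:R) m by rewrite subr0.
rewrite binomial_eval // subn0 => e; apply/eqP.
by rewrite -(Num.Theory.eqr_nat rat) natrD natrM -e subrK.
Qed.

Lemma drename_renL (p : dpA F 'I_n) : @drename m F 'I_n (JY n d) inl p = renL (dpC F (JY n d)) (@dpX m F (JY n d)) HV p.
Proof. exact: deval_dev. Qed.

Lemma drename_renR (p : dpA F (uvar n d)) : @drename m F (uvar n d) (JY n d) inr p = renR (dpC F (JY n d)) (@dpX m F (JY n d)) HU p.
Proof. exact: deval_dev. Qed.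

Lemma chow_ideal_chowY p : @chow_ideal m n F E iota V d (drename inr p) <->
  chowY iota (dpC F (JY n d)) (@dpX m F (JY n d)) HV xi (renR (dpC F (JY n d)) (@dpX m F (JY n d)) HU p).
Proof.
rewrite drename_renR; split; apply: dideal_gen_ext => y [[q hq ->]|[i ->]].
- by left; exists q; [apply/vanishing_phi | apply: drename_renL].
- by right; exists i.
- by left; exists q; [apply/vanishing_phi | apply/esym/drename_renL].
by right; exists i.
Qed.

End Link.

Section ChowForm.
Variables (m n d s : nat) (F E : diffFieldType m) (iota : {rmorphism F -> E}).
Variables (lt : rel (deriv_of m (uvar n d))) (V : ('I_n -> E) -> Prop) (xi : 'I_n -> E).
Hypothesis iotaD : is_dmorphism iota.
Hypothesis m2 : (2 <= m)%N.
Hypothesis char0 : [pchar F] =i pred0.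
Hypothesis rk : is_ranking lt.
Hypothesis gen_xi : is_generic iota V xi.
Hypothesis kol : is_kolchin_poly iota V
  ((d.+1)%:R *: binomial_poly m%:R m - binomial_poly (m%:R - s%:R) m).
Local Notation HU := (dp_ring F (uvar n d)).
Local Notation HV := (dp_ring F 'I_n).
Local Notation HY := (dp_ring F (JY n d)).
Local Notation HB := (dp_ring E (JB n d)).
Local Notation dC := (@dp_dC _ _ _).
Local Notation dX := (@dp_dX _ _ _).

(** The polynomial of ker_sat for the orderly ranking derived from lt has leader of order s, hence has
    order s.  The description of the ideal as a saturation is for lt itself. *)
Lemma chow_generator : exists G : dpA F (uvar n d),
  [/\ is_irreducible G,
      forall u I p, lead_at HU lt G u I ->
        (@chow_ideal m n F E iota V d (drename inr p) <-> sat_by HU G u I p) &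
      dord G = s].
Proof.
have [L [hL hL_inj]] := embed_in_field (@poly_domain _ _ _ _ _ HB).
have [t0 hk] := kol.
have kolchin : forall t, (t0 + s <= t)%N ->
    exists2 k, dim_upto iota HV xi t k & (k + 'C(m + (t - s), m) = d.+1 * 'C(m + t, m))%N.
  move=> t ht; have [k hd hw] := hk t (leq_trans (leq_addr _ _) ht).
  exists k; first exact: (is_dim_upto_dim gen_xi hd).
  exact: (kolchin_nat ht hw).
have [v0 [v0s hdep]] := chow_principal iotaD HU HY HB
  dC dX dC dX dC dX dC dX hL_inj char0 rk m2 kolchin.
have finU : exists l : seq (uvar n d), forall j, j \in l by exists (sU n d); exact: all_sU.
have rko := orderly_ranking rk.
have [G [iG GK vG sG]] := generator_exists finU rko hdep.
exists G; split=> //.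
  move=> u I p lead; rewrite (chow_ideal_chowY gen_xi).
  rewrite (chow_renR iotaD HV HU HY HB dC dX dC dX dC dX dC dX xi p).
  rewrite -(psiL0 iota (dpC E (JB n d)) (@dpX m E (JB n d)) HU xi hL_inj p).
  apply: (ker_sat dC dX char0 finU _ rko hdep iG GK vG sG p rk lead).
  exact: (psiL_der iotaD dC dX dC hL_inj).
apply/eqP; rewrite eqn_leq; apply/andP; split.
  apply/dord_le; apply: vinW vG _ => v [->|/orderly_mdeg]; first by rewrite v0s.
  by rewrite v0s.
rewrite -v0s; have v0G : v0 \in dvars G.
  apply: contraLR sG => nv; rewrite -leqNgt.
  apply: (vin_avoid (T := fun v => v \in dvars G) HU _); first exact/dp_vin.
  exact/negP.
have /dord_le /dp_vin h := leqnn (dord G).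
exact: h.
Qed.

(** Units are constants and factors have no new variables. *)
Lemma associates_dord (c G G' : dpA F (uvar n d)) :
  G' <> 0 -> invertible c -> G' = c * G -> dord G' = dord G.
Proof.
move=> G'0 ic e.
have k t : (dord G' <= t)%N <-> (dord G <= t)%N.
  split=> /dord_le h; apply/dord_le; last first.
    by rewrite e; apply: vinM h; apply: (invertible_vin HU _ ic).
  by apply: (vin_factor HU (q := c)); rewrite mulrC -e //; apply/eqP.
by apply/eqP; rewrite eqn_leq; apply/andP; split; apply/k.
Qed.

Lemma chow_form_exists : exists G : dpoly m F (uvar n d), is_chow_form iota V lt G.
Proof.
have [G [iG hG _]] := chow_generator.
have [u lu] := irreducible_leader rk iG.
have [/eqP G0 _ _] := iG.
exists G; split=> // p.
rewrite (hG u _ p (leader_lead G0 lu)).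
exact: iff_sym (dsat_by rk p lu).
Qed.

Lemma chow_form_dord (G : dpoly m F (uvar n d)) : is_chow_form iota V lt G -> dord G = s.
Proof.
move=> [iG' hG']; have [G0 [iG hG <-]] := chow_generator.
have [u lu] := irreducible_leader rk iG; have [u' lu'] := irreducible_leader rk iG'.
have [/eqP n0 _ _] := iG; have [/eqP n0' _ _] := iG'.
have l0 := leader_lead n0 lu; have l0' := leader_lead n0' lu'.
have [|c ic [e|e]] := generator_unique dC dX char0 rk iG iG' l0 l0'.
- move=> p; rewrite -(hG u _ p l0) hG'; exact: dsat_by.
- by apply: (associates_dord _ ic e); apply/eqP.
by apply/esym; apply: (associates_dord _ ic e); apply/eqP.
Qed.
End ChowForm.

Theorem theorem4p5 (m n d s : nat) (F E : diffFieldType m) (iota : {rmorphism F -> E})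
    (lt : rel (deriv_of m (uvar n d))) (V : ('I_n -> E) -> Prop) :
  (2 <= m)%N ->
  [pchar F] =i pred0 ->
  is_universal iota ->
  is_ranking lt ->
  is_dvariety iota V ->
  is_prime (vanishing iota V) ->
  is_ddim iota V d ->
  is_kolchin_poly iota V
    ((d.+1)%:R *: binomial_poly m%:R m - binomial_poly (m%:R - s%:R) m) ->
  (exists G : dpoly m F (uvar n d), is_chow_form iota V lt G) /\
  (forall G : dpoly m F (uvar n d), is_chow_form iota V lt G -> dord G = s).
Proof.
move=> m2 char0 [iotaD _] rk _ _ [xi [gen_xi _]] kol; split.
  exact: chow_form_exists iotaD m2 char0 rk gen_xi kol.
by move=> G; apply: chow_form_dord iotaD m2 char0 rk gen_xi kol G.
Qed.
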